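(* Let $\mathbb L\in\{\mathbb R,\mathbb C\}$, $\mathbb K\in\{\mathbb R,\mathbb L\}$, $s\in\{\infty,\omega\}$, and $r\in\mathbb N\cup\{\infty,\omega\}$ with $r\le s$. Let $G$ be a $C^s_{\mathbb K}$-Lie group, $M$ be a $C^r_{\mathbb K}$-manifold with a $C^r_{\mathbb K}$-action $\alpha\colon G\times M\to M$, and let $\pi\colon E\to M$ be an equivariant $\mathbb L$-vector bundle of class $C^r_{\mathbb K}$ over $(M,\alpha)$, with typical fibre $F$ and $G$-action $\beta\colon G\times E\to E$. Let $\widetilde F\supseteq F$ be a completion of $F$ and, for $x\in M$, let $\widetilde E_x\supseteq E_x$ be a completion of $E_x$, chosen pairwise disjoint. Let $\widetilde E:=\bigcup_{x\in M}\widetilde E_x$, with $\widetilde\pi\colon\widetilde E\to M$ taking elements of $\widetilde E_x$ to $x$, and define $\widetilde\beta\colon G\times\widetilde E\to\widetilde E$ by letting $\widetilde\beta(g,\cdot)|_{\widetilde E_x}\colon\widetilde E_x\to\widetilde E_{\alpha(g,x)}$ be the continuous linear extension of $\beta(g,\cdot)|_{E_x}\colon E_x\to E_{\alpha(g,x)}$. Then $(\widetilde E,\widetilde\beta)$ can be made an equivariant $\mathbb L$-vector bundle of class $C^{r-1}_{\mathbb K}$ over the $G$-manifold $M$ (with bundle projection $\widetilde\pi$ and typical fibre $\widetilde F$) such that for each local trivialization $\psi\colon\pi^{-1}(U)\to U\times F$ of $E$, the map $$\widetilde\psi\colon\widetilde\pi^{-1}(U)\to U\times\widetilde F,\quad \widetilde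 E_x\ni v\mapsto\bigl(x,(\mathrm{pr}_F\circ\psi|_{E_x})^{\sim}(v)\bigr)$$ is a local trivialization of $\widetilde E$, where $(\mathrm{pr}_F\circ\psi|_{E_x})^{\sim}\colon\widetilde E_x\to\widetilde F$ is the continuous linear extension of $\mathrm{pr}_F\circ\psi|_{E_x}\colon E_x\to F$.
   Context: All locally convex spaces are Hausdorff; manifolds and Lie groups are modeled on (possibly infinite-dimensional) locally convex $\mathbb K$-spaces. $n<\infty<\omega$ for $n\in\mathbb N_0$; $\infty-1:=\infty$, $\omega-1:=\omega$. Complex spaces are regarded as real ones when $\mathbb K=\mathbb R$. $C^r_{\mathbb K}$-maps (Keller's $C^r_c$-theory): for $r\in\mathbb N_0\cup\{\infty\}$, a map $f\colon U\to H$ from an open subset $U$ of a locally convex $\mathbb K$-space $X$ to a locally convex $\mathbb K$-space $H$ is $C^r_{\mathbb K}$ if it is continuous and for all $j\in\mathbb N$ with $j\le r$ the iterated directional derivatives $d^jf(x,y_1,\ldots,y_j)=(D_{y_j}\cdots D_{y_1}f)(x)$ (over $\mathbb K$) exist and define a continuous map $U\times X^j\to H$. $C^\omega_{\mathbb C}$ means complex analytic (continuous and locally a pointwise convergent series of continuous homogeneous complex polynomials; equivalent to $C^\infty_{\mathbb C}$); $C^\omega_{\mathbb R}$ means: extends to a complex analytic map to $H_{\mathbb C}$ on an open neighbourhood of $U$ in $X_{\mathbb C}$. Manifolds and Lie groups of class $C^r_{\mathbb K}$ are defined as usual. An $\mathbb L$-vector bundle of class $C^r_{\mathbb K}$ over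 $M$ with typical fibre a locally convex $\mathbb L$-vector space $F$ is a $C^r_{\mathbb K}$-manifold $E$ with a surjective $C^r_{\mathbb K}$-map $\pi\colon E\to M$ and an $\mathbb L$-vector space structure on each fibre $E_x=\pi^{-1}(\{x\})$ such that each $x\in M$ has an open neighbourhood $U\subseteq M$ with a $C^r_{\mathbb K}$-diffeomorphism $\psi\colon\pi^{-1}(U)\to U\times F$ (a local trivialization) satisfying $\psi(E_y)=\{y\}\times F$ and $\mathrm{pr}_F\circ\psi|_{E_y}\colon E_y\to F$ $\mathbb L$-linear for all $y\in U$ ($\mathrm{pr}_F$ is the projection to $F$). Fibres carry the topology induced by $E$, making them locally convex spaces isomorphic to $F$. A $G$-manifold of class $C^r_{\mathbb K}$ is a $C^r_{\mathbb K}$-manifold $M$ with a $C^r_{\mathbb K}$-action $\alpha\colon G\times M\to M$. An equivariant $\mathbb L$-vector bundle of class $C^r_{\mathbb K}$ over $(M,\alpha)$ is an $\mathbb L$-vector bundle $\pi\colon E\to M$ of class $C^r_{\mathbb K}$ with a $C^r_{\mathbb K}$-action $\beta\colon G\times E\to E$ such that $\beta(g,E_x)\subseteq E_{\alpha(g,x)}$ and $\beta(g,\cdot)|_{E_x}\colon E_x\to E_{\alpha(g,x)}$ is $\mathbb L$-linear for all $(g,x)\in G\times M$. *)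

(* Defs.v *)
From HB Require Import structures.
From mathcomp Require Import all_boot all_order all_algebra.
From mathcomp Require Import complex.
From mathcomp Require Import all_classical all_reals all_analysis.

Set Implicit Arguments.
Unset Strict Implicit.
Unset Printing Implicit Defensive.

Import Order.TTheory GRing.Theory Num.Theory.
Import numFieldNormedType.Exports.

Local Open Scope classical_set_scope.
Local Open Scope ring_scope.

(* Formal names for the two fields, so that the three admissible pairs (K, L)
   can be treated uniformly. *)
Inductive scalars := RealScalars | ComplexScalars.

Definition fld (R : realType) (k : scalars) : numFieldType :=
  match k with
  | RealScalars => R : numFieldType
  | ComplexScalars => R[i] : numFieldType
  end.

Definition emb (R : realType) (K L : scalars) (h : K = RealScalars \/ K = L) :
    fld R K -> fld R L :=
  match K, L return K = RealScalars \/ K = L -> fld R K -> fld R L with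
  | RealScalars, RealScalars => fun _ x => x
  | RealScalars, ComplexScalars => fun _ x => (x%:C)%C
  | ComplexScalars, ComplexScalars => fun _ x => x
  | ComplexScalars, RealScalars => fun h =>
      False_rect _ (match h with
                    | or_introl e => ltac:(discriminate e)
                    | or_intror e => ltac:(discriminate e)
                    end)
  end h.

Section emb_theory.
Context (R : realType) (K L : scalars) (h : K = RealScalars \/ K = L).

Lemma emb1 : emb h 1 = 1 :> fld R L.
Proof. by case: K L h => [] [] []. Qed.

Lemma embM : {morph emb h : x y / x * y >-> x * y :> fld R L}.
Proof. by case: K L h => [] [] [] //= _ x y; rewrite rmorphM. Qed.

Lemma embD : {morph emb h : x y / x + y >-> x + y :> fld R L}.
Proof. by case: K L h => [] [] [] //= _ x y; rewrite rmorphD. Qed.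

Lemma emb_ge0 (x : fld R K) : 0 <= x -> 0 <= emb h x.
Proof. by case: K L h x => [] [] [] //= _ x; rewrite ler0c. Qed.

Lemma emb_le1 (x : fld R K) : x <= 1 -> emb h x <= 1.
Proof. by case: K L h x => [] [] [] //= _ x; rewrite lecR. Qed.

Lemma emb_continuous : continuous (emb h : (fld R K)^o -> (fld R L)^o).
Proof.
case: K L h => [] [] [] //= _ x; try exact: cvg_id.
apply/cvgrPdist_lt => -[e e'] /[dup] e0; rewrite ltcE/= => /andP[/eqP e'0 e1].
near=> y; rewrite -rmorphB/= normc_def/= expr0n addr0 sqrtr_sqr.
rewrite ltcE/= e'0 eqxx/=; near: y.
by have /cvgrPdist_lt := (@cvg_id R^o (nbhs x)); apply.
Unshelve. all: by end_near. Qed.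

End emb_theory.

(* The L-space V regarded as a K-space. *)
Definition restr (R : realType) (K L : scalars) (h : K = RealScalars \/ K = L)
  (V : tvsType (fld R L)) : Type := V.

Section restr_instances.
Context (R : realType) (K L : scalars) (h : K = RealScalars \/ K = L).
Context (V : tvsType (fld R L)).

HB.instance Definition _ := Uniform.copy (restr h V) V.
HB.instance Definition _ := TopologicalZmodule.copy (restr h V) V.

Let restr_scale (a : fld R K) (v : restr h V) : restr h V :=
  emb h a *: (v : V).

Let restr_scaleA a b v :
  restr_scale a (restr_scale b v) = restr_scale (a * b) v.
Proof. by rewrite /restr_scale scalerA embM. Qed.

Let restr_scale1 : left_id 1 restr_scale.
Proof. by move=> v; rewrite /restr_scale emb1 scale1r. Qed.

Let restr_scaleDr : right_distributive restr_scale +%R.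
Proof. by move=> a u v; rewrite /restr_scale scalerDr. Qed.

Let restr_scaleDl v : {morph restr_scale^~ v : a b / a + b}.
Proof. by move=> a b; rewrite /restr_scale embD scalerDl. Qed.

HB.instance Definition _ := GRing.Zmodule_isLmodule.Build (fld R K) (restr h V)
  restr_scaleA restr_scale1 restr_scaleDr restr_scaleDl.

Let restr_scale_continuous :
  continuous (fun z : (fld R K)^o * restr h V => z.1 *: z.2).
Proof.
pose e (z : (fld R K)^o * restr h V) : (fld R L)^o * V := (emb h z.1, z.2).
have ce : continuous e.
  move=> z; apply: (@cvg_pair _ _ _ _ (nbhs (emb h z.1 : (fld R L)^o)));
    last exact: cvg_snd.
  apply: (@continuous_comp _ _ _ fst (emb h : (fld R K)^o -> (fld R L)^o)).
    exact: cvg_fst.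
  exact: emb_continuous.
by move=> z; exact: (continuous_comp (ce z) (@scale_continuous _ V (e z))).
Qed.

HB.instance Definition _ := TopologicalZmodule_isTopologicalLmodule.Build
  (fld R K) (restr h V) restr_scale_continuous.

Let restr_locally_convex : exists2 B : set_system (restr h V),
  (forall b, b \in B -> convex_set b) & basis B.
Proof.
have [B Bc Bb] := @locally_convex _ V.
exists B => // b bB; apply/convex_setW => x y xb yb t t0 t1.
have l0 : 0 <= emb h t%:num by exact: emb_ge0 (ltW t0).
have l1 : emb h t%:num <= 1 by exact: emb_le1 (ltW t1).
suff <- : conv (Itv01 l0 l1) (x : convex_lmodType V) y = conv t x y.
  exact: Bc.
congr (_ + _ *: _) => /=.
transitivity (1 - emb h t%:num) => //.
by rewrite -[in LHS](emb1 R h) -[in X in X - _](subrK t%:num 1) embD addrK.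
Qed.

HB.instance Definition _ :=
  Uniform_isTvs.Build (fld R K) (restr h V) restr_locally_convex.

End restr_instances.

(* V_C = V + iV, with (x, y) standing for x + iy. *)
Definition cplxfication (R : realType) (V : tvsType R) : Type := (V * V)%type.

Section cplxfication_instances.
Context (R : realType) (V : tvsType R).
Local Notation VC := (cplxfication V).

HB.instance Definition _ := Uniform.copy VC (V * V)%type.
HB.instance Definition _ := TopologicalZmodule.copy VC (V * V)%type.

Let scaleC (a : R[i]) (v : VC) : VC :=
  (complex.Re a *: v.1 - complex.Im a *: v.2,
   complex.Re a *: v.2 + complex.Im a *: v.1).


Let scaleCA a b v : scaleC a (scaleC b v) = scaleC (a * b) v.
Proof.
case: a b v => [a a'] [b b'] [x y]; congr pair.
  change (a *: (b *: x - b' *: y) - a' *: (b *: y + b' *: x) =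
          (a * b - a' * b') *: x - (a * b' + a' * b) *: y).
  rewrite scalerBl scalerDl scalerBr scalerDr !scalerA !opprD.
  by rewrite -!addrA; congr (_ + _); rewrite [RHS]addrC -!addrA.
change (a *: (b *: y + b' *: x) + a' *: (b *: x - b' *: y) =
        (a * b - a' * b') *: y + (a * b' + a' * b) *: x).
rewrite scalerBl scalerDl scalerBr scalerDr !scalerA.
by rewrite -!addrA; congr (_ + _); rewrite [RHS]addrC -!addrA.
Qed.

Let scaleC1 : left_id 1 scaleC.
Proof.
move=> [x y]; rewrite /scaleC.
change ((1 *: x - 0 *: y, 1 *: y + 0 *: x) = (x, y)).
by rewrite !scale0r !scale1r subr0 addr0.
Qed.

Let scaleCDr : right_distributive scaleC +%R.
Proof.
move=> a [x y] [x' y']; congr pair => /=.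
  by rewrite !scalerDr opprD addrACA.
by rewrite !scalerDr addrACA.
Qed.

Let scaleCDl v : {morph scaleC^~ v : a b / a + b}.
Proof.
move=> [a a'] [b b']; congr pair => /=.
  by rewrite !scalerDl opprD addrACA.
by rewrite !scalerDl addrACA.
Qed.

HB.instance Definition _ := GRing.Zmodule_isLmodule.Build R[i] VC
  scaleCA scaleC1 scaleCDr scaleCDl.

Let Re_continuous : continuous (@complex.Re R : R[i]^o -> R^o).
Proof.
move=> x; apply/(@cvgrPdist_lt _ _ _ _ (@nbhs_filter R[i]^o x)) => e e0.
apply/nbhs_ballP; exists (e%:C)%C => /=; first by rewrite ltcR.
move=> y; rewrite -ball_normE/= => xy; rewrite -ltcR.
by apply: le_lt_trans xy; have := normc_ge_Re (x - y); case: x y => [? ?] [? ?].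
Qed.

Let Im_continuous : continuous (@complex.Im R : R[i]^o -> R^o).
Proof.
move=> x; apply/(@cvgrPdist_lt _ _ _ _ (@nbhs_filter R[i]^o x)) => e e0.
apply/nbhs_ballP; exists (e%:C)%C => /=; first by rewrite ltcR.
move=> y; rewrite -ball_normE/= => xy; rewrite -ltcR.
apply: le_lt_trans xy; have := normc_ge_Re ((x - y) * 'i%C).
rewrite normrM [X in _ <= _ * X]normc_def/= expr0n expr1n add0r sqrtr1 mulr1.
case: x y => [? x] [? y] /=.
by rewrite mulr0 mulr1 sub0r normrN.
Qed.

Let scaleC_continuous : continuous (fun z : R[i]^o * VC => z.1 *: z.2).
Proof.
pose mul (f : R[i]^o -> R^o) (g : V * V -> V) (z : R[i]^o * (V * V)) :=
  f z.1 *: g z.2.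
have cmul f g : continuous f -> continuous g -> continuous (mul f g).
  move=> cf cg z.
  have ce : {for z, continuous (fun z => (f z.1, g z.2) : R^o * V)}.
    apply: (@cvg_pair _ _ _ _ (nbhs (f z.1 : R^o)) (nbhs (g z.2))).
      by apply: (@continuous_comp _ _ _ fst f); [exact: cvg_fst|exact: cf].
    by apply: (@continuous_comp _ _ _ snd g); [exact: cvg_snd|exact: cg].
  exact: (continuous_comp ce (@scale_continuous _ V _)).
have c1 : continuous (fst : V * V -> V) by move=> x; exact: cvg_fst.
have c2 : continuous (snd : V * V -> V) by move=> x; exact: cvg_snd.
move=> z.
have c3 : {for z, continuous (fun z => (mul (@complex.Re R) fst z,
    mul (@complex.Im R) snd z) : V * V)}.
  by apply: cvg_pair; exact: cmul.
have c4 : {for z, continuous (fun z => (mul (@complex.Re R) snd z,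
    mul (@complex.Im R) fst z) : V * V)}.
  by apply: cvg_pair; exact: cmul.
apply: (@cvg_pair _ _ _ _
  (nbhs (complex.Re z.1 *: z.2.1 - complex.Im z.1 *: z.2.2 : V))
  (nbhs (complex.Re z.1 *: z.2.2 + complex.Im z.1 *: z.2.1 : V))).
  exact: (continuous_comp c3 (@sub_continuous V _)).
exact: (continuous_comp c4 (@add_continuous V _)).
Qed.

HB.instance Definition _ := TopologicalZmodule_isTopologicalLmodule.Build
  R[i] VC scaleC_continuous.

Let VC_locally_convex : exists2 B : set_system VC,
  (forall b, b \in B -> convex_set b) & basis B.
Proof.
have [B Bc Bb] := @locally_convex _ (V * V)%type.
exists B => // b bB; apply/convex_setW => x y xb yb t t0 t1.
have [t'E l0] : complex.Im t%:num = 0 /\ 0 <= complex.Re t%:num.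
  by move: (ltW t0); rewrite lecE/= => /andP[/eqP-> ->].
have l1 : complex.Re t%:num <= 1 by move: (ltW t1); rewrite lecE/= => /andP[].
suff <- : conv (Itv01 l0 l1) (x : convex_lmodType (V * V)%type) y = conv t x y.
  exact: Bc.
have scaleE (a : R[i]) (v : VC) : complex.Im a = 0 ->
    a *: v = complex.Re a *: (v : (V * V)%type) :> VC.
  move=> a0; case: v => u v.
  change ((complex.Re a *: u - complex.Im a *: v,
    complex.Re a *: v + complex.Im a *: u) = (complex.Re a *: u, complex.Re a *: v)).
  by rewrite a0 !scale0r subr0 addr0.
change (complex.Re t%:num *: (x : (V * V)%type) +
        (1 - complex.Re t%:num) *: (y : (V * V)%type) =
        t%:num *: (x : VC) + (1 - t%:num) *: (y : VC) :> VC).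
have I0 : complex.Im (1 - t%:num) = 0.
  by move: t'E; case: (t%:num) => u v /= ->; rewrite subrr.
rewrite !scaleE//.
have -> // : complex.Re (1 - t%:num) = 1 - complex.Re t%:num.
by case: (t%:num).
Qed.

HB.instance Definition _ := Uniform_isTvs.Build R[i] VC VC_locally_convex.

End cplxfication_instances.

Inductive smoothness := Fin of nat | Infty | Omega.

Definition le_smooth (r s : smoothness) : bool :=
  match r, s with
  | Fin m, Fin n => (m <= n)%N
  | Fin _, _ => true
  | Infty, Fin _ => false
  | Infty, _ => true
  | Omega, Omega => true
  | Omega, _ => false
  end.

Definition pred_smooth (r : smoothness) : smoothness :=
  if r is Fin n then Fin n.-1 else r.

Section maps_between_tvs.
Context (C : numFieldType) (X H : tvsType C).
Implicit Types (U : set X) (f : X -> H).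

(* Maps on an open set U are represented by total functions; all notions below
   only depend on the restriction to U. *)

(* [l] is D_y f (x), for scalars t in the ground field C (the library's
   [derivable] is restricted to normed modules). *)
Definition is_dirder f (y x : X) (l : H) : Prop :=
  t^-1 *: (f (x + t *: y) - f x) @[t --> (0 : C)^'] --> l.

Definition dirder f (y x : X) : H := xget 0 [set l | is_dirder f y x l].

(* [dirders f [:: y1; ...; yj]] is D_{yj} ... D_{y1} f *)
Definition dirders f (ys : seq X) : X -> H := foldl dirder f ys.

(* (x, y1, ..., yj) |-> d^j f (x, y1, ..., yj) *)
Definition djmap f (j : nat) (p : X * prod_topology (fun _ : 'I_j => X)) : H :=
  dirders f [seq p.2 i | i <- enum 'I_j] p.1.

Definition Keller_Cr (r : smoothness) U f : Prop :=
  [/\ open U, {within U, continuous f} &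
    forall j, le_smooth (Fin j.+1) r ->
      (forall ys y x, size ys = j -> U x ->
         exists l, is_dirder (dirders f ys) y x l) /\
      {within U `*` setT, continuous (@djmap f j.+1)}].

Definition multilinear n (b : ('I_n -> X) -> H) : Prop :=
  forall (i : 'I_n) (y : 'I_n -> X),
    linear (fun u : X => b (dfwith y i u)).

Definition continuous_homogeneous_poly n (p : X -> H) : Prop :=
  continuous p /\
  exists2 b : ('I_n -> X) -> H, multilinear b & forall x, p x = b (fun=> x).

Definition power_series_analytic U f : Prop :=
  [/\ open U, {within U, continuous f} &
    forall x, U x ->
      exists2 p : nat -> X -> H,
        forall n, continuous_homogeneous_poly n (p n) &
        \forall y \near (0 : X), series (fun n => p n y) @ \oo --> f (x + y)].

End maps_between_tvs.

Definition real_analytic (R : realType) (X H : tvsType R) (U : set X)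
    (f : X -> H) : Prop :=
  open U /\
  exists (W : set (cplxfication X)) (g : cplxfication X -> cplxfication H),
    power_series_analytic W g /\
    forall x, U x -> W (x, 0) /\ g (x, 0) = (f x, 0).

Definition analytic (R : realType) (k : scalars) :
    forall X H : tvsType (fld R k), set X -> (X -> H) -> Prop :=
  match k with
  | RealScalars => @real_analytic R
  | ComplexScalars => @power_series_analytic R[i]
  end.

Definition Cr (R : realType) (k : scalars) (r : smoothness)
    (X H : tvsType (fld R k)) (U : set X) (f : X -> H) : Prop :=
  if r is Omega then analytic U f else Keller_Cr r U f.

Section manifolds.
Context (R : realType) (k : scalars).

(* Charts of one manifold may take values in different locally convex spaces.
   [chart_fun] and [chart_inv] are only relevant on [chart_dom], [chart_img]. *)
Record chart (T : topologicalType) := Chart {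
  chart_model : tvsType (fld R k);
  chart_dom : set T;
  chart_img : set chart_model;
  chart_fun : T -> chart_model;
  chart_inv : chart_model -> T }.

Arguments chart_dom {T} c _.
Arguments chart_img {T} c _.
Arguments chart_fun {T} c _.
Arguments chart_inv {T} c _.

Definition is_chart (T : topologicalType) (c : chart T) : Prop :=
  [/\ hausdorff_space (chart_model c),
      open (chart_dom c) /\ open (chart_img c),
      {within chart_dom c, continuous (chart_fun c)} /\
      {within chart_img c, continuous (chart_inv c)},
      forall x, chart_dom c x ->
        chart_img c (chart_fun c x) /\ chart_inv c (chart_fun c x) = x &
      forall y, chart_img c y ->
        chart_dom c (chart_inv c y) /\ chart_fun c (chart_inv c y) = y].

(* A topology and a family of charts on a bare type; the manifold axioms are in
   [is_Cr_manifold]. The topology is a field because it is part of what is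
   constructed when a given set is made a manifold. *)
Record manifold (T : Type) := Manifold {
  mfd_topology : Topological T;
  mfd_index : Type;
  mfd_chart : mfd_index -> chart (Topological.Pack mfd_topology) }.

Arguments mfd_chart {T} m i.

Definition mspace (T : Type) (m : manifold T) : topologicalType :=
  Topological.Pack (mfd_topology m).

Definition is_Cr_manifold (r : smoothness) (T : Type) (m : manifold T) : Prop :=
  [/\ hausdorff_space (mspace m),
      forall x, exists i, chart_dom (mfd_chart m i) x,
      forall i, is_chart (mfd_chart m i) &
      forall i j, let c := mfd_chart m i in let c' := mfd_chart m j in
        Cr r [set y | chart_img c y /\ chart_dom c' (chart_inv c y)]
          (chart_fun c' \o chart_inv c)].

(* f is C^r on the open subset W of the manifold m. *)
Definition Cr_map (r : smoothness) (T T' : Type) (m : manifold T)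
    (m' : manifold T') (W : set T) (f : T -> T') : Prop :=
  [/\ open (W : set (mspace m)),
      {within (W : set (mspace m)), continuous (f : mspace m -> mspace m')} &
      forall i j, let c := mfd_chart m i in let c' := mfd_chart m' j in
        Cr r [set y | [/\ chart_img c y, W (chart_inv c y) &
                          chart_dom c' (f (chart_inv c y))]]
          (chart_fun c' \o f \o chart_inv c)].

Definition tvs_manifold (V : tvsType (fld R k)) : manifold V :=
  @Manifold V (Topological.class V) unit
    (fun=> @Chart V V setT setT id id).

Definition prod_chart (T T' : topologicalType) (c : chart T) (c' : chart T') :
    chart (T * T')%type :=
  @Chart (T * T')%type (chart_model c * chart_model c')%type
    (chart_dom c `*` chart_dom c')
    (chart_img c `*` chart_img c')
    (fun x => (chart_fun c x.1, chart_fun c' x.2))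
    (fun y => (chart_inv c y.1, chart_inv c' y.2)).

Definition prod_manifold (T T' : Type) (m : manifold T) (m' : manifold T') :
    manifold (T * T') :=
  @Manifold (T * T')
    (Topological.class (mspace m * mspace m')%type)
    (mfd_index m * mfd_index m')
    (fun i => prod_chart (mfd_chart m i.1) (mfd_chart m' i.2)).

Definition is_Lie_group (s : smoothness) (G : groupType) (mG : manifold G) :
    Prop :=
  [/\ is_Cr_manifold s mG,
      Cr_map s (prod_manifold mG mG) mG setT (fun p => (p.1 * p.2)%g) &
      Cr_map s mG mG setT (fun g => (g^-1)%g)].

Definition is_Cr_action (r : smoothness) (G : groupType) (mG : manifold G)
    (T : Type) (m : manifold T) (a : G -> T -> T) : Prop :=
  [/\ forall x, a 1%g x = x,
      forall g h x, a (g * h)%g x = a g (a h x) &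
      Cr_map r (prod_manifold mG m) m setT (fun p => a p.1 p.2)].

End manifolds.

(* The disjoint union of the fibres; the projection is [tag]. It is never used
   with the library's (disjoint sum) topology on sigma types, only with the
   topology of an explicitly given manifold structure. *)
Definition bundle_total (M : Type) (S : pzRingType) (E : M -> lmodType S) : Type :=
  {x : M & E x}.

Section vector_bundles.
Context (R : realType) (K L : scalars) (h : K = RealScalars \/ K = L).
Context (M : Type) (mM : manifold R K M).

(* pr_F o psi|_{E_x} *)
Definition fibre_part (F : tvsType (fld R L)) (E : M -> lmodType (fld R L))
    (psi : bundle_total E -> M * F) (x : M) : E x -> F :=
  fun v => (psi (existT _ x v)).2.

(* psi : pi^-1(U) -> U x F, extended arbitrarily outside pi^-1(U). *)
Definition is_local_triv (r : smoothness) (F : tvsType (fld R L))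
    (E : M -> lmodType (fld R L)) (mE : manifold R K (bundle_total E))
    (U : set M) (psi : bundle_total E -> M * F) : Prop :=
  let mMF := prod_manifold mM (tvs_manifold (restr h F)) in
  let EU := [set e : bundle_total E | U (tag e)] in
  [/\ open (U : set (mspace mM)),
      Cr_map r mE mMF EU psi,
      exists phi : M * F -> bundle_total E,
        [/\ Cr_map r mMF mE (U `*` setT) phi,
            forall e, EU e -> U (psi e).1 /\ phi (psi e) = e &
            forall p, U p.1 -> EU (phi p) /\ psi (phi p) = p],
      forall y, U y -> psi @` [set e | tag e = y] = [set y] `*` setT &
      forall y, U y -> linear (fibre_part psi (x := y))].

Definition is_vector_bundle (r : smoothness) (F : tvsType (fld R L))
    (E : M -> lmodType (fld R L)) (mE : manifold R K (bundle_total E)) : Prop :=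
  [/\ is_Cr_manifold r mE,
      Cr_map r mE mM setT (fun e => tag e),
      forall x, exists e : bundle_total E, tag e = x &
      forall x, exists (U : set M) (psi : bundle_total E -> M * F),
        U x /\ is_local_triv r mE U psi].

(* The inclusions beta(g, E_x) <= E_{alpha(g, x)} are part of the typing. *)
Definition total_action (G : Type) (E : M -> lmodType (fld R L))
    (alpha : G -> M -> M) (beta : forall g x, E x -> E (alpha g x))
    (g : G) (e : bundle_total E) : bundle_total E :=
  existT _ (alpha g (tag e)) (beta g (tag e) (tagged e)).

Definition is_equivariant_bundle (r : smoothness) (G : groupType)
    (mG : manifold R K G) (alpha : G -> M -> M)
    (F : tvsType (fld R L)) (E : M -> lmodType (fld R L))
    (mE : manifold R K (bundle_total E))
    (beta : forall g x, E x -> E (alpha g x)) : Prop :=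
  [/\ is_vector_bundle r F mE,
      is_Cr_action r mG mE (total_action beta) &
      forall g x, linear (beta g x)].

(* The open sets of the topology induced by E on E_x. *)
Definition fibre_open (E : M -> lmodType (fld R L))
    (mE : manifold R K (bundle_total E)) (x : M) (O : set (E x)) : Prop :=
  exists2 O' : set (mspace mE), open O' & O = [set v | O' (existT _ x v)].

End vector_bundles.

Section completions.
Context (S : numFieldType).

(* Completeness for the uniformity of the topological group (W, +): the uniform
   structure carried by a [tvsType] need not be translation invariant, so that
   the library's [cauchy] may be a different notion. *)
Definition tvs_complete (W : tvsType S) : Prop :=
  forall F : set_system W, ProperFilter F ->
    (forall O : set W, nbhs 0 O ->
       exists2 A, F A & forall x y, A x -> A y -> O (x - y)) ->
    exists x : W, F --> x.

(* j : V -> W is a completion of V, with topology openV, identifying V with a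
   dense subspace of the complete Hausdorff space W. *)
Definition is_completion (V : lmodType S) (openV : set (set V))
    (W : tvsType S) (j : V -> W) : Prop :=
  [/\ hausdorff_space W, tvs_complete W, linear j /\ injective j,
      forall O, openV O <-> exists2 O' : set W, open O' & O = j @^-1` O' &
      closure (range j) = setT].

(* The continuous linear extension of f : V -> V' to the completions; the
   default value 0 is used only if there is none. *)
Definition cont_ext (V V' : lmodType S) (W W' : tvsType S)
    (j : V -> W) (j' : V' -> W') (f : V -> V') : W -> W' :=
  xget (fun=> 0) [set g : W -> W' |
    [/\ linear g, continuous g & forall v, g (j v) = j' (f v)]].

End completions.

Definition ext_action (R : realType) (L : scalars) (G M : Type)
    (alpha : G -> M -> M) (E : M -> lmodType (fld R L))
    (beta : forall g x, E x -> E (alpha g x))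
    (Et : M -> tvsType (fld R L)) (jE : forall x, E x -> Et x)
    (g : G) (x : M) : Et x -> Et (alpha g x) :=
  cont_ext (jE x) (jE (alpha g x)) (beta g x).

Definition ext_triv (R : realType) (L : scalars) (M : Type)
    (F Ft : tvsType (fld R L)) (jF : F -> Ft)
    (E : M -> lmodType (fld R L)) (Et : M -> tvsType (fld R L))
    (jE : forall x, E x -> Et x) (psi : bundle_total E -> M * F)
    (e : bundle_total Et) : M * Ft :=
  (tag e, cont_ext (jE (tag e)) jF (fibre_part psi (x := tag e)) (tagged e)).

(* Main.v *)
(** In charts and local trivializations, the coordinate changes of the completed
    bundle and of the extended action are fibrewise extensions
    f~ : U x F~ -> F~ of maps f : U x F -> F of class C^r which are linear in the
    second variable. By linearity, continuity of f at (x0, 0) yields a bound of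
    f(x, .) by one seminorm, uniformly for x near x0; hence f~ is continuous.
    The derivative of f~ at ((x, v), (y, w)) is the extension of d_1 f(x, v; y)
    plus f~(x, w), and d_1 f is again linear in v, so that f~ is C^r by
    induction: no derivative is lost, and the class C^(r-1) follows a fortiori.

    Complex analyticity amounts to C^n for all n, by Cauchy's formula with
    averages over roots of unity in place of contour integrals. If f is real
    analytic with complex extension g, then (x, v) |-> dg((x, 0), (0, v)) is an
    extension which is complex linear in v and defined for all v in F_C, and the
    complex case applies to it. *)
Require Import Defs.
From HB Require Import structures.
From mathcomp Require Import all_boot all_order all_algebra.
From mathcomp Require Import complex.
From mathcomp Require Import all_classical all_reals all_analysis.
From mathcomp Require Import ring lra.

Set Implicit Arguments.
Unset Strict Implicit.
Unset Printing Implicit Defensive.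

Import Order.TTheory GRing.Theory Num.Theory.
Import numFieldNormedType.Exports.

Local Open Scope classical_set_scope.
Local Open Scope ring_scope.

(** The model spaces are not normed and need not be complete, and the fibres are bare modules with a
    family of open sets. Hence every estimate is made for one continuous seminorm at a time, and a
    mean value inequality takes the place of integration. The obstacle is to find a form of C^r that
    supports the induction. Keller's condition speaks of each d^j f separately, and the derivative
    of d^j f as a map of all its arguments is not among them; it can be computed because d^j f is
    linear in every direction. The resulting iterated form [IC] covers finite and infinite order,
    and both analytic cases are reduced to it: a complex analytic map is [IC n] for all n, and a
    real analytic map has an extension that is. Extensions of real analytic maps live on arbitrary
    domains and are known only locally, so they are continued along complex discs before they are
    glued. In the action, G is of class C^s while M and E are of class C^r. An inverse chart of G is
    therefore tested only in its own chart, where it reads as a linear map. *)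

Arguments fld : simpl never.

(** * Equations in a module, by reflection *)

Section lmod_reflection.
Context {S : comPzRingType} {V : lmodType S}.

Inductive mexp :=
  | MVar of nat | MZero | MAdd of mexp & mexp | MOpp of mexp | MScale of S & mexp.

Fixpoint meval (env : seq V) (e : mexp) : V :=
  match e with
  | MVar n => nth 0 env n
  | MZero => 0
  | MAdd a b => meval env a + meval env b
  | MOpp a => - meval env a
  | MScale c a => c *: meval env a
  end.

(** [Nat.eqb] is chosen because [cbn] evaluates it on numerals, which leaves bare ring
    expressions. *)
Fixpoint mcoef (e : mexp) (i : nat) : S :=
  match e with
  | MVar n => if Nat.eqb n i then 1 else 0
  | MZero => 0
  | MAdd a b => mcoef a i + mcoef b i
  | MOpp a => - mcoef a i
  | MScale c a => c * mcoef a i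
  end.

Fixpoint mcheck (n : nat) (a b : mexp) : Prop :=
  if n is m.+1 then mcoef a m = mcoef b m /\ mcheck m a b else True.

Lemma mevalE env e :
  meval env e = \sum_(i < size env) mcoef e i *: nth 0 env i.
Proof.
elim: e => [n||a IHa b IHb|a IHa|c a IHa] /=.
- have [nlt|nge] := ltnP n (size env).
    rewrite (bigD1 (Ordinal nlt))//= PeanoNat.Nat.eqb_refl scale1r big1 ?addr0// => i.
    rewrite -val_eqE/= eq_sym; case: (PeanoNat.Nat.eqb_spec n i) => [->|_ _]; first by rewrite eqxx.
    by rewrite scale0r.
  rewrite nth_default// big1// => i _.
  case: (PeanoNat.Nat.eqb_spec n i) => [e|_]; last by rewrite scale0r.
  by move: nge; rewrite e leqNgt ltn_ord.
- by rewrite big1// => i _; rewrite scale0r.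
- by rewrite IHa IHb -big_split; apply: eq_bigr => i _; rewrite scalerDl.
- by rewrite IHa -sumrN; apply: eq_bigr => i _; rewrite scaleNr.
- by rewrite IHa scaler_sumr; apply: eq_bigr => i _; rewrite scalerA.
Qed.

Lemma mexpP env a b : mcheck (size env) a b -> meval env a = meval env b.
Proof.
move=> h; rewrite !mevalE; apply: eq_bigr => -[i /= +] _.
elim: (size env) h => [//|n IH] /= [e h]; rewrite ltnS leq_eqVlt => /predU1P[->|].
  by rewrite e.
exact: IH.
Qed.

End lmod_reflection.

(* Atoms with the same head are compared up to conversion, as they may differ
   in the structures from which their operations are inferred. *)
Ltac lm_unify x y :=
  match goal with
  | _ => let _ := match goal with _ => unify x y end in constr:(true)
  | _ => constr:(false)
  end.
Ltac lm_same x y :=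
  lazymatch y with
  | x => constr:(true)
  | @bigop.body _ _ _ _ _ =>
    lazymatch x with @bigop.body _ _ _ _ _ => lm_unify x y | _ => constr:(false) end
  | ?g _ =>
    lazymatch x with g _ => lm_unify x y | _ => constr:(false) end
  | _ => constr:(false)
  end.
Ltac lm_mem x l :=
  lazymatch l with
  | nil => constr:(false)
  | cons ?y ?t =>
    lazymatch lm_same x y with true => constr:(true) | false => lm_mem x t end
  end.
Ltac lm_idx x l :=
  lazymatch l with
  | cons ?y ?t =>
    lazymatch lm_same x y with
    | true => constr:(O)
    | false => let n := lm_idx x t in constr:(S n)
    end
  end.
Ltac lm_atoms e l :=
  lazymatch e with
  | (?a + ?b)%R => let l := lm_atoms a l in lm_atoms b l
  | (- ?a)%R => lm_atoms a l
  | (_ *: ?a)%R => lm_atoms a l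
  | 0%R => l
  | _ => lazymatch lm_mem e l with true => l | false => constr:(cons e l) end
  end.
Ltac lm_reify S e l :=
  lazymatch e with
  | (?a + ?b)%R => let a := lm_reify S a l in let b := lm_reify S b l in
      constr:(@MAdd S a b)
  | (- ?a)%R => let a := lm_reify S a l in constr:(@MOpp S a)
  | (?c *: ?a)%R => let a := lm_reify S a l in constr:(@MScale S c a)
  | 0%R => constr:(@MZero S)
  | _ => let n := lm_idx e l in constr:(@MVar S n)
  end.

(* [lmodule V] reduces an equation in the module V to ring equations between
   the coefficients of its atoms. *)
Ltac lmodule_goals V :=
  match goal with
  | |- ?a = ?b =>
    let T := type of a in
    let S := match type of V with lmodType ?S => S | tvsType ?S => S end in
    let l := lm_atoms a (@nil T) in
    let l := lm_atoms b l in
    let ea := lm_reify S a l in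
    let eb := lm_reify S b l in
    change (@meval S V l ea = @meval S V l eb); apply: mexpP;
    cbn [size mcheck mcoef Nat.eqb];
    repeat match goal with |- _ /\ _ => split | |- True => exact I end
  end.
Ltac lmodule V := lmodule_goals V; ring.

(** * Maps with a separate proof of linearity *)

Section unbundled_linear.
Context {S : pzRingType} {U V : lmodType S} {f : U -> V} (lf : linear f).

Lemma linD x y : f (x + y) = f x + f y.
Proof. by have := lf 1 x y; rewrite !scale1r. Qed.
Lemma lin0 : f 0 = 0.
Proof. by apply: (@addrI _ (f 0)); rewrite -linD !addr0. Qed.
Lemma linZ a x : f (a *: x) = a *: f x.
Proof. by rewrite -[a *: x]addr0 lf lin0 addr0. Qed.
Lemma linN x : f (- x) = - f x.
Proof. by rewrite -scaleN1r linZ scaleN1r. Qed.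
Lemma linB x y : f (x - y) = f x - f y.
Proof. by rewrite linD linN. Qed.

End unbundled_linear.

(** * Real absolute value on both scalar fields *)

Section scalar_norm.
Context {R : realType} {k : scalars}.
Local Notation C := (fld R k).

Definition rC : R -> C := @emb R RealScalars k (or_introl erefl).

(** The norm of [fld R k] takes values in the field itself. Its real value lets seminorms and radii
    lie in R for both fields. *)
Definition nm : C -> R :=
  match k return fld R k -> R with
  | RealScalars => fun x => `|x|
  | ComplexScalars => fun x => complex.Re `|x|
  end.

Lemma rCD x y : rC (x + y) = rC x + rC y.
Proof. exact: embD. Qed.
Lemma rCM x y : rC (x * y) = rC x * rC y.
Proof. exact: embM. Qed.
Lemma rC1 : rC 1 = 1.
Proof. exact: emb1. Qed.
Lemma rC0 : rC 0 = 0.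
Proof. by apply: (@addrI _ (rC 0)); rewrite -rCD !addr0. Qed.
Lemma rCN x : rC (- x) = - rC x.
Proof. by apply/eqP; rewrite -addr_eq0 -rCD addNr rC0. Qed.
Lemma rCB x y : rC (x - y) = rC x - rC y.
Proof. by rewrite rCD rCN. Qed.
Lemma rC_eq0 x : (rC x == 0) = (x == 0).
Proof.
have [->|x0] := eqVneq x 0; first by rewrite rC0 eqxx.
apply/negP => /eqP e; have := oner_neq0 C.
by rewrite -rC1 -(mulfV x0) rCM e mul0r eqxx.
Qed.
Lemma rCV x : rC x^-1 = (rC x)^-1.
Proof.
have [->|x0] := eqVneq x 0; first by rewrite invr0 rC0 invr0.
apply: (@mulfI _ (rC x)); first by rewrite rC_eq0.
by rewrite -rCM mulfV// rC1 mulfV// rC_eq0.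
Qed.
Lemma rC_nat n : rC n%:R = n%:R.
Proof. by elim: n => [|n IH]; rewrite ?rC0// -!natr1 rCD IH rC1. Qed.
Lemma rC_le x y : (rC x <= rC y) = (x <= y).
Proof. by rewrite /rC; case: k => //=; rewrite lecR. Qed.
Lemma rC_lt x y : (rC x < rC y) = (x < y).
Proof. by rewrite /rC; case: k => //=; rewrite ltcR. Qed.
Lemma rC_inj : injective rC.
Proof. by move=> x y e; apply/eqP; rewrite eq_le -!rC_le e lexx. Qed.

Lemma normE (x : C) : `|x| = rC (nm x).
Proof.
by rewrite /rC /nm; case: k x.
Qed.

Lemma nm_ge0 x : 0 <= nm x.
Proof. by rewrite -rC_le rC0 -normE. Qed.
Lemma nmM x y : nm (x * y) = nm x * nm y.
Proof. by apply: rC_inj; rewrite rCM -!normE normrM. Qed.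
Lemma nmD x y : nm (x + y) <= nm x + nm y.
Proof. by rewrite -rC_le rCD -!normE ler_normD. Qed.
Lemma nm0 : nm 0 = 0.
Proof. by apply: rC_inj; rewrite -normE normr0 rC0. Qed.
Lemma nm1 : nm 1 = 1.
Proof. by apply: rC_inj; rewrite -normE normr1 rC1. Qed.
Lemma nmN x : nm (- x) = nm x.
Proof. by apply: rC_inj; rewrite -!normE normrN. Qed.
Lemma nm_eq0 x : (nm x == 0) = (x == 0).
Proof. by rewrite -rC_eq0 -normE normr_eq0. Qed.
Lemma nm_gt0 x : (0 < nm x) = (x != 0).
Proof. by rewrite lt_def nm_eq0 nm_ge0 andbT. Qed.
Lemma nmV x : nm x^-1 = (nm x)^-1.
Proof. by apply: rC_inj; rewrite rCV -!normE normfV. Qed.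
Lemma nmX x n : nm (x ^+ n) = nm x ^+ n.
Proof. by elim: n => [|n IH]; rewrite ?expr0 ?nm1// !exprS nmM IH. Qed.
Lemma nm_rC x : nm (rC x) = `|x|.
Proof.
apply: rC_inj; rewrite -normE.
have [x0|/ltW x0] := leP 0 x.
  by rewrite (ger0_norm x0) ger0_norm// -rC0 rC_le.
by rewrite (ler0_norm x0) ler0_norm ?rCN// -rC0 rC_le.
Qed.

Lemma nbhs_nm (a : C) (P : set C) :
  (\forall t \near a, P t) <->
  exists2 d : R, 0 < d & forall t, nm (t - a) < d -> P t.
Proof.
split.
  move=> /nbhs_ballP[e /= e0 aP].
  exists (nm e); first by rewrite nm_gt0 gt_eqF.
  move=> t ht; apply: aP; rewrite -ball_normE /ball_/= distrC normE.
  by rewrite -(gtr0_norm e0) normE rC_lt.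
move=> [d d0 dP]; apply/nbhs_ballP; exists (rC d) => /=.
  by rewrite -rC0 rC_lt.
by move=> t; rewrite -ball_normE /ball_/= distrC normE rC_lt; exact: dP.
Qed.

End scalar_norm.

Arguments nm : simpl never.
Arguments rC : simpl never.

(** * Continuous seminorms *)

Section seminorms.
Context {R : realType} {k : scalars}.
Local Notation C := (fld R k).

(** Smallness near 0 together with subadditivity gives continuity everywhere ([csn_near]);
    nonnegativity and the value at 0 follow from the first two clauses. *)
Definition csn (V : tvsType C) (q : V -> R) : Prop :=
  [/\ forall x y, q (x + y) <= q x + q y,
      forall a x, q (a *: x) = nm a * q x &
      forall e, 0 < e -> \forall x \near (0 : V), q x < e].

Section basic.
Context (V : tvsType C) (q : V -> R) (hq : csn q).

Lemma csnD x y : q (x + y) <= q x + q y. Proof. by case: hq. Qed.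
Lemma csnZ a x : q (a *: x) = nm a * q x. Proof. by case: hq. Qed.
Lemma csn0 : q 0 = 0. Proof. by rewrite -(scale0r 0) csnZ nm0 mul0r. Qed.
Lemma csnN x : q (- x) = q x. Proof. by rewrite -scaleN1r csnZ nmN nm1 mul1r. Qed.
Lemma csnB x y : q (x - y) <= q x + q y.
Proof. by rewrite -(csnN y) csnD. Qed.
Lemma csn_sym x y : q (x - y) = q (y - x).
Proof. by rewrite -csnN opprB. Qed.
Lemma csn_ge0 x : 0 <= q x.
Proof. by have := csnB x x; rewrite subrr csn0 -mulr2n pmulrn_lge0. Qed.
Lemma csn_trans y x z : q (x - z) <= q (x - y) + q (y - z).
Proof. by have := csnD (x - y) (y - z); rewrite addrA subrK. Qed.
Lemma csn_sum (I : Type) (s : seq I) (P : pred I) (f : I -> V) :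
  q (\sum_(i <- s | P i) f i) <= \sum_(i <- s | P i) q (f i).
Proof.
elim/big_rec2: _ => [|i y x _ h]; first by rewrite csn0.
by rewrite (le_trans (csnD _ _))// lerD2l.
Qed.

End basic.

Lemma add_cont2 (V : tvsType C) (x y : V) (O : set V) : nbhs (x + y) O ->
  exists A B : set V, [/\ nbhs x A, nbhs y B & forall u v, A u -> B v -> O (u + v)].
Proof.
move=> /(@add_continuous V (x, y))[[A B] /= [hA hB] AB].
by exists A, B; split=> // u v Au Bv; apply: (AB (u, v)).
Qed.

Lemma near_shift (V : tvsType C) (x : V) (P : set V) :
  (\forall y \near x, P y) <-> (\forall y \near (0 : V), P (x + y)).
Proof.
split=> [h|h].
  have := @add_cont2 _ x 0 P; rewrite addr0 => /(_ h)[A [B [hA hB AB]]].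
  by apply: filterS hB => y By; apply: AB By; exact: nbhs_singleton.
have := @add_cont2 _ x (- x) [set y | P (x + y)]; rewrite subrr.
move=> /(_ h)[A [B [hA hB AB]]].
apply: filterS hA => y Ay; rewrite -(subrKC x y).
by rewrite addrC subrK; have := AB _ _ Ay (nbhs_singleton hB); rewrite /= addrCA subrr addr0.
Qed.

Lemma scale_contl (V : tvsType C) (a : C) : continuous (fun x : V => a *: x).
Proof.
move=> x; apply: (@continuous_comp _ (C^o * V)%type _ (fun x => (a, x))
  (fun z => z.1 *: z.2)); last exact: scale_continuous.
by apply: (@cvg_pair _ _ _ _ (nbhs (a : C^o))); [exact: cvg_cst|exact: cvg_id].
Qed.

Lemma scale_contr (V : tvsType C) (x : V) : continuous (fun a : C^o => a *: x).
Proof.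
move=> a; apply: (@continuous_comp _ (C^o * V)%type _ (fun a => (a, x))
  (fun z => z.1 *: z.2)); last exact: scale_continuous.
by apply: (@cvg_pair _ _ _ (nbhs a) (nbhs a) (nbhs x) _ _ _ (fun a : C^o => a) (fun=> x));
  [exact: cvg_id|exact: cvg_cst].
Qed.

Section gauge.
Context (V : tvsType C) (B : set V) (nB : nbhs 0 B).
Hypothesis Bc : forall (t : R) x y, 0 < t -> t < 1 -> B x -> B y ->
  B (rC t *: x + rC (1 - t) *: y).

(** A convex neighbourhood need not be balanced. This is its largest balanced subset, which is still
    convex and still a neighbourhood of 0. *)
Let D := [set x | forall a, nm a <= 1 -> B (a *: x)].

Let DB x : D x -> B x.
Proof. by move=> /(_ 1); rewrite nm1 scale1r; apply. Qed.

Let Dbal a x : nm a <= 1 -> D x -> D (a *: x).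
Proof.
move=> a1 Dx b b1; rewrite scalerA; apply: Dx; rewrite nmM.
by rewrite mulr_ile1// nm_ge0.
Qed.

Let Dconv (t : R) x y : 0 < t -> t < 1 -> D x -> D y ->
  D (rC t *: x + rC (1 - t) *: y).
Proof.
move=> t0 t1 Dx Dy a a1; rewrite scalerDr !scalerA mulrC [a * rC (1 - t)]mulrC.
by rewrite -!scalerA; apply: Bc => //; [exact: Dx|exact: Dy].
Qed.

Let nD : nbhs 0 D.
Proof.
have := @scale_continuous C V (0, 0) B; rewrite /= scaler0 => /(_ nB).
move=> [[P Q] /= [hP hQ] PQ].
have /nbhs_nm[d d0 dP] : \forall t \near (0 : C), P t by [].
(* Writing a x = (a c) (c^-1 x) with |a| <= 1, half the radius keeps |a c| below d. *)
pose c : C := rC (d / 2).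
have c0 : c != 0 by rewrite rC_eq0 gt_eqF// divr_gt0.
have : \forall x \near (0 : V), Q (c^-1 *: x).
  by apply: (@scale_contl V c^-1 0); rewrite scaler0.
apply: filterS => x Qx a a1.
rewrite -[x](scalerKV c0) scalerA; apply: (PQ (a * c, c^-1 *: x)); split => //=.
apply: dP; rewrite subr0 nmM nm_rC gtr0_norm ?divr_gt0//.
by rewrite (le_lt_trans (ler_wpM2r _ a1))// ?divr_ge0 ?ltW// mul1r ltr_pdivrMr// mulr_natr mulr2n ltrDl.
Qed.

Let S x := [set t : R | 0 < t /\ D ((rC t)^-1 *: x)].

Let absorb x : exists t, S x t.
Proof.
have : \forall a \near (0 : C^o), D (a *: x).
  by apply: (@scale_contr V x 0); rewrite scale0r.
move=> /nbhs_nm[d d0 dP]; exists (d / 2)^-1; split.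
  by rewrite invr_gt0 divr_gt0.
apply: dP; rewrite subr0 -rCV invrK nm_rC gtr0_norm ?divr_gt0//.
by rewrite ltr_pdivrMr// mulr_natr mulr2n ltrDl.
Qed.

Let hasinf x : has_inf (S x).
Proof. by split; [exact: absorb|exists 0 => t [/ltW]]. Qed.

(** The Minkowski functional of [D]; it is a seminorm for the full scalar field because [D] is
    balanced. *)
Definition gauge x := inf (S x).

Let gauge_ge0 x : 0 <= gauge x.
Proof. by apply: lb_le_inf; [exact: absorb|move=> t [/ltW]]. Qed.

Let S_up x s t : S x s -> s <= t -> S x t.
Proof.
move=> [s0 Ds] st; have t0 := lt_le_trans s0 st; split=> //.
have -> : (rC t)^-1 *: x = rC (s / t) *: ((rC s)^-1 *: x).
  by rewrite scalerA -!rCV -rCM mulrAC mulfV ?gt_eqF// mul1r.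
apply: Dbal Ds; rewrite nm_rC ger0_norm ?divr_ge0 ?(ltW s0) ?(ltW t0)//.
by rewrite ler_pdivrMr// mul1r.
Qed.

Let gauge_le x t : S x t -> gauge x <= t.
Proof. by move=> St; apply: (ge_inf (hasinf x).2). Qed.

Let gauge_lt x t : gauge x < t -> S x t.
Proof.
by move=> /inf_lt; case=> [|s Ss /ltW st]; [exact: absorb|exact: S_up Ss st].
Qed.

Let gaugeZ_le a x : a != 0 -> gauge (a *: x) <= nm a * gauge x.
Proof.
move=> a0; have na : 0 < nm a by rewrite nm_gt0.
rewrite -ler_pdivrMl//; apply: lb_le_inf; first exact: absorb.
move=> t [t0 Dt]; rewrite ler_pdivrMl//; apply: gauge_le.
split; first by rewrite mulr_gt0.
have -> : (rC (nm a * t))^-1 *: (a *: x) = (a / rC (nm a)) *: ((rC t)^-1 *: x).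
  by rewrite !scalerA rCM invfM; congr (_ *: _); rewrite mulrC -mulrA mulrCA mulrC.
by apply: Dbal => //; rewrite nmM nmV nm_rC ger0_norm ?nm_ge0// mulfV ?gt_eqF.
Qed.

Lemma gauge_csn : csn gauge.
Proof.
split.
- move=> x y; apply/ler_addgt0Pr => e e0.
  have e2 : 0 < e / 2 by rewrite divr_gt0.
  have [s0 Ds] : S x (gauge x + e / 2) by apply: gauge_lt; rewrite ltrDl.
  have [t0 Dt] : S y (gauge y + e / 2) by apply: gauge_lt; rewrite ltrDl.
  have -> : gauge x + gauge y + e = (gauge x + e / 2) + (gauge y + e / 2) by lra.
  set s := gauge x + _ in s0 Ds *; set t := gauge y + _ in t0 Dt *.
  have st0 : 0 < s + t by rewrite addr_gt0.
  apply: gauge_le; split=> //.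
  have -> : (rC (s + t))^-1 *: (x + y) =
     rC (s / (s + t)) *: ((rC s)^-1 *: x) + rC (1 - s / (s + t)) *: ((rC t)^-1 *: y).
    have -> : 1 - s / (s + t) = t / (s + t).
      by apply: (@mulIf _ (s + t)); rewrite ?gt_eqF// mulrBl !divfK ?gt_eqF// mul1r addrC addKr.
    rewrite !scalerA -!rCV -!rCM mulrAC mulfV ?gt_eqF// mul1r.
    by rewrite mulrAC mulfV ?gt_eqF// mul1r scalerDr.
  by apply: Dconv => //; rewrite ?divr_gt0// ltr_pdivrMr// mul1r ltrDl.
- move=> a x; have [->|a0] := eqVneq a 0.
    rewrite scale0r nm0 mul0r; apply/eqP; rewrite eq_le gauge_ge0 andbT.
    apply/ler_addgt0Pr => e e0; rewrite add0r; apply: gauge_le; split=> //.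
    rewrite scaler0 => b _; rewrite scaler0; exact: nbhs_singleton.
  apply/eqP; rewrite eq_le gaugeZ_le//=.
  have := gaugeZ_le (a *: x) (invr_neq0 a0); rewrite scalerK// nmV.
  by rewrite ler_pdivlMl// nm_gt0.
- move=> e e0.
  have : \forall x \near (0 : V), D ((rC (e / 2))^-1 *: x).
    by apply: (@scale_contl V _ 0); rewrite scaler0.
  apply: filterS => x Dx; apply: (@le_lt_trans _ _ (e / 2)).
    by apply: gauge_le; split=> //; rewrite divr_gt0.
  by rewrite ltr_pdivrMr// mulr_natr mulr2n ltrDl.
Qed.

Lemma gauge_lt1 x : gauge x < 1 -> B x.
Proof. by move=> /gauge_lt[_]; rewrite rC1 invr1 scale1r; exact: DB. Qed.

End gauge.

(** Local convexity enters here: a convex basic neighbourhood is replaced by the unit ball of its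
    gauge, and from now on seminorms describe the topology. *)
Lemma csn_nbhs (V : tvsType C) (O : set V) : nbhs 0 O ->
  exists2 q, csn q & forall x, q x < 1 -> O x.
Proof.
move=> nO; have [Bs Bc [Bo Bn]] := @locally_convex C V.
have [B [BsB B0] BO] := Bn 0 O nO.
have nB : nbhs 0 B by apply: open_nbhs_nbhs; split=> //; exact: Bo.
have Bconv (t : R) x y : 0 < t -> t < 1 -> B x -> B y ->
    B (rC t *: x + rC (1 - t) *: y).
  move=> t0 t1 Bx By.
  have l0 : 0 <= rC t :> C by rewrite -rC0 rC_le ltW.
  have l1 : rC t <= 1 :> C by rewrite -rC1 rC_le ltW.
  have /set_mem := Bc _ (mem_set BsB) x y (Itv01 l0 l1) (mem_set Bx) (mem_set By).
  by rewrite rCB rC1.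
exists (gauge B); first exact: gauge_csn.
by move=> x h; apply: BO; apply: gauge_lt1 h.
Qed.

Lemma csn_nbhsx (V : tvsType C) (x : V) (O : set V) : nbhs x O ->
  exists2 q, csn q & forall y, q (y - x) < 1 -> O y.
Proof.
move=> /near_shift /csn_nbhs[q hq qO]; exists q => // y /qO.
by rewrite /= addrC subrK.
Qed.

Lemma csn_near (V : tvsType C) (q : V -> R) (x : V) e : csn q -> 0 < e ->
  \forall y \near x, q (y - x) < e.
Proof.
move=> hq e0; apply/near_shift; case: hq => _ _ /(_ e e0); apply: filterS => y.
by rewrite addrC addKr.
Qed.

Lemma csn_cvgP (V : tvsType C) (T : Type) (F : set_system T) (FF : Filter F)
    (f : T -> V) (l : V) :
  f @ F --> l <-> forall q, csn q -> forall e, 0 < e -> \forall x \near F, q (f x - l) < e.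
Proof.
split=> [h q hq e e0|h]; first exact: (h _ (csn_near l hq e0)).
move=> O /csn_nbhsx[q hq qO]; have := h q hq 1 ltr01.
by rewrite /nbhs/=; apply: filterS => x /qO.
Qed.

Lemma csn_contP (X : topologicalType) (V : tvsType C) (f : X -> V) (x : X) :
  {for x, continuous f} <->
  forall q, csn q -> forall e, 0 < e -> \forall y \near x, q (f y - f x) < e.
Proof. exact: csn_cvgP. Qed.

Lemma csn_sep (V : tvsType C) (x y : V) : hausdorff_space V ->
  (forall q, csn q -> q (x - y) = 0) -> x = y.
Proof.
move=> hV h; apply: hV => A B nA nB; exists y; split; last exact: nbhs_singleton.
have [q hq qA] := csn_nbhsx nA; apply: qA.
by rewrite csn_sym// h.
Qed.

(** The sum serves as a common upper bound of two seminorms. *)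
Lemma csn_max (V : tvsType C) (q1 q2 : V -> R) : csn q1 -> csn q2 ->
  csn (fun x => q1 x + q2 x).
Proof.
move=> h1 h2; split.
- by move=> x y; rewrite addrACA lerD// csnD.
- by move=> a x; rewrite !csnZ// mulrDr.
- move=> e e0; have e2 : 0 < e / 2 by rewrite divr_gt0.
  have [_ _ /(_ _ e2) H1] := h1; have [_ _ /(_ _ e2) H2] := h2.
  by near=> x; rewrite [e]splitr ltrD//; near: x.
Unshelve. all: by end_near. Qed.

Lemma csn_comp (V W : tvsType C) (l : V -> W) (q : W -> R) :
  linear l -> continuous l -> csn q -> csn (q \o l).
Proof.
move=> ll cl hq; split.
- by move=> x y /=; rewrite (linD ll) csnD.
- by move=> a x /=; rewrite (linZ ll) csnZ.
- move=> e e0; have := cl 0; rewrite /= => /csn_cvgP /(_ q hq e e0).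
  by apply: filterS => x; rewrite (lin0 ll) subr0.
Qed.

(** Scale x into the unit ball of p by 1 / (p x + e), where e takes care of p x = 0. This turns
    every inclusion of neighbourhoods into an inequality of seminorms. *)
Lemma homog_le (V : lmodType C) (p q : V -> R) : (forall x, 0 <= p x) ->
  (forall a x, p (a *: x) = nm a * p x) -> (forall a x, q (a *: x) = nm a * q x) ->
  (forall x, p x < 1 -> q x < 1) -> forall x, q x <= p x.
Proof.
move=> p0 pZ qZ h x; apply/ler_addgt0Pr => e e0.
have pe : 0 < p x + e by rewrite ltr_wpDl.
have := h (rC (p x + e)^-1 *: x); rewrite pZ qZ nm_rC gtr0_norm ?invr_gt0//.
rewrite !ltr_pdivrMl// mulr1 => /(_ _)/ltW; apply.
by rewrite ltrDl.
Qed.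

End seminorms.

(** * Directional derivatives *)

Section mean_value.
Context {R : realType} {k : scalars}.
Local Notation C := (fld R k).

(** Multiplied by t, the difference quotient needs neither a division nor the exclusion of t = 0, so
    that error terms can simply be added. *)
Lemma dirderP (X H : tvsType C) (f : X -> H) y x l :
  is_dirder f y x l <->
  forall q, csn q -> forall e, 0 < e -> exists2 d : R, 0 < d &
    forall t : C, nm t < d -> q (f (x + t *: y) - f x - t *: l) <= e * nm t.
Proof.
rewrite /is_dirder csn_cvgP; split=> h q hq e e0.
  have /nbhs_nm[d d0 dP] := h q hq e e0; exists d => // t td.
  have [->|t0] := eqVneq t 0.
    by rewrite !scale0r addr0 subrr subr0 csn0// nm0 mulr0.
  have := dP t; rewrite subr0 => /(_ td t0)/ltW.
  have -> : t^-1 *: (f (x + t *: y) - f x) - l =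
    t^-1 *: (f (x + t *: y) - f x - t *: l) by rewrite [RHS]scalerBr scalerK.
  by rewrite csnZ// nmV ler_pdivrMl ?nm_gt0// mulrC.
have e2 : 0 < e / 2 by rewrite divr_gt0.
have [d d0 dP] := h q hq _ e2.
apply/nbhs_nm; exists d => // t; rewrite subr0 => td t0.
have -> : t^-1 *: (f (x + t *: y) - f x) - l =
   t^-1 *: (f (x + t *: y) - f x - t *: l) by rewrite [RHS]scalerBr scalerK.
rewrite csnZ// nmV ltr_pdivrMl ?nm_gt0// (le_lt_trans (dP t td))//.
rewrite mulrC ltr_pM2l ?nm_gt0// ltr_pdivrMr// mulr_natr mulr2n ltrDl//.
Qed.

(** Connectedness of [0, 1]: the bound (M + e) s holds at the supremum u of the points where it
    holds, and differentiability at u carries it beyond u unless u = 1. No integral is formed, so V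
    need not be complete. *)
Lemma mvt_real (V : tvsType C) (q : V -> R) (phi d : R -> V) (M : R) : csn q ->
  (forall s, 0 <= s <= 1 -> forall e, 0 < e -> exists2 r : R, 0 < r &
    forall t : R, `|t| < r -> q (phi (s + t) - phi s - rC t *: d s) <= e * `|t|) ->
  (forall s, 0 <= s <= 1 -> q (d s) <= M) ->
  q (phi 1 - phi 0) <= M.
Proof.
move=> hq hd hM; apply/ler_addgt0Pr => e e0.
have loc s : 0 <= s <= 1 -> exists2 r : R, 0 < r &
    forall t : R, `|t| < r -> q (phi (s + t) - phi s) <= (M + e) * `|t|.
  move=> s01; have [r r0 rP] := hd s s01 e e0; exists r => // t tr.
  rewrite -[X in q X](subrK (rC t *: d s)) (le_trans (csnD hq _ _))//.
  rewrite addrC mulrDl lerD ?rP// csnZ// nm_rC mulrC ler_wpM2r//.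
  exact: hM.
pose S := [set s : R | 0 <= s <= 1 /\ q (phi s - phi 0) <= (M + e) * s].
have S0 : S 0 by split; rewrite ?lexx ?ler01// subrr csn0// mulr0.
have hS : has_sup S by split; [exists 0|exists 1 => s [/andP[]]].
set u := sup S.
have u0 : 0 <= u by apply: (ub_le_sup hS.2 S0).
have u1 : u <= 1 by apply: ge_sup => [|s [/andP[]]//]; exists 0.
have [r r0 rP] := loc u (introT andP (conj u0 u1)).
have Su : S u.
  split; first by rewrite u0.
  have [s Ss us] := sup_adherent r0 hS.
  have su : s <= u by apply: (ub_le_sup hS.2).
  have := rP (s - u); rewrite distrC ger0_norm ?subr_ge0//.
  rewrite ltrBlDr -ltrBlDl => /(_ us); rewrite [u + (s - u)]addrC subrK => h.
  rewrite (le_trans (csn_trans hq (phi s) _ _))// csn_sym//.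
  rewrite (le_trans (lerD h Ss.2))// -mulrDr subrK//.
have [u1'|u1'] := eqVneq u 1.
  by move: Su => []; rewrite u1' mulr1.
have {u1'}u1 : u < 1 by rewrite lt_neqAle u1'.
(* A step inside the radius r that does not leave [0, 1]. *)
pose t := Num.min (r / 2) (1 - u).
have t0 : 0 < t by rewrite lt_min divr_gt0//= subr_gt0.
have tr : t < r by rewrite gt_min ltr_pdivrMr// mulr_natr mulr2n ltrDl r0.
have tu : u + t <= 1 by rewrite -lerBrDl ge_min lexx orbT.
suff /(ub_le_sup hS.2) : S (u + t) by rewrite -/u leNgt ltrDl t0.
split; first by rewrite tu andbT addr_ge0// ltW.
rewrite (le_trans (csn_trans hq (phi u) _ _))// mulrDr addrC lerD//; first exact: Su.2.
by rewrite -{2}(gtr0_norm t0) rP// gtr0_norm.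
Qed.

(* Differentiability at z of a curve on the scalar line, with respect to one
   seminorm. *)
Definition hasd (V : tvsType C) (q : V -> R) (g : C -> V) (z : C) (l : V) :=
  forall e, 0 < e -> exists2 r : R, 0 < r &
    forall t, nm t < r -> q (g (z + t) - g z - t *: l) <= e * nm t.

(** The mean value inequality for z |-> g z - z l on a segment: an increment differs from the linear
    one by at most the deviation of the derivative from l. *)
Lemma mvt_curve (V : tvsType C) (q : V -> R) (g g' : C -> V) (z0 z1 : C) (l : V) M :
  csn q -> (forall s, 0 <= s <= 1 -> hasd q g (z0 + rC s * (z1 - z0)) (g' (z0 + rC s * (z1 - z0)))) ->
  (forall s, 0 <= s <= 1 -> q (g' (z0 + rC s * (z1 - z0)) - l) <= M) ->
  q (g z1 - g z0 - (z1 - z0) *: l) <= nm (z1 - z0) * M.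
Proof.
move=> hq hd hM; set w := z1 - z0.
pose phi s := g (z0 + rC s * w) - (rC s * w) *: l.
pose d s := w *: (g' (z0 + rC s * w) - l).
have -> : g z1 - g z0 - w *: l = phi 1 - phi 0.
  rewrite /phi rC1 rC0 !mul1r mul0r scale0r addr0 subr0 /w [z0 + _]addrC subrK.
  by rewrite addrAC.
apply: (@mvt_real _ q phi d) => // [s s01 e e0|s s01]; last first.
  by rewrite csnZ// ler_wpM2l ?nm_ge0// hM.
have w0 : 0 < nm w + 1 by rewrite ltr_wpDl ?nm_ge0.
have [r r0 rP] := hd s s01 _ (divr_gt0 e0 w0); exists (r / (nm w + 1)); first exact: divr_gt0.
move=> t tr.
have := rP (rC t * w); rewrite nmM nm_rC => /(_ _)/le_trans.
have -> : phi (s + t) - phi s - rC t *: d s =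
   g (z0 + rC s * w + rC t * w) - g (z0 + rC s * w) - (rC t * w) *: g' (z0 + rC s * w).
  have eA : z0 + (rC s * w + rC t * w) = z0 + rC s * w + rC t * w by rewrite addrA.
  by rewrite /phi /d rCD mulrDl eA; lmodule V.
have tw : `|t| * nm w < r.
  rewrite (le_lt_trans _ (_ : `|t| * (nm w + 1) < r))//; last by rewrite -ltr_pdivlMr.
  by rewrite ler_wpM2l// lerDl.
move=> /(_ _ tw); apply.
have -> : e / (nm w + 1) * (`|t| * nm w) = e * `|t| * (nm w / (nm w + 1)).
  by field; rewrite gt_eqF.
by rewrite ler_piMr ?mulr_ge0 ?(ltW e0)// ler_pdivrMr// mul1r lerDl.
Qed.
End mean_value.

(** The tolerance e / (c + 1) absorbs a factor c without a separate case c = 0. *)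
Lemma ler_div1D (R : realFieldType) (e c t : R) : 0 <= e -> 0 <= c -> 0 <= t ->
  e / (c + 1) * (c * t) <= e * t.
Proof.
move=> e0 c0 t0; have c1 : 0 < c + 1 by rewrite ltr_wpDl.
have -> : e / (c + 1) * (c * t) = e * t * (c / (c + 1)) by field; rewrite gt_eqF.
by rewrite ler_piMr ?mulr_ge0// ler_pdivrMr// mul1r lerDl.
Qed.

Section directional.
Context {R : realType} {k : scalars}.
Local Notation C := (fld R k).
Implicit Types X H : tvsType C.

Lemma dirder_unique X H (f : X -> H) y x l l' : hausdorff_space H ->
  is_dirder f y x l -> is_dirder f y x l' -> l = l'.
Proof.
move=> hH /dirderP h /dirderP h'; apply: csn_sep hH _ => q hq.
apply/eqP; rewrite eq_le csn_ge0// andbT; apply/ler_addgt0Pr => e e0; rewrite add0r.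
have e2 : 0 < e / 2 by rewrite divr_gt0.
have [d d0 dP] := h q hq _ e2; have [d' d'0 dP'] := h' q hq _ e2.
pose s := Num.min d d' / 2; have s0 : 0 < s by rewrite divr_gt0// lt_min d0.
pose t : C := rC s; have nt : nm t = s by rewrite nm_rC gtr0_norm.
have sm : s < Num.min d d' by rewrite ltr_pdivrMr// mulr_natr mulr2n ltrDl lt_min d0.
have [sd sd'] : s < d /\ s < d' by apply/andP; rewrite -lt_min.
have := csnB hq (f (x + t *: y) - f x - t *: l') (f (x + t *: y) - f x - t *: l).
have -> : f (x + t *: y) - f x - t *: l' - (f (x + t *: y) - f x - t *: l) =
  t *: (l - l') by lmodule H.
rewrite csnZ// nt => h3.
rewrite -(ler_pM2l s0) (le_trans h3)// (le_trans (lerD (dP' _ _) (dP _ _))) ?nt//.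
by rewrite mulrC -mulrDr -splitr.
Qed.

Lemma dirderE X H (f : X -> H) y x l : hausdorff_space H ->
  is_dirder f y x l -> dirder f y x = l.
Proof.
move=> hH h; apply: (dirder_unique hH _ h).
by rewrite /dirder; case: xgetP => [//|/(_ l)].
Qed.

Lemma dirder_ex X H (f : X -> H) y x :
  (exists l, is_dirder f y x l) -> is_dirder f y x (dirder f y x).
Proof. by move=> [l h]; rewrite /dirder; case: xgetP => [//|/(_ l)]. Qed.

Lemma near_line X (x y : X) (P : set X) : nbhs x P ->
  exists2 d : R, 0 < d & forall t : C, nm t < d -> P (x + t *: y).
Proof.
move=> /csn_nbhsx[q hq qP].
have q0 : 0 < q y + 1 by rewrite ltr_wpDl ?csn_ge0.
exists (q y + 1)^-1; first by rewrite invr_gt0.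
move=> t td; apply: qP; rewrite addrC addKr csnZ//.
apply: (@le_lt_trans _ _ (nm t * (q y + 1))); first by rewrite ler_wpM2l ?nm_ge0 ?lerDl.
by rewrite -ltr_pdivlMr// div1r.
Qed.

Lemma dirder_near X H (f g : X -> H) y x l :
  (\forall z \near x, f z = g z) -> is_dirder f y x l -> is_dirder g y x l.
Proof.
move=> fg /dirderP h; apply/dirderP => q hq e e0.
have [d d0 dP] := h q hq e e0; have [d' d'0 dP'] := near_line y fg.
exists (Num.min d d'); first by rewrite lt_min d0.
move=> t; rewrite lt_min => /andP[td td'].
by rewrite -(dP' _ td') -(nbhs_singleton fg) dP.
Qed.

Lemma dirder_eq_near X H (f g : X -> H) y x :
  (\forall z \near x, f z = g z) -> dirder f y x = dirder g y x.
Proof.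
move=> fg; rewrite /dirder; congr xget; apply/funext => l; apply/propext.
by split; apply: dirder_near => //; apply: filterS fg => z ->.
Qed.

Lemma dirderD X H (f g : X -> H) y x l l' : is_dirder f y x l ->
  is_dirder g y x l' -> is_dirder (fun z => f z + g z) y x (l + l').
Proof.
move=> /dirderP h /dirderP h'; apply/dirderP => q hq e e0.
have e2 : 0 < e / 2 by rewrite divr_gt0.
have [d d0 dP] := h q hq _ e2; have [d' d'0 dP'] := h' q hq _ e2.
exists (Num.min d d'); first by rewrite lt_min d0.
move=> t; rewrite lt_min => /andP[td td'].
have -> : f (x + t *: y) + g (x + t *: y) - (f x + g x) - t *: (l + l') =
  (f (x + t *: y) - f x - t *: l) + (g (x + t *: y) - g x - t *: l') by lmodule H.
rewrite (le_trans (csnD hq _ _))// (le_trans (lerD (dP _ td) (dP' _ td')))//.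
by rewrite -mulrDl -splitr.
Qed.

Lemma dirder_scale X H (a : C) (f : X -> H) y x l : is_dirder f y x l ->
  is_dirder (fun z => a *: f z) y x (a *: l).
Proof.
move=> /dirderP h; apply/dirderP => q hq e e0.
have a1 : 0 < nm a + 1 by rewrite ltr_wpDl ?nm_ge0.
have [d d0 dP] := h q hq _ (divr_gt0 e0 a1); exists d => // t td.
have -> : a *: f (x + t *: y) - a *: f x - t *: (a *: l) =
  a *: (f (x + t *: y) - f x - t *: l) by lmodule H.
rewrite csnZ// (le_trans (ler_wpM2l (nm_ge0 _) (dP _ td)))// mulrCA.
by rewrite ler_div1D ?nm_ge0 ?ltW.
Qed.

Lemma dirderZ X H (a : C) (f : X -> H) y x l : is_dirder f y x l ->
  is_dirder f (a *: y) x (a *: l).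
Proof.
move=> /dirderP h; apply/dirderP => q hq e e0.
have a1 : 0 < nm a + 1 by rewrite ltr_wpDl ?nm_ge0.
have [d d0 dP] := h q hq _ (divr_gt0 e0 a1); exists (d / (nm a + 1)); first exact: divr_gt0.
move=> t td; rewrite !scalerA (le_trans (dP _ _))//.
  rewrite nmM (le_lt_trans _ (_ : nm t * (nm a + 1) < d))//; last by rewrite -ltr_pdivlMr.
  by rewrite ler_wpM2l ?nm_ge0// lerDl.
by rewrite nmM mulrC [nm t * _]mulrC mulrC ler_div1D ?nm_ge0 ?ltW.
Qed.

Lemma dirder_cst X H (c : H) y x : is_dirder (fun _ : X => c) y x 0.
Proof.
apply/dirderP => q hq e e0; exists 1 => // t _.
by rewrite subrr scaler0 subr0 csn0// mulr_ge0 ?nm_ge0 ?(ltW e0).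
Qed.

Lemma dirder_lin X H (l : X -> H) y x : linear l -> is_dirder l y x (l y).
Proof.
move=> ll; apply/dirderP => q hq e e0; exists 1 => // t _.
have -> : l (x + t *: y) - l x - t *: l y = 0.
  by rewrite (linD ll) (linZ ll); lmodule H.
by rewrite csn0// mulr_ge0 ?nm_ge0 ?(ltW e0).
Qed.

Lemma dirder_pair X H H' (f : X -> H) (g : X -> H') y x l l' :
  is_dirder f y x l -> is_dirder g y x l' ->
  is_dirder (fun z => (f z, g z)) y x (l, l').
Proof.
by move=> hf hg; exact: (cvg_pair hf hg).
Qed.

Lemma dirder_hasd X H (f : X -> H) (q : H -> R) x w z l : csn q ->
  is_dirder f w (x + z *: w) l -> hasd q (fun z => f (x + z *: w)) z l.
Proof.
move=> hq /dirderP h e e0; have [d d0 dP] := h q hq e e0; exists d => // t td.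
by rewrite scalerDl addrA dP.
Qed.

Section C1.
Context (X H : tvsType C) (U : set X) (f : X -> H) (df : X * X -> H).
Hypothesis dfP : forall x y, U x -> is_dirder f y x (df (x, y)).
Hypothesis Uo : open U.

(** Apply [mvt_curve] on the segment from x to x + t w, where the derivative [df (_, w)] is close to
    [df (x0, w0)] by continuity. Both linearity in the direction and the chain rule need an error
    that is uniform in the base point x and in the direction w. *)
Lemma strict_diff x0 w0 q e : U x0 -> {for (x0, w0), continuous df} ->
  csn q -> 0 < e ->
  exists d N M, [/\ 0 < d, nbhs x0 N, nbhs w0 M, N `<=` U & forall (t : C) x w,
    nm t < d -> N x -> M w ->
    q (f (x + t *: w) - f x - t *: df (x0, w0)) <= e * nm t].
Proof.
move=> Ux0 cf hq e0.
have [[A B] /= [nA nB] AB] := (csn_contP df (x0, w0)).1 cf q hq e e0.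
have nAU : nbhs x0 (A `&` U) by apply: filterI => //; apply: open_nbhs_nbhs.
have [p hp pA] := csn_nbhsx nAU.
have c0 : 0 < p w0 + 1 by rewrite ltr_wpDl ?csn_ge0.
(* One half of the unit p-ball is spent on x - x0, the other on t w, as p w <= p w0 + 1. *)
exists (2^-1 / (p w0 + 1)), [set x | p (x - x0) < 2^-1 /\ U x],
  [set w | B w /\ p (w - w0) < 1].
split.
- by rewrite divr_gt0// invr_gt0.
- apply: filterI; first by apply: csn_near => //; rewrite invr_gt0.
  by apply: open_nbhs_nbhs.
- by apply: filterI => //; apply: csn_near.
- by move=> x [].
move=> t x w td [xx0 Ux] [Bw ww0].
have pw : p w <= p w0 + 1.
  by rewrite -[w](subrK w0) (le_trans (csnD hp _ _))// addrC lerD2l ltW.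
have inA (s : R) : 0 <= s <= 1 -> (A `&` U) (x + (rC s * t) *: w).
  move=> /andP[s0 s1]; apply: pA.
  rewrite addrAC (le_lt_trans (csnD hp _ _))// [ltRHS]splitr div1r ltr_leD//.
  rewrite csnZ// nmM nm_rC ger0_norm//.
  apply: (@le_trans _ _ (nm t * (p w0 + 1))).
    by rewrite ler_pM ?mulr_ge0 ?nm_ge0 ?csn_ge0// ler_piMl// nm_ge0.
  by rewrite -ler_pdivlMr// ltW.
have := @mvt_curve R k H q (fun z => f (x + z *: w)) (fun z => df (x + z *: w, w)) 0 t
  (df (x0, w0)) e hq.
rewrite scale0r addr0 subr0 mulrC; apply=> s s01; rewrite add0r.
  by apply: dirder_hasd => //; apply: dfP; case: (inA s s01).
by apply/ltW/(AB (_, _)); split=> //=; case: (inA s s01).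
Qed.

(** Go from x along t a u and then along t v. The second step starts at a point that moves with t,
    which [strict_diff] permits; the first step is homogeneity. *)
Lemma C1_linear x : hausdorff_space H -> U x ->
  (forall w, {for (x, w), continuous df}) -> linear (fun w => df (x, w)).
Proof.
move=> hH Ux cdf a u v; apply: (@dirder_unique _ _ f (a *: u + v) x) => //.
  exact: dfP.
have hl : is_dirder f (a *: u) x (a *: df (x, u)) by apply/dirderZ/dfP.
apply/dirderP => q hq e e0.
have e2 : 0 < e / 2 by rewrite divr_gt0.
have [d [N [M [d0 nN nM NU dP]]]] := strict_diff Ux (cdf v) hq e2.
have [d' d'0 dP'] := (dirderP _ _ _ _).1 hl q hq _ e2.
have [d2 d20 dP2] := near_line (a *: u) nN.
exists (Num.min d (Num.min d' d2)); first by rewrite !lt_min d0 d'0.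
move=> t; rewrite !lt_min => /and3P[td td' td2].
have eA : x + t *: (a *: u + v) = x + t *: (a *: u) + t *: v.
  by rewrite scalerDr addrA.
have -> : f (x + t *: (a *: u + v)) - f x - t *: (a *: df (x, u) + df (x, v)) =
  (f (x + t *: (a *: u) + t *: v) - f (x + t *: (a *: u)) - t *: df (x, v)) +
  (f (x + t *: (a *: u)) - f x - t *: (a *: df (x, u))) by rewrite eA; lmodule H.
rewrite (le_trans (csnD hq _ _))// (le_trans (lerD (dP _ _ _ _ _ _) (dP' _ _)))//.
- exact: dP2.
- exact: nbhs_singleton.
- by rewrite -mulrDl -splitr.
Qed.

(** The increment of g is t times its difference quotient, a direction that tends to w;
    [strict_diff] allows the direction to vary with t. *)
Lemma chain_rule (Y : tvsType C) (g : Y -> X) y v w :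
  U (g y) -> {for (g y, w), continuous df} -> is_dirder g v y w ->
  is_dirder (f \o g) v y (df (g y, w)).
Proof.
move=> Ug cdf hg; apply/dirderP => q hq e e0.
have [d [N [M [d0 nN nM NU dP]]]] := strict_diff Ug cdf hq e0.
have /nbhs_nm[d' d'0 dP'] := hg _ nM.
exists (Num.min d d'); first by rewrite lt_min d0.
move=> t; rewrite lt_min => /andP[td td'] /=.
have [->|t0] := eqVneq t 0.
  by rewrite !scale0r addr0 subrr subr0 csn0// nm0 mulr0.
have := dP' t; rewrite subr0 => /(_ td' t0) Mt.
have := dP t (g y) _ td (nbhs_singleton nN) Mt.
by rewrite scalerKV// [g y + _]addrC subrK.
Qed.

End C1.
End directional.

(** * Iterated C^1 maps *)

Lemma open_nearP (T : topologicalType) (U : set T) : open U <-> forall x, U x -> \forall y \near x, U y.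
Proof. by rewrite openE; split => h x; apply: h. Qed.

Lemma open_near (T : topologicalType) (U : set T) x : open U -> U x -> \forall y \near x, U y.
Proof. by move=> /open_nearP; apply. Qed.

Section open_sets.
Context {S T : topologicalType}.

Lemma near_pair (a : S) (b : T) (P : set S) (Q : set T) :
  nbhs a P -> nbhs b Q -> nbhs (a, b) (P `*` Q).
Proof. by move=> hP hQ; exists (P, Q). Qed.

Lemma near_pairP (a : S) (b : T) (P : set (S * T)) : nbhs (a, b) P ->
  exists A B, [/\ nbhs a A, nbhs b B & forall x y, A x -> B y -> P (x, y)].
Proof. by move=> [[A B] /= [hA hB] AB]; exists A, B; split => // x y Ax By; apply: AB. Qed.

Lemma open_prod (P : set S) (Q : set T) : open P -> open Q -> open (P `*` Q).
Proof.
by move=> oP oQ; apply/open_nearP => -[x y] [/= Px Qy]; apply: near_pair; apply: open_near.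
Qed.

Lemma within_contP (U : set S) (f : S -> T) : open U ->
  {within U, continuous f} <-> forall x, U x -> {for x, continuous f}.
Proof.
move=> oU; rewrite continuous_open_subspace//; split=> h x.
  by move=> Ux; apply: h; rewrite inE.
by rewrite inE; exact: h.
Qed.

Lemma cont_near (f g : S -> T) x : (\forall y \near x, f y = g y) ->
  {for x, continuous f} -> {for x, continuous g}.
Proof.
move=> fg cf O nO; rewrite -(nbhs_singleton fg) in nO.
by have := cf O nO; apply: filterS2 fg => y /= ->.
Qed.

Lemma open_preim (U : set S) (f : S -> T) (V : set T) : open U -> open V ->
  (forall x, U x -> {for x, continuous f}) -> open [set x | U x /\ V (f x)].
Proof.
move=> oU oV cf; apply/open_nearP => x [Ux Vx].
by apply: filterI; [exact: open_near|apply: (cf x Ux); exact: open_near].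
Qed.

End open_sets.

Section iterated_C1.
Context {R : realType} {k : scalars}.
Local Notation C := (fld R k).

Definition cont_on (X H : topologicalType) (U : set X) (f : X -> H) :=
  forall x, U x -> {for x, continuous f}.

(* C^n as iterated C^1: f is C^(n+1) iff (x, y) |-> D_y f (x) exists and is C^n
   jointly. In this form the chain rule is a direct induction. *)
Fixpoint IC (n : nat) : forall X H : tvsType C, set X -> (X -> H) -> Prop :=
  match n with
  | 0 => fun X H U f => cont_on U f
  | m.+1 => fun X H U f => cont_on U f /\ exists df : X * X -> H,
      (forall x y, U x -> is_dirder f y x (df (x, y))) /\ IC m (U `*` setT) df
  end.

Implicit Types X Y H : tvsType C.

Lemma IC_cont n X H (U : set X) (f : X -> H) : IC n U f -> cont_on U f.
Proof. by case: n => [|n] //= []. Qed.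

Lemma IC_pred n X H (U : set X) (f : X -> H) : IC n.+1 U f -> IC n U f.
Proof.
elim: n X U f => [|n IH] X U f; first by case.
by case=> cf [df [dfP /IH h]]; split => //; exists df.
Qed.

Lemma IC_sub n X H (U U' : set X) (f g : X -> H) : open U' -> U' `<=` U ->
  (forall x, U' x -> f x = g x) -> IC n U f -> IC n U' g.
Proof.
elim: n X U U' f g => [|n IH] X U U' f g oU' U'U fg /=.
  move=> cf x U'x; apply: (@cont_near _ _ f); last exact/cf/U'U.
  by near=> y; apply: fg; near: y; exact: open_near.
case=> cf [df [dfP hdf]]; split.
  move=> x U'x; apply: (@cont_near _ _ f); last exact/cf/U'U.
  by near=> y; apply: fg; near: y; exact: open_near.
exists df; split.
  move=> x y U'x; apply: (@dirder_near _ _ _ _ f); last exact/dfP/U'U.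
  by near=> z; apply: fg; near: z; exact: open_near.
apply: IH hdf => //; first exact: open_prod oU' openT.
by move=> [x y] [/= /U'U].
Unshelve. all: by end_near. Qed.

Lemma IC_eq n X H (U : set X) (f g : X -> H) : open U ->
  (forall x, U x -> f x = g x) -> IC n U f -> IC n U g.
Proof. by move=> oU fg; apply: IC_sub. Qed.

(** In a Hausdorff space directional derivatives are unique, so all local derivatives coincide with
    [dirder], which is defined globally. *)
Lemma IC_local n X H (U : set X) (f : X -> H) : hausdorff_space H ->
  (forall x, U x -> exists V, [/\ open V, V x & IC n V f]) -> IC n U f.
Proof.
move=> hH; elim: n X U f => [|n IH] X U f h /=.
  by move=> x /h[V [_ Vx]]; apply.
split; first by move=> x /h[V [_ Vx [+ _]]]; apply.
exists (fun p => dirder f p.2 p.1); split.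
  move=> x y /h[V [_ Vx [_ [df [dfP _]]]]]; apply: dirder_ex.
  by exists (df (x, y)); exact: dfP.
apply: IH => -[x y] [/= /h[V [oV Vx [_ [df [dfP hdf]]]]] _].
exists (V `*` setT); split => //; first exact: open_prod oV openT.
apply: IC_eq hdf; first exact: open_prod oV openT.
by move=> [z w] [/= Vz _]; rewrite (dirderE hH (dfP z w Vz)).
Qed.

Lemma lin_fst X Y : linear (fst : X * Y -> X). Proof. by []. Qed.
Lemma lin_snd X Y : linear (snd : X * Y -> Y). Proof. by []. Qed.
Lemma cont_fst X Y : continuous (fst : X * Y -> X). Proof. by move=> x; exact: cvg_fst. Qed.
Lemma cont_snd X Y : continuous (snd : X * Y -> Y). Proof. by move=> x; exact: cvg_snd. Qed.
Lemma lin_comp X Y H (f : X -> Y) (g : Y -> H) : linear f -> linear g -> linear (g \o f).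
Proof. by move=> lf lg a x y /=; rewrite lf lg. Qed.
Lemma cont_comp (A B D : topologicalType) (f : A -> B) (g : B -> D) :
  continuous f -> continuous g -> continuous (g \o f).
Proof. by move=> cf cg x; apply: continuous_comp; [exact: cf|exact: cg]. Qed.
Lemma cont_pair_at (A B D : topologicalType) (f : A -> B) (g : A -> D) x :
  {for x, continuous f} -> {for x, continuous g} ->
  {for x, continuous (fun x => (f x, g x))}.
Proof. by move=> cf cg; exact: (cvg_pair cf cg). Qed.
Lemma cont_pair (A B D : topologicalType) (f : A -> B) (g : A -> D) :
  continuous f -> continuous g -> continuous (fun x => (f x, g x)).
Proof. by move=> cf cg x; apply: cont_pair_at; [exact: cf|exact: cg]. Qed.
Lemma lin_id X : linear (@id X). Proof. by []. Qed.
Lemma cont_id (A : topologicalType) : continuous (@id A). Proof. by move=> x; exact: cvg_id. Qed.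
Lemma cont_cst (A B : topologicalType) (b : B) : continuous (fun _ : A => b).
Proof. by move=> x; exact: cvg_cst. Qed.
Lemma lin_add X : linear (fun p : X * X => p.1 + p.2).
Proof. by move=> a x y /=; rewrite scalerDr addrACA. Qed.
Lemma lin_scale X (c : C) : linear (fun x : X => c *: x).
Proof. by move=> a x y; rewrite scalerDr !scalerA mulrC. Qed.

Lemma IC_lin n X H (U : set X) (l : X -> H) : linear l -> continuous l -> IC n U l.
Proof.
elim: n X U l => [|n IH] X U l ll cl /=; first by move=> x _; exact: cl.
split; first by move=> x _; exact: cl.
exists (l \o snd); split; first by move=> x y _; exact: dirder_lin.
by apply: IH; [exact: lin_comp (@lin_snd X X) ll|exact: cont_comp (@cont_snd X X) cl].
Qed.

Lemma IC_cst n X H (U : set X) (c : H) : IC n U (fun=> c).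
Proof.
elim: n X U c => [|n IH] X U c /=; first by move=> x _; exact: cont_cst.
split; first by move=> x _; exact: cont_cst.
by exists (fun=> 0); split=> // x y _; exact: dirder_cst.
Qed.

Lemma IC_pair n X Y H (U : set X) (f : X -> Y) (g : X -> H) :
  IC n U f -> IC n U g -> IC n U (fun x => (f x, g x)).
Proof.
elim: n X U f g => [|n IH] X U f g /=.
  by move=> cf cg x Ux; apply: cont_pair_at; [exact: cf|exact: cg].
move=> [cf [df [dfP hdf]]] [cg [dg [dgP hdg]]]; split.
  by move=> x Ux; apply: cont_pair_at; [exact: cf|exact: cg].
exists (fun p => (df p, dg p)); split; last exact: IH.
by move=> x y Ux; apply: dirder_pair; [exact: dfP|exact: dgP].
Qed.

Lemma IC_comp n X Y H (U : set X) (V : set Y) (f : X -> Y) (g : Y -> H) :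
  open U -> open V -> (forall x, U x -> V (f x)) -> IC n U f -> IC n V g -> IC n U (g \o f).
Proof.
elim: n X Y H U V f g => [|n IH] X Y H U V f g oU oV UV.
  by move=> cf cg x Ux; apply: continuous_comp; [exact: cf|exact/cg/UV].
move=> hf hg; have [cf [df [dfP hdf]]] := hf; have [cg [dg [dgP hdg]]] := hg.
split; first by move=> x Ux; apply: continuous_comp; [exact: cf|exact/cg/UV].
have oUT : open (U `*` [set: X]) by exact: open_prod oU openT.
exists (fun p => dg (f p.1, df p)); split.
  move=> x y Ux; have Vfx := UV x Ux.
  apply: (@chain_rule _ _ _ _ V g dg) => //; last exact: dfP.
  by apply: (IC_cont hdg).
apply: (IH _ _ _ _ (V `*` setT) (fun p => (f p.1, df p)) dg) => //.
- exact: open_prod oV openT.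
- by move=> [x y] [/= Ux _]; split=> //=; exact: UV.
apply: IC_pair => //.
apply: (IH _ _ _ _ U fst f) => //; [by move=> p []| |exact: IC_pred].
by apply: IC_lin; [exact: lin_fst|exact: cont_fst].
Qed.

Lemma IC_postlin n X Y H (U : set X) (f : X -> Y) (l : Y -> H) : open U ->
  linear l -> continuous l -> IC n U f -> IC n U (l \o f).
Proof.
move=> oU ll cl hf; apply: (IC_comp oU openT _ hf) => //; exact: IC_lin.
Qed.

Lemma IC_prelin n X Y H (U : set X) (V : set Y) (l : X -> Y) (f : Y -> H) :
  open U -> open V -> (forall x, U x -> V (l x)) ->
  linear l -> continuous l -> IC n V f -> IC n U (f \o l).
Proof. by move=> oU oV UV ll cl hf; apply: (IC_comp oU oV UV _ hf); exact: IC_lin. Qed.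

Lemma IC_add n X H (U : set X) (f g : X -> H) : open U -> IC n U f -> IC n U g ->
  IC n U (fun x => f x + g x).
Proof.
move=> oU hf hg; apply: (@IC_postlin _ _ _ _ _ (fun x => (f x, g x)) (fun p => p.1 + p.2)) => //.
- exact: lin_add.
- exact: add_continuous.
- exact: IC_pair.
Qed.

Lemma IC_scale n X H (U : set X) (c : C) (f : X -> H) : open U -> IC n U f ->
  IC n U (fun x => c *: f x).
Proof.
move=> oU; apply: (@IC_postlin _ _ _ _ _ f (fun x => c *: x)) => //.
- exact: lin_scale.
- exact: scale_contl.
Qed.

Lemma IC_sum n X H (U : set X) (I : Type) (s : seq I) (f : I -> X -> H) : open U ->
  (forall i, List.In i s -> IC n U (f i)) -> IC n U (fun x => \sum_(i <- s) f i x).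
Proof.
move=> oU; elim: s => [|i s IH] h.
  by apply: (IC_eq oU (f := fun=> 0)); [move=> x _; rewrite big_nil|exact: IC_cst].
apply: (IC_eq oU (f := fun x => f i x + \sum_(i <- s) f i x)).
  by move=> x _; rewrite big_cons.
by apply: IC_add => //; [apply: h; left|apply: IH => j js; apply: h; right].
Qed.

End iterated_C1.

(** * Fibrewise extension to a completion *)

Section continuous_extension.
Context {R : realType} {k : scalars}.
Local Notation C := (fld R k).

Lemma dense_near (V : Type) (W : topologicalType) (j : V -> W) :
  closure (range j) = setT ->
  forall (w : W) (N : set W), nbhs w N -> exists v, N (j v).
Proof.
move=> dj w N nN; have : closure (range j) w by rewrite dj.
by move=> /(_ N nN)[_ [[v _ <-] Nv]]; exists v.
Qed.

Lemma dense_eq (V : Type) (W : topologicalType) (W' : tvsType C) (j : V -> W)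
    (g g' : W -> W') : closure (range j) = setT -> hausdorff_space W' ->
  continuous g -> continuous g' -> (forall v, g (j v) = g' (j v)) -> g = g'.
Proof.
move=> dj hW' cg cg' e; apply/funext => w; apply: csn_sep hW' _ => q hq.
apply/eqP; rewrite eq_le csn_ge0// andbT; apply/ler_addgt0Pr => d d0; rewrite add0r.
have d2 : 0 < d / 2 by rewrite divr_gt0.
have n1 := (csn_contP g w).1 (cg w) q hq _ d2.
have n2 := (csn_contP g' w).1 (cg' w) q hq _ d2.
have [v [/= h1 h2]] := dense_near dj (filterI n1 n2).
rewrite (le_trans (csn_trans hq (g (j v)) _ _))// [leRHS]splitr lerD//.
  by rewrite csn_sym// ltW.
by rewrite e ltW.
Qed.

Lemma csn_dense_le (V : Type) (W W' : tvsType C) (j : V -> W) (g : W -> W')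
    (q : W' -> R) (p : W -> R) : closure (range j) = setT -> continuous g ->
  csn q -> csn p -> (forall v, q (g (j v)) <= p (j v)) -> forall w, q (g w) <= p w.
Proof.
move=> dj cg hq hp h w; apply/ler_addgt0Pr => d d0.
have d2 : 0 < d / 2 by rewrite divr_gt0.
have n1 := (csn_contP g w).1 (cg w) q hq _ d2.
have n2 := csn_near w hp d2.
have [v [/= h1 h2]] := dense_near dj (filterI n1 n2).
have := csnB hq (g (j v)) (g (j v) - g w); rewrite opprB addrC subrK => /le_trans; apply.
have : p (j v) <= p w + d / 2.
  by rewrite -[j v](subrK w) (le_trans (csnD hp _ _))// addrC lerD2l ltW.
by have := h v; move: h1; lra.
Qed.

(** V carries no topology here, because a fibre of the bundle is a bare module; domination by
    seminorms pulled back along j expresses the continuity of D. *)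
Lemma extension_ex (V : lmodType C) (W W' : tvsType C) (j : V -> W) (D : V -> W') :
  linear j -> linear D -> closure (range j) = setT -> hausdorff_space W' ->
  tvs_complete W' ->
  (forall q, csn q -> exists2 p, csn p & forall v, q (D v) <= p (j v)) ->
  exists g : W -> W', [/\ linear g, continuous g & forall v, g (j v) = D v].
Proof.
move=> lj lD dj hW' cW' dom.
(* The image under D of the trace on V of the neighbourhoods of w. Domination makes it a Cauchy
   filter, and [g w] is its limit. *)
pose Fw (w : W) : set_system W' := [set A | exists2 N, nbhs w N & forall v, N (j v) -> A (D v)].
have PFw w : ProperFilter (Fw w).
  apply: Build_ProperFilter_ex.
    move=> A [N nN NA]; have [v Nv] := dense_near dj nN.
    by exists (D v); exact: NA.
  split.
  - by exists setT => //; exact: filterT.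
  - move=> A B [N nN NA] [M nM MB]; exists (N `&` M); first exact: filterI.
    by move=> v [/NA ? /MB ?].
  - by move=> A B AB [N nN NA]; exists N => // v /NA /AB.
have [g gP] : {g : W -> W' & forall w, Fw w --> g w}.
  apply: (@choice W W' (fun w x => Fw w --> x)) => w; apply: cW' => O /csn_nbhs[q hq qO].
  have [p hp qp] := dom q hq.
  exists (D @` [set v | p (j v - w) < 2^-1]).
    exists [set y | p (y - w) < 2^-1]; first by apply: csn_near; rewrite ?invr_gt0.
    by move=> v /= h; exists v.
  move=> _ _ [v /= h <-] [v' /= h' <-]; apply: qO.
  rewrite -(linB lD) (le_lt_trans (qp _))// (linB lj).
  rewrite (le_lt_trans (csn_trans hp w _ _))//.
  by rewrite (csn_sym hp w); move: h h'; lra.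
(* Domination survives the passage to the limit in one argument; agreement with D, linearity and
   continuity of g all follow from this inequality. *)
have key q p : csn q -> csn p -> (forall v, q (D v) <= p (j v)) ->
    forall v w, q (D v - g w) <= p (j v - w).
  move=> hq hp qp v w; apply/ler_addgt0Pr => d d0.
  have d2 : 0 < d / 2 by rewrite divr_gt0.
  have [N nN NA] := gP w _ (csn_near (g w) hq d2).
  have [v' [/NA/= h1 /= h2]] := dense_near dj (filterI nN (csn_near w hp d2)).
  rewrite (le_trans (csn_trans hq (D v') _ _))//.
  have : q (D v - D v') <= p (j v - j v') by rewrite -(linB lD) -(linB lj) qp.
  have := csn_trans hp w (j v) (j v'); rewrite (csn_sym hp w).
  by move: h1 h2; lra.
have gD v : g (j v) = D v.
  apply: csn_sep hW' _ => q hq; have [p hp qp] := dom q hq.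
  apply/eqP; rewrite eq_le csn_ge0// andbT csn_sym//.
  by rewrite (le_trans (key q p hq hp qp _ _))// subrr csn0.
have glin : linear g.
  move=> a w w'; apply: csn_sep hW' _ => q hq; have [p hp qp] := dom q hq.
  apply/eqP; rewrite eq_le csn_ge0// andbT; apply/ler_addgt0Pr => d d0; rewrite add0r.
  (* Both w and w' are approximated up to d / c. The error in w is multiplied by |a|, and each error
     occurs twice, through D and through j. *)
  pose c := 2 * (nm a + 1).
  have c0 : 0 < c by rewrite mulr_gt0// ltr_wpDl ?nm_ge0.
  have dc : 0 < d / c by rewrite divr_gt0.
  have [v /= hv] := dense_near dj (csn_near w hp dc).
  have [v' /= hv'] := dense_near dj (csn_near w' hp dc).
  have k1 := key q p hq hp qp (a *: v + v') (a *: w + w').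
  have k2 := key q p hq hp qp v w; have k3 := key q p hq hp qp v' w'.
  have e1 : g (a *: w + w') - (a *: g w + g w') =
    (a *: (D v - g w) + (D v' - g w')) - (D (a *: v + v') - g (a *: w + w')).
    by rewrite lD; lmodule W'.
  have e2 : j (a *: v + v') - (a *: w + w') = a *: (j v - w) + (j v' - w').
    by rewrite lj; lmodule W.
  rewrite e1 (le_trans (csnB hq _ _))//.
  have k4 := csnD hq (a *: (D v - g w)) (D v' - g w'); rewrite csnZ// in k4.
  have k5 := csnD hp (a *: (j v - w)) (j v' - w'); rewrite csnZ// in k5.
  rewrite e2 in k1.
  have m1 : nm a * q (D v - g w) <= nm a * (d / c).
    by rewrite ler_wpM2l ?nm_ge0// (le_trans k2)// ltW.
  have m2 : nm a * p (j v - w) <= nm a * (d / c) by rewrite ler_wpM2l ?nm_ge0// ltW.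
  have e3 : 2 * (nm a * (d / c)) + 2 * (d / c) = d.
    have -> : 2 * (nm a * (d / c)) + 2 * (d / c) = c * (d / c) by rewrite /c; ring.
    by rewrite mulrC divfK// gt_eqF.
  by move: m1 m2 e3 k1 k3 k4 k5 hv' ; lra.
exists g; split=> // w; apply/csn_contP => q hq e e0.
have [p hp qp] := dom q hq; apply: filterS (csn_near w hp e0) => y.
apply: le_lt_trans; rewrite -(linB glin) -csnN//.
have := key q p hq hp qp 0 (y - w).
by rewrite (lin0 lD) (lin0 lj) !sub0r (csnN hp).
Qed.

(** Continuity of j and the last clause say that F has the topology induced by j, in the form in
    which estimates use it. *)
Definition dense_emb (F Ft : tvsType C) (j : F -> Ft) := [/\ linear j, continuous j,
  closure (range j) = setT &
  forall p, csn p -> exists2 p', csn p' & forall v, p v <= p' (j v)].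

(* The homogeneity of a map which is linear in v turns continuity at (x0, 0)
   into a bound by one seminorm, uniformly for x near x0. *)
Lemma linear_loc_bound (X F Z : tvsType C) (U : set X) (f : X * F -> Z) x0 q :
  open U -> (forall x, U x -> linear (fun v => f (x, v))) -> U x0 ->
  {for (x0, 0), continuous f} -> csn q ->
  exists N p, [/\ nbhs x0 N, N `<=` U, csn p &
    forall x v, N x -> q (f (x, v)) <= p v].
Proof.
move=> oU lf Ux0 cf hq.
have := (csn_contP f (x0, 0)).1 cf q hq 1 ltr01.
rewrite (lin0 (lf _ Ux0)) => /near_pairP[A [B [nA nB AB]]].
have [p hp pB] := csn_nbhs nB.
exists (A `&` U), p; split => //; first by apply: filterI => //; exact: open_near.
move=> x v [Ax Ux]; apply: (homog_le (q := fun v => q (f (x, v)))) => [y|a y|a y|y /pB By]; rewrite ?csn_ge0 ?csnZ//.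
  by rewrite (linZ (lf _ Ux)) csnZ.
by have := AB x y Ax By; rewrite subr0.
Qed.

Section fibrewise.
Context (X F Ft Z : tvsType C) (j : F -> Ft) (U : set X) (f : X * F -> Z)
  (ft : X * Ft -> Z).
Hypothesis je : dense_emb j.
Hypothesis oU : open U.
Hypothesis lf : forall x, U x -> linear (fun v => f (x, v)).
Hypothesis lft : forall x, U x -> linear (fun v => ft (x, v)).
Hypothesis cft : forall x, U x -> continuous (fun v => ft (x, v)).
Hypothesis ftj : forall x v, U x -> ft (x, j v) = f (x, v).

(** The uniform seminorm bound passes to [ft] by density, so v may be exchanged for a nearby v1 in F
    at a cost that is the same for all x near x0; at v1 the map f is continuous in x. *)
Lemma fibrewise_ext_cont : cont_on (U `*` setT) f -> cont_on (U `*` setT) ft.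
Proof.
have [lj cj dj domj] := je.
move=> cf [x0 v0] [/= Ux0 _]; apply/csn_contP => q hq e e0.
have [N [p' [nN NU hp' hp]]] := linear_loc_bound oU lf Ux0 (cf (x0, 0) (conj Ux0 I)) hq.
have [p hp1 pp'] := domj _ hp'.
have bd x v : N x -> q (ft (x, v)) <= p v.
  move=> Nx; have Ux := NU _ Nx.
  apply: (csn_dense_le dj (cft Ux) hq hp1) => w.
  by rewrite ftj// (le_trans (hp _ _ Nx)).
(* Two quarters pay for v - j v1, one for the motion of x at v1, and one for j v1 - v0. *)
have e4 : 0 < e / 4 by rewrite divr_gt0.
have [v1 /= hv1] := dense_near dj (csn_near v0 hp1 e4).
have cf1 : {for x0, continuous (fun x => f (x, v1))}.
  apply: (@continuous_comp _ _ _ (fun x => (x, v1)) f); last exact: cf.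
  by apply: cont_pair; [exact: cont_id|exact: cont_cst].
have n1 := (csn_contP _ _).1 cf1 q hq _ e4.
apply: filterS (near_pair (filterI nN n1) (csn_near v0 hp1 e4)) => -[x v] [[/= Nx h1] /= h2].
have Ux := NU _ Nx.
have -> : ft (x, v) - ft (x0, v0) =
  ft (x, v - j v1) + ((f (x, v1) - f (x0, v1)) + ft (x0, j v1 - v0)).
  by rewrite (linB (lft Ux)) (linB (lft Ux0)) /= !ftj//; lmodule Z.
rewrite (le_lt_trans (csnD hq _ _))//.
have b1 := bd x (v - j v1) Nx.
have b2 := bd x0 (j v1 - v0) (nbhs_singleton nN).
have b3 := csnD hq (f (x, v1) - f (x0, v1)) (ft (x0, j v1 - v0)).
have b4 := csn_trans hp1 v0 v (j v1); rewrite (csn_sym hp1 v0) in b4.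
by move: h1 h2 hv1 b1 b2 b3 b4; lra.
Qed.

End fibrewise.

Lemma fibrewise_ext_ex (X F Ft Z : tvsType C) (j : F -> Ft) (U : set X)
    (f : X * F -> Z) : dense_emb j -> hausdorff_space Z -> tvs_complete Z -> open U ->
  (forall x, U x -> linear (fun v => f (x, v))) -> cont_on (U `*` setT) f ->
  exists ft : X * Ft -> Z, forall x, U x -> [/\ linear (fun v => ft (x, v)),
    continuous (fun v => ft (x, v)) & forall v, ft (x, j v) = f (x, v)].
Proof.
move=> [lj cj dj domj] hZ cZ oU lf cf.
have [g gP] : {g : X -> Ft -> Z & forall x, U x ->
    [/\ linear (g x), continuous (g x) & forall v, g x (j v) = f (x, v)]}.
  apply: (@choice X (Ft -> Z) (fun x g => U x ->
    [/\ linear g, continuous g & forall v, g (j v) = f (x, v)])) => x; have [Ux|] := pselect (U x); last by exists (fun=> 0).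
  have [|g hg] := extension_ex lj (lf x Ux) dj hZ cZ; last by exists g.
  move=> q hq.
  have [N [p' [nN NU hp' hp]]] := linear_loc_bound oU lf Ux (cf (x, 0) (conj Ux I)) hq.
  have [p hp1 pp'] := domj _ hp'; exists p => // v.
  by rewrite (le_trans (hp _ _ (nbhs_singleton nN))).
by exists (fun p => g p.1 p.2) => x /gP.
Qed.

(* The derivative of the extension is the extension of the partial derivative
   in x plus the extension itself, so no order of differentiability is lost. *)
Lemma IC_fibrewise_ext n (X F Ft Z : tvsType C) (j : F -> Ft) (U : set X)
    (f : X * F -> Z) (ft : X * Ft -> Z) :
  dense_emb j -> hausdorff_space Z -> tvs_complete Z -> open U ->
  (forall x, U x -> linear (fun v => f (x, v))) ->
  (forall x, U x -> linear (fun v => ft (x, v))) ->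
  (forall x, U x -> continuous (fun v => ft (x, v))) ->
  (forall x v, U x -> ft (x, j v) = f (x, v)) ->
  IC n (U `*` setT) f -> IC n (U `*` setT) ft.
Proof.
move=> je hZ cZ; elim: n X U f ft => [|n IH] X U f ft oU lf lft cft ftj hf.
  exact: (fibrewise_ext_cont je oU lf lft cft ftj hf).
have [cf [df [dfP hdf]]] := hf.
have cft' : cont_on (U `*` setT) ft by exact: (fibrewise_ext_cont je oU lf lft cft ftj cf).
split=> //.
have [lj cj dj domj] := je.
have oUX : open (U `*` [set: X]) by exact: open_prod oU openT.
have oUF : open (U `*` [set: F]) by exact: open_prod oU openT.
have oUFt : open (U `*` [set: Ft]) by exact: open_prod oU openT.
(* The partial derivative in x along y, a fibrewise linear map over the base [X * X]; hence the
   induction is on n for all base spaces at once. *)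
pose g (p : (X * X) * F) := df ((p.1.1, p.2), (p.1.2, 0)).
have gP x y v : U x -> is_dirder f (y, 0) (x, v) (g ((x, y), v)).
  by move=> Ux; apply: dfP.
have fl x y v t : (x, v) + t *: (y, 0) = (x + t *: y, v) :> X * F.
  by congr (_, _); rewrite /= scaler0 addr0.
(* The difference quotients in x are linear in v as soon as x + t y lies in U, and derivatives are
   unique. *)
have lg p : (U `*` setT) p -> linear (fun v => g (p, v)).
  case: p => x y [/= Ux _] a v w.
  apply: (dirder_unique hZ (gP x y _ Ux)).
  have /dirderP h := dirder_scale (a := a) (gP x y v Ux).
  have /dirderP h' := gP x y w Ux; apply/dirderP => q hq e e0.
  have e2 : 0 < e / 2 by rewrite divr_gt0.
  have [d d0 dP] := h q hq _ e2; have [d' d'0 dP'] := h' q hq _ e2.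
  have [d1 d10 dP1] := near_line y (open_near oU Ux).
  exists (Num.min d (Num.min d' d1)); first by rewrite !lt_min d0 d'0.
  move=> t; rewrite !lt_min => /and3P[td td' td1].
  have := dP t td; have := dP' t td'; rewrite !fl => h1 h2.
  rewrite (lf _ Ux) (lf _ (dP1 _ td1)).
  have -> : a *: f (x + t *: y, v) + f (x + t *: y, w) - (a *: f (x, v) + f (x, w)) -
      t *: (a *: g (x, y, v) + g (x, y, w)) =
    (a *: f (x + t *: y, v) - a *: f (x, v) - t *: (a *: g (x, y, v))) +
    (f (x + t *: y, w) - f (x, w) - t *: g (x, y, w)) by lmodule Z.
  by rewrite (le_trans (csnD hq _ _))// [e]splitr mulrDl lerD.
have hg : IC n ((U `*` setT) `*` setT) g.
  apply: (@IC_prelin _ _ n _ _ _ _ ((U `*` setT) `*` setT)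
    (fun p : (X * X) * F => ((p.1.1, p.2), (p.1.2, 0))) df) => //.
  - exact: open_prod oUX openT.
  - exact: open_prod oUF openT.
  - by move=> a [[? ?] ?] [[? ?] ?]; congr (_, (_, _)); rewrite /= scaler0 addr0.
  - apply: cont_pair.
      apply: cont_pair; last exact: cont_snd.
      exact: cont_comp (@cont_fst _ _ _ _) (@cont_fst _ _ _ _).
    apply: cont_pair; last exact: cont_cst.
    exact: cont_comp (@cont_fst _ _ _ _) (@cont_snd _ _ _ _).
have [gt gtP] := fibrewise_ext_ex je hZ cZ oUX lg (IC_cont hg).
have hgt : IC n ((U `*` setT) `*` setT) gt.
  by apply: (IH _ _ g gt) => // p => [/gtP[]|/gtP[]|v /gtP[]].
have hft : IC n (U `*` setT) ft by apply: (IH _ _ f) => //; exact: IC_pred hf.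
exists (fun p => gt ((p.1.1, p.2.1), p.1.2) + ft (p.1.1, p.2.2)); split; last first.
  apply: IC_add; first exact: open_prod oUFt openT.
    apply: (@IC_prelin _ _ n _ _ _ _ ((U `*` setT) `*` setT)
      (fun p : (X * Ft) * (X * Ft) => ((p.1.1, p.2.1), p.1.2)) gt) => //.
    - exact: open_prod oUFt openT.
    - exact: open_prod oUX openT.
    - apply: cont_pair.
        apply: cont_pair; first exact: cont_comp (@cont_fst _ _ _ _) (@cont_fst _ _ _ _).
        exact: cont_comp (@cont_snd _ _ _ _) (@cont_fst _ _ _ _).
      exact: cont_comp (@cont_fst _ _ _ _) (@cont_snd _ _ _ _).
  apply: (@IC_prelin _ _ n _ _ _ _ (U `*` setT)
    (fun p : (X * Ft) * (X * Ft) => (p.1.1, p.2.2)) ft) => //.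
  - exact: open_prod oUFt openT.
  - by move=> [[x y] [v w]] /= [[Ux _] _]; split.
  - apply: cont_pair; first exact: cont_comp (@cont_fst _ _ _ _) (@cont_fst _ _ _ _).
    exact: cont_comp (@cont_snd _ _ _ _) (@cont_snd _ _ _ _).
move=> [x v] [y w] [/= Ux _]; apply/dirderP => q hq e e0.
have e2 : 0 < e / 2 by rewrite divr_gt0.
have cgt := IC_cont hgt.
have := (csn_contP _ _).1 (cgt ((x, y), v) (conj (conj Ux I) I)) q hq _ e2.
move=> /near_pairP[A [B [nA nB AB]]].
have [A1 [A2 [nA1 nA2 AA]]] := near_pairP nA.
have [d d0 dP] := near_line y (filterI nA1 (open_near oU Ux)).
have := (csn_contP _ _).1 (cft' (x, w) (conj Ux I)) q hq _ e2.
move=> /near_pairP[A3 [B3 [nA3 nB3 AB3]]].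
have [d' d'0 dP'] := near_line y nA3.
exists (Num.min d d'); first by rewrite lt_min d0.
move=> t; rewrite lt_min => /andP[td td'].
have tU : U (x + t *: y) by case: (dP t td).
have -> : (x, v) + t *: (y, w) = (x + t *: y, v + t *: w) :> X * Ft by [].
have -> : ft (x + t *: y, v + t *: w) - ft (x, v) -
    t *: (gt ((x, y), v) + ft (x, w)) =
  (ft (x + t *: y, v) - ft (x, v) - t *: gt ((x, y), v)) +
  t *: (ft (x + t *: y, w) - ft (x, w)).
  by rewrite (linD (lft _ tU)) (linZ (lft _ tU)) /=; lmodule Z.
rewrite (le_trans (csnD hq _ _))// [e]splitr mulrDl lerD//; last first.
  by rewrite csnZ// mulrC ler_wpM2r ?nm_ge0// ltW//; apply: AB3; [exact: dP'|exact: nbhs_singleton].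
(* Differentiability along y is known only at vectors of F. The estimate is proved there, uniformly
   for j v1 in the neighbourhood B of v, and then v1 approaches v while t stays fixed. *)
have main v1 : B (j v1) -> q (ft (x + t *: y, j v1) - ft (x, j v1) - t *: gt ((x, y), v)) <= e / 2 * nm t.
  move=> Bv1; rewrite !ftj//.
  have := @mvt_curve R k Z q (fun z => f (x + z *: y, v1))
    (fun z => g ((x + z *: y, y), v1)) 0 t (gt ((x, y), v)) (e / 2) hq.
  rewrite scale0r addr0 subr0 [_ * nm t]mulrC; apply=> s /andP[s0 s1]; rewrite add0r.
    have := @dirder_hasd R k _ _ f q (x, v1) (y, 0) (rC s * t) (g ((x + (rC s * t) *: y, y), v1)) hq.
    have -> : (fun z : C => f ((x, v1) + z *: (y, 0))) = (fun z => f (x + z *: y, v1)).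
      by apply/funext => z; rewrite fl.
    apply; rewrite fl; apply: gP.
    case: (dP (rC s * t)) => //; rewrite nmM nm_rC ger0_norm// (le_lt_trans _ td)//.
    by rewrite ler_piMl ?nm_ge0.
  have [Ax Ust] : (A1 `&` U) (x + (rC s * t) *: y).
    apply: dP; rewrite nmM nm_rC ger0_norm// (le_lt_trans _ td)//.
    by rewrite ler_piMl ?nm_ge0.
  have [_ _ gtj] := gtP (x + (rC s * t) *: y, y) (conj Ust I).
  rewrite -gtj ltW//; apply: AB => //.
  by apply: AA => //; exact: nbhs_singleton.
apply/ler_addgt0Pr => e' e'0.
have e'2 : 0 < e' / 2 by rewrite divr_gt0.
have n1 := (csn_contP _ _).1 (cft _ tU v) q hq _ e'2.
have n2 := (csn_contP _ _).1 (cft _ Ux v) q hq _ e'2.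
have [v1 [[/= h1 h2] Bv1]] := dense_near dj (filterI (filterI n1 n2) nB).
have -> : ft (x + t *: y, v) - ft (x, v) - t *: gt ((x, y), v) =
 (ft (x + t *: y, j v1) - ft (x, j v1) - t *: gt ((x, y), v)) +
 ((ft (x, j v1) - ft (x, v)) - (ft (x + t *: y, j v1) - ft (x + t *: y, v))) by lmodule Z.
rewrite (le_trans (csnD hq _ _))//.
have b1 := main v1 Bv1.
have b2 := csnB hq (ft (x, j v1) - ft (x, v)) (ft (x + t *: y, j v1) - ft (x + t *: y, v)).
by move: h1 h2 b1 b2; lra.
Qed.

End continuous_extension.

(** * Keller's classes *)

Section keller.
Context {R : realType} {k : scalars}.
Local Notation C := (fld R k).
Implicit Types X H : tvsType C.

Lemma dirders_eq_on X H (U : set X) (f g : X -> H) ys : open U ->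
  (forall x, U x -> f x = g x) -> forall x, U x -> dirders f ys x = dirders g ys x.
Proof.
move=> oU; elim: ys f g => [|y ys IH] f g fg //=.
apply: IH => x Ux; apply: dirder_eq_near.
by near=> z; apply: fg; near: z; exact: open_near.
Unshelve. all: by end_near. Qed.

(** Directions of the form (y, 0) leave the second argument alone. In this way the higher
    derivatives of f become derivatives of its first derivative [df], with the first direction kept
    as an argument. *)
Lemma dirders_fst X H (df : X * X -> H) ys x y1 :
  dirders df [seq (y, 0) | y <- ys] (x, y1) = dirders (fun x => df (x, y1)) ys x.
Proof.
elim: ys df x y1 => [//|y ys IH] df x y1 /=; rewrite IH; congr (dirders _ ys x).
apply/funext => z; rewrite /dirder; congr xget; apply/funext => l.
rewrite /is_dirder; have -> // : (fun t : C => t^-1 *: (df ((z, y1) + t *: (y, 0)) - df (z, y1))) =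
  (fun t : C => t^-1 *: (df (z + t *: y, y1) - df (z, y1))).
apply/funext => t; congr (_ *: (df _ - _)).
by congr (_, _); rewrite /= scaler0 addr0.
Qed.

Definition has_dirders X H (n : nat) (U : set X) (f : X -> H) :=
  forall ys y x, (size ys < n)%N -> U x -> exists l, is_dirder (dirders f ys) y x l.

(* Joint continuity of d^j f, tested on arguments depending continuously on a
   parameter. *)
Definition slot_cont X H (j : nat) (U : set X) (f : X -> H) :=
  forall (T : topologicalType) (p0 : T) (a0 : T -> X) (s : seq (T -> X)),
    size s = j -> U (a0 p0) -> {for p0, continuous a0} ->
    (forall a, List.In a s -> {for p0, continuous a}) ->
    {for p0, continuous (fun p => dirders f [seq a p | a <- s] (a0 p))}.

Lemma IC_dirders n X H (U : set X) (f : X -> H) : hausdorff_space H -> open U ->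
  IC n U f -> has_dirders n U f /\ forall j, (j <= n)%N -> slot_cont j U f.
Proof.
move=> hH; elim: n X U f => [|n IH] X U f oU hf.
  split=> // j; rewrite leqn0 => /eqP-> T p0 a0 [|//] _ U0 c0 _ /=.
  by apply: continuous_comp => //; exact: hf.
have [cf [df [dfP hdf]]] := hf.
have oUT : open (U `*` [set: X]) by exact: open_prod oU openT.
have [hd hs] := IH _ _ _ oUT hdf.
have e1 y1 x : U x -> dirder f y1 x = df (x, y1).
  by move=> Ux; apply: dirderE => //; exact: dfP.
have e2 y1 ys x : U x -> dirders f (y1 :: ys) x = dirders df [seq (y, 0) | y <- ys] (x, y1).
  move=> Ux; rewrite dirders_fst /=; apply: (dirders_eq_on _ oU) => // z Uz.
  exact: e1.
split.
  move=> [|y1 ys] y x; first by move=> _ Ux; exists (df (x, y)); exact: dfP.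
  rewrite /= ltnS => sz Ux.
  have [|l hl] := hd [seq (y, 0) | y <- ys] (y, 0) (x, y1) _ (conj Ux I).
    by rewrite size_map.
  exists l; apply: (@dirder_near _ _ _ _ (fun z => dirders df [seq (y, 0) | y <- ys] (z, y1))).
    by near=> z; rewrite -e2//; near: z; exact: open_near.
  move: hl; rewrite /is_dirder.
  rewrite (_ : (fun t => _) = (fun t : C => t^-1 *: (dirders df [seq (y, 0) | y <- ys] (x + t *: y, y1) -
    dirders df [seq (y, 0) | y <- ys] (x, y1))))//.
  apply/funext => t; congr (_ *: (dirders _ _ _ - _)).
  by congr (_, _); rewrite /= scaler0 addr0.
move=> [|j] jn T p0 a0 [|a1 s] //= sz U0 c0 cs.
  by apply: continuous_comp => //; exact: cf.
have c1 := cs a1 (or_introl erefl).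
have := hs j jn T p0 (fun p => (a0 p, a1 p)) [seq (fun p => (a p, 0)) | a <- s].
rewrite size_map => /(_ _ (conj U0 I) (cont_pair_at c0 c1)); case: sz => sz /(_ sz) h.
apply: (cont_near _ (h _)).
  near=> p; transitivity (dirders f (a1 p :: [seq a p | a <- s]) (a0 p)); last by [].
  by rewrite e2 -?map_comp//; near: p; exact: c0 (open_near oU U0).
move=> a /List.in_map_iff[b [<- bs]]; apply: cont_pair_at; last exact: cont_cst.
by apply: cs; right.
Unshelve. all: by end_near. Qed.

(** * From Keller's condition to iterated C^1 maps *)

Section from_slots.
Context (X H : tvsType C) (n : nat) (U : set X) (f : X -> H).
Hypothesis (hH : hausdorff_space H) (oU : open U).
Hypothesis hd : has_dirders n U f.
Hypothesis hs : forall j, (j <= n)%N -> slot_cont j U f.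

Lemma dirders_lincomb m (a : C) (g1 g2 g3 : X -> H) post :
  (forall x, U x -> g3 x = a *: g1 x + g2 x) -> (size post <= m)%N ->
  has_dirders m U g1 -> has_dirders m U g2 ->
  forall x, U x -> dirders g3 post x = a *: dirders g1 post x + dirders g2 post x.
Proof.
elim: post m g1 g2 g3 => [//|y post IH] m g1 g2 g3 e; case: m => [//|m] /=.
rewrite ltnS => sz h1 h2; apply: (IH m) => //.
- move=> x Ux; apply: dirderE => //.
  have d1 := dirder_ex (h1 [::] y x isT Ux); have d2 := dirder_ex (h2 [::] y x isT Ux).
  apply: dirder_near (dirderD (dirder_scale (a := a) d1) d2).
  by near=> z; rewrite e//; near: z; exact: open_near.
- by move=> ys y' x szy; exact: (h1 (y :: ys)).
- by move=> ys y' x szy; exact: (h2 (y :: ys)).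
Unshelve. all: by end_near. Qed.

Lemma dirders_cat (g : X -> H) s1 s2 : dirders g (s1 ++ s2) = dirders (dirders g s1) s2.
Proof. exact: foldl_cat. Qed.

(** Linearity in this slot is [C1_linear] for the function [dirders f pre]; the derivatives along
    [post] preserve the linear combination. *)
Lemma dirders_linear (a : C) pre y z post x : (size (pre ++ y :: post) <= n)%N -> U x ->
  dirders f (pre ++ (a *: y + z) :: post) x =
  a *: dirders f (pre ++ y :: post) x + dirders f (pre ++ z :: post) x.
Proof.
rewrite size_cat /= addnS => sz Ux.
rewrite !dirders_cat /=; set g := dirders f pre.
have pn : (size pre < n)%N by rewrite (leq_trans _ sz)// ltnS leq_addr.
have hg w : has_dirders (size post) U (dirder g w).
  move=> ys y' x' szy Ux'; have := hd (ys := pre ++ w :: ys) y' (x := x').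
  rewrite dirders_cat; apply=> //; rewrite size_cat /= addnS.
  by rewrite (leq_trans _ sz)// !ltnS ltn_add2l.
apply: (@dirders_lincomb (size post)) => // x' Ux'.
have := @C1_linear _ _ X H U g (fun p => dirder g p.2 p.1) _ oU x' hH Ux' _ a y z.
apply; first by move=> u v Uu; apply: dirder_ex; exact: hd.
move=> w; have := hs pn (p0 := (x', w)) (a0 := fst)
  (s := rcons [seq (fun=> u) | u <- pre] snd).
rewrite size_rcons size_map => /(_ erefl Ux' (@cont_fst _ _ _ _ _)) h.
apply: (cont_near _ (h _)).
  near=> p; rewrite map_rcons -map_comp /= map_id -cats1 dirders_cat //.
move=> b; rewrite -cats1 => /List.in_app_iff[/List.in_map_iff[u [<- _]]|[<-|//]].
  exact: cont_cst.
exact: cont_snd.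
Unshelve. all: by end_near. Qed.

Let lc (T : tvsType C) (a : T -> X) := linear a /\ continuous a.

(** The terms of the product rule: each slot in turn takes its increment a v, while the slots before
    it, collected in [pre], and after it stay at p. *)
Fixpoint Lv (T : tvsType C) (p v : T) (pre : seq X) (s : seq (T -> X)) : seq (seq X) :=
  if s is a :: s' then (pre ++ a v :: [seq b p | b <- s']) :: Lv p v (rcons pre (a p)) s'
  else [::].

(** The slots are released one at a time. By multilinearity, moving the slot a by t v contributes t
    times the value with a v in that place, which is continuous along the line; the remaining
    increment has a p frozen in [pre]. *)
Lemma dirder_slots (T : tvsType C) (a0 : T -> X) (p v : T) pre s :
  lc a0 -> (forall a, List.In a s -> lc a) -> U (a0 p) ->
  (size pre + size s < n)%N ->
  is_dirder (fun p => dirders f (pre ++ [seq a p | a <- s]) (a0 p)) v p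
    (dirders f (rcons (pre ++ [seq a p | a <- s]) (a0 v)) (a0 p) +
     \sum_(l <- Lv p v pre s) dirders f l (a0 p)).
Proof.
move=> [l0 c0]; elim: s pre => [|a s IH] pre hl Up sz.
  rewrite /= big_nil addr0 !cats0 -cats1 dirders_cat /=.
  have := dirder_ex (hd (ys := pre) (a0 v) _ Up); rewrite addn0 in sz => /(_ sz) /dirderP h.
  apply/dirderP => q hq e e0; have [d d0 dP] := h q hq e e0; exists d => // t td.
  by rewrite (linD l0) (linZ l0) dP.
rewrite /= big_cons.
have [la ca] := hl a (or_introl erefl).
have szr : (size (rcons pre (a p)) + size s < n)%N by rewrite size_rcons addSn -addnS.
have /dirderP h0 := IH (rcons pre (a p)) (fun b bs => hl b (or_intror bs)) Up szr.
apply/dirderP => q hq e e0; have e2 : 0 < e / 2 by rewrite divr_gt0.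
have [d d0 dP] := h0 q hq _ e2.
pose G p' := dirders f (pre ++ a v :: [seq b p' | b <- s]) (a0 p').
have cG : {for p, continuous G}.
  have := hs (j := size pre + size (a :: s)) (ltnW sz) (p0 := p) (a0 := a0)
   (s := [seq (fun=> u) | u <- pre] ++ (fun=> a v) :: s).
  rewrite size_cat size_map /= => /(_ erefl Up (c0 p)) h.
  apply: (cont_near _ (h _)); first by near=> p'; rewrite map_cat /= -map_comp map_id.
  move=> b /List.in_app_iff[/List.in_map_iff[u [<- _]]|[<-|bs]]; [exact: cont_cst|exact: cont_cst|].
  by have [_] := hl b (or_intror bs); apply.
have [d' d'0 dP'] := near_line v (filterI ((csn_contP _ _).1 cG q hq _ e2) (c0 p _ (open_near oU Up))).
exists (Num.min d d'); first by rewrite lt_min d0.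
move=> t; rewrite lt_min => /andP[td td'].
have [/= Gt Ut] := dP' t td'.
have eq1 : dirders f (pre ++ a (p + t *: v) :: [seq b (p + t *: v) | b <- s]) (a0 (p + t *: v)) =
   t *: G (p + t *: v) + dirders f (rcons pre (a p) ++ [seq b (p + t *: v) | b <- s]) (a0 (p + t *: v)).
  rewrite (linD la) (linZ la) addrC dirders_linear//; first by rewrite cat_rcons.
  by rewrite size_cat /= size_map ltnW.
have := dP t td; rewrite eq1 !cat_rcons => h1.
set A := dirders f (pre ++ a p :: _) (a0 (p + t *: v)) in h1 *.
set B := dirders f (pre ++ a p :: _) (a0 p) in h1 *.
set D := dirders f (rcons _ _) (a0 p) in h1 *.
set S := \sum_(l <- _) _ in h1 *.
have -> : t *: G (p + t *: v) + A - B - t *: (D + (G p + S)) =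
  (A - B - t *: (D + S)) + t *: (G (p + t *: v) - G p) by lmodule H.
rewrite (le_trans (csnD hq _ _))// [e]splitr mulrDl lerD// csnZ// mulrC.
by rewrite ler_wpM2r ?nm_ge0// ltW.
Unshelve. all: by end_near. Qed.

(** The lists of [Lv] as lists of linear maps of (p, v), so that the derivative has the same shape
    as the map that is differentiated. *)
Fixpoint Ls (T : tvsType C) (pre : seq (T * T -> X)) (s : seq (T -> X)) :
    seq (seq (T * T -> X)) :=
  if s is a :: s' then
    (pre ++ (a \o snd) :: [seq b \o fst | b <- s']) :: Ls (rcons pre (a \o fst)) s'
  else [::].

Lemma LvE (T : tvsType C) (p v : T) pre s :
  Lv p v [seq b (p, v) | b <- pre] s = [seq [seq b (p, v) | b <- l] | l <- Ls pre s].
Proof.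
elim: s pre => [//|a s IH] pre /=; rewrite map_cat /= -map_comp; congr (_ :: _).
by rewrite -IH map_rcons.
Qed.

Lemma LsP (T : tvsType C) (pre : seq (T * T -> X)) (s : seq (T -> X)) l :
  (forall a, List.In a pre -> lc a) -> (forall a, List.In a s -> lc a) ->
  List.In l (Ls pre s) -> size l = (size pre + size s)%N /\ forall a, List.In a l -> lc a.
Proof.
elim: s pre => [//|a s IH] pre hp hl /= [<-|].
  rewrite size_cat /= size_map; split=> // b /List.in_app_iff[/hp//|[<-|/List.in_map_iff[c [<- cs]]]].
    have [la ca] := hl a (or_introl erefl).
    by split; [exact: lin_comp (@lin_snd _ _ T T) la|exact: cont_comp (@cont_snd _ _ T T) ca].
  have [lb cb] := hl c (or_intror cs).
  by split; [exact: lin_comp (@lin_fst _ _ T T) lb|exact: cont_comp (@cont_fst _ _ T T) cb].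
move=> /IH[|b bs|->]; last by rewrite size_rcons addSn addnS.
  move=> b; rewrite -cats1 => /List.in_app_iff[/hp//|[<-|//]].
  have [la ca] := hl a (or_introl erefl).
  by split; [exact: lin_comp (@lin_fst _ _ T T) la|exact: cont_comp (@cont_fst _ _ T T) ca].
by apply: hl; right.
Qed.

(** Derivatives of f evaluated at linear slots are closed under differentiation up to sums. The
    bound on [size s + m] counts the derivatives of f that may still be taken. *)
Lemma IC_slots m (T : tvsType C) (V : set T) (a0 : T -> X) (s : seq (T -> X)) :
  (size s + m <= n)%N -> open V -> (forall p, V p -> U (a0 p)) -> lc a0 ->
  (forall a, List.In a s -> lc a) ->
  IC m V (fun p => dirders f [seq a p | a <- s] (a0 p)).
Proof.
have cont (T' : tvsType C) (V' : set T') b0 l : (size l <= n)%N -> (forall p, V' p -> U (b0 p)) -> lc b0 ->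
    (forall a, List.In a l -> lc a) -> cont_on V' (fun p => dirders f [seq a p | a <- l] (b0 p)).
  move=> sz V'U [_ c0] hl p Vp; apply: (hs sz) => //; first exact: V'U.
    exact: c0.
  by move=> a /hl[_]; apply.
elim: m T V a0 s => [|m IH] T V a0 s sz oV VU lc0 hl.
  by apply: cont => //; rewrite addn0 in sz.
split; first by apply: cont => //; rewrite (leq_trans _ sz)// leq_addr.
have [l0 c0] := lc0.
exists (fun pv => dirders f [seq a pv | a <- rcons [seq a \o fst | a <- s] (a0 \o snd)] (a0 pv.1) +
   \sum_(l <- Ls [::] s) dirders f [seq a pv | a <- l] (a0 pv.1)); split.
  move=> p v Vp; have := @dirder_slots T a0 p v [::] s lc0 hl (VU _ Vp).
  rewrite (_ : [::] = [seq b (p, v) | b <- [::]])// LvE big_map /= map_rcons -map_comp /=; apply.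
  by rewrite (leq_trans _ sz)// addnS ltnS leq_addr.
have oVT : open (V `*` [set: T]) by exact: open_prod oV openT.
have lcf : lc (a0 \o (fst : T * T -> T)).
  by split; [exact: lin_comp (@lin_fst _ _ T T) l0|exact: cont_comp (@cont_fst _ _ T T) c0].
apply: IC_add => //.
  apply: (IH _ _ (a0 \o fst)) => //.
  - by rewrite size_rcons size_map addSn -addnS.
  - by move=> [p v] [/= /VU].
  move=> b; rewrite -cats1 => /List.in_app_iff[/List.in_map_iff[c [<- cs]]|[<-|//]].
    have [lb cb] := hl c cs.
    by split; [exact: lin_comp (@lin_fst _ _ T T) lb|exact: cont_comp (@cont_fst _ _ T T) cb].
  by split; [exact: lin_comp (@lin_snd _ _ T T) l0|exact: cont_comp (@cont_snd _ _ T T) c0].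
apply: IC_sum => // l /LsP[//|//|szl hll].
apply: (IH _ _ (a0 \o fst)) => //; last by move=> [p v] [/= /VU].
by rewrite szl add0n (leq_trans _ sz)// leq_add2l.
Qed.

Lemma IC_of_slots : IC n U f.
Proof.
by have := @IC_slots n X U id [::]; apply=> //; split; [exact: lin_id|exact: cont_id].
Qed.

End from_slots.

Lemma cont_into_prod (I : Type) (T X' : topologicalType) (F : T -> prod_topology (fun _ : I => X')) p :
  (forall i, {for p, continuous (fun x => F x i)}) -> {for p, continuous F}.
Proof.
move=> h; apply/cvg_sup => i A [B [[V oV <-] VF] BA].
apply: filterS BA _; apply: (h i V); exact: (open_near oV VF).
Qed.

Lemma Keller_CrP r X H (U : set X) (f : X -> H) : hausdorff_space H ->
  Keller_Cr r U f <-> open U /\ forall n, (if r is Fin m then (n <= m)%N else true) -> IC n U f.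
Proof.
move=> hH; split.
  move=> [oU cf h]; split=> // n nr.
  have le j : (j < n)%N -> le_smooth (Fin j.+1) r.
    by move=> jn; case: r nr {h} => //= m nm; exact: leq_trans jn nm.
  apply: IC_of_slots => //.
    by move=> ys y x sz Ux; have [h1 _] := h _ (le _ sz); exact: h1.
  move=> [|j] jn T p0 a0 s sz U0 c0 cs.
    case: s sz cs => // _ _; apply: continuous_comp => //.
    by move/(within_contP _ oU): cf; apply.
  have [_ hc] := h _ (le _ jn).
  have oUT : open (U `*` [set: prod_topology (fun _ : 'I_j.+1 => X)]) by exact: open_prod oU openT.
  move/(within_contP _ oUT): hc => hc.
  (* The separate slots are assembled into one point of the product on which [djmap] is
     continuous. *)
  pose F p : X * prod_topology (fun _ : 'I_j.+1 => X) :=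
    (a0 p, fun i : 'I_j.+1 => nth (fun=> 0) s i p).
  have cF : {for p0, continuous F}.
    apply: cont_pair_at => //; apply: cont_into_prod => i.
    apply: cs; have : (i < size s)%N by rewrite sz.
    elim: s (i : nat) {sz F} => [//|a s IH] [|m] //=; first by left.
    by rewrite ltnS => /IH; right.
  have := continuous_comp cF (hc (F p0) (conj U0 I)).
  apply: cont_near; near=> p; rewrite /= /djmap /=; congr (dirders f _ _).
  rewrite (map_comp (fun m => nth (fun=> 0) s m p) val) val_enum_ord -sz.
  by rewrite -[in RHS](mkseq_nth (fun=> 0) s) -map_comp.
move=> [oU h]; split=> //.
  by apply/within_contP => //; apply: (IC_cont (n := 0)); apply: h; case: r.
move=> j jr; have hj : IC j.+1 U f by apply: h; case: r jr.
have [hd hs] := IC_dirders hH oU hj; split.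
  by move=> ys y x sz Ux; apply: hd => //; rewrite sz.
apply/within_contP; first exact: open_prod oU openT.
move=> [x Y] [/= Ux _].
have := hs _ (leqnn _) (X * prod_topology (fun _ : 'I_j.+1 => X))%type (x, Y) fst
  [seq (fun p => p.2 i) | i <- enum 'I_j.+1].
rewrite size_map size_enum_ord => /(_ erefl Ux (@cvg_fst _ _ _ _ _)) hc.
apply: (cont_near _ (hc _)); first by near=> p; rewrite -map_comp.
move=> a /List.in_map_iff[i [<- _]].
apply: (@continuous_comp _ _ _ snd (fun g : prod_topology (fun _ : 'I_j.+1 => X) => g i)).
  exact: cvg_snd.
exact: proj_continuous.
Unshelve. all: by end_near. Qed.

End keller.

(** * Averages over roots of unity and Cauchy's formula *)

Section roots_of_unity.
Context {R : realType}.
Local Notation C := (fld R ComplexScalars).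

Definition cis (x : R) : C := (cos x +i* sin x)%C.

Lemma cisD x y : cis (x + y) = cis x * cis y.
Proof.
by rewrite /cis cosD sinD [sin x * _ + _]addrC.
Qed.

Lemma cis0 : cis 0 = 1. Proof. by rewrite /cis cos0 sin0. Qed.

Lemma cisMn x n : cis (x *+ n) = cis x ^+ n.
Proof. by elim: n => [|n IH]; rewrite ?cis0 // mulrS cisD IH exprS. Qed.

Lemma nm_cis x : nm (cis x) = 1.
Proof. by rewrite /nm /= cos2Dsin2 sqrtr1. Qed.

Lemma nm_le (a b : R) : nm ((a +i* b)%C : C) <= `|a| + `|b|.
Proof.
have -> : (a +i* b)%C = (a%:C)%C + 'i%C * (b%:C)%C by simpc.
rewrite (le_trans (nmD _ _))// nmM (nm_rC a) (nm_rC b).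
by rewrite [nm _ in X in _ + X](_ : _ = 1) ?mul1r// /nm /= expr0n expr1n add0r sqrtr1.
Qed.

Lemma nm_le_ReIm (z : C) : nm z <= `|complex.Re z| + `|complex.Im z|.
Proof. by case: z => a b; exact: nm_le. Qed.

Lemma cis_neq1 x : 0 < x -> x < pi *+ 2 -> cis x != 1.
Proof.
move=> x0 x1; apply/eqP => /(congr1 (@complex.Re R)) /= h.
have : sin (x / 2) > 0.
  by rewrite sin_gt0_pi// divr_gt0//= ltr_pdivrMr// mulr_natr.
have := cos_mulr2n (x / 2); rewrite -[x / 2 *+ 2]mulr_natr divfK// h.
have := cos2Dsin2 (x / 2); nra.
Qed.

Definition root1 (N : nat) : C := cis (pi *+ 2 / N%:R).

Lemma nm_root1 N : nm (root1 N) = 1. Proof. exact: nm_cis. Qed.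

Lemma root1_neq0 N : root1 N != 0.
Proof. by rewrite -nm_gt0 nm_root1. Qed.

Lemma root1X N : (0 < N)%N -> root1 N ^+ N = 1.
Proof.
move=> N0; rewrite -cisMn -[_ *+ N]mulr_natr divfK ?pnatr_eq0 -?lt0n//.
by rewrite /cis -(add0r (pi *+ 2)) cosD2pi sinD2pi cos0 sin0.
Qed.

Lemma root1_neq1 N k : (0 < k < N)%N -> root1 N ^+ k != 1.
Proof.
move=> /andP[k0 kN]; have N0 : 0 < N%:R :> R by rewrite ltr0n (leq_trans _ kN).
rewrite -cisMn; apply: cis_neq1.
  by rewrite pmulrn_lgt0// divr_gt0// pmulrn_lgt0// pi_gt0.
rewrite -[_ *+ k]mulr_natr mulrAC ltr_pdivrMr// ltr_pM2l ?ltr_nat//.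
by rewrite pmulrn_lgt0// pi_gt0.
Qed.

Lemma root1_cvg e : 0 < e -> exists N0, forall N, (N0 <= N)%N -> nm (root1 N - 1) < e.
Proof.
move=> e0; have e2 : 0 < e / 2 by rewrite divr_gt0.
have c : \forall x \near (0 : R), `|cos x - 1| < e / 2 /\ `|sin x| < e / 2.
  have h1 := @continuous_cos R 0; have h2 := @continuous_sin R 0.
  move: h1 h2; rewrite /continuous_at cos0 sin0.
  move=> /cvgrPdist_lt/(_ _ e2) h1 /cvgrPdist_lt/(_ _ e2) h2.
  near=> x; split; first by rewrite distrC; near: x.
  by rewrite -normrN -sub0r; near: x.
have /nbhs_ballP[d /= d0 dP] := c.
have pi2 : 0 < pi *+ 2 :> R by rewrite pmulrn_lgt0// pi_gt0.
exists (Num.trunc (pi *+ 2 / d)).+1 => N hN.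
have h : pi *+ 2 / d < N%:R.
  by rewrite (lt_le_trans (truncnS_gt _))// ler_nat.
have N0 : 0 < N%:R :> R by rewrite (le_lt_trans _ h)// divr_ge0// ltW.
have [|h1 h2] := dP (pi *+ 2 / N%:R).
  rewrite -ball_normE /ball_/= sub0r normrN gtr0_norm ?divr_gt0//.
  by rewrite ltr_pdivrMr// mulrC -ltr_pdivrMr.
by rewrite (le_lt_trans (nm_le_ReIm _))//= oppr0 addr0 [e]splitr ltrD.
Unshelve. all: by end_near. Qed.

Lemma root1_sum N k : (0 < k < N)%N -> \sum_(j < N) (root1 N ^+ j) ^+ k = 0.
Proof.
move=> kN; have N0 : (0 < N)%N by case/andP: kN => k0; apply: leq_trans.
have w1 := root1_neq1 kN.
apply: (mulfI (x := root1 N ^+ k - 1)); first by rewrite subr_eq0.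
rewrite mulr0; under eq_bigr do rewrite exprAC.
by rewrite -subrX1 exprAC root1X// expr1n subrr.
Qed.

Lemma root1_sumV N k : (0 < k < N)%N -> \sum_(j < N) (root1 N ^+ j) ^- k = 0.
Proof.
move=> kN; have N0 : (0 < N)%N by case/andP: kN => k0; apply: leq_trans.
have kN' : (0 < N - k < N)%N.
  by case/andP: kN => k0 kN; rewrite subn_gt0 kN ltn_subrL k0.
rewrite -[RHS](root1_sum kN'); apply: eq_bigr => j _.
have wj : root1 N ^+ j != 0 by rewrite expf_neq0// root1_neq0.
have e : (root1 N ^+ j) ^+ k * (root1 N ^+ j) ^+ (N - k) = 1.
  rewrite -exprD subnKC; last by case/andP: kN => _ /ltnW.
  by rewrite exprAC root1X// expr1n.
apply: (mulfI (x := (root1 N ^+ j) ^+ k)); first by rewrite expf_neq0.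
by apply: etrans (esym e); rewrite mulfV// expf_neq0.
Qed.

(** Orthogonality of the characters of the group of N-th roots of unity; this is how an average
    extracts a coefficient. *)
Lemma root1_sum_shift N n k : (n < N)%N -> (k < N)%N ->
  \sum_(j < N) (root1 N ^+ j) ^- n * (root1 N ^+ j) ^+ k = if k == n then N%:R else 0.
Proof.
move=> nN kN.
have wj (j : 'I_N) : root1 N ^+ j != 0 by rewrite expf_neq0// root1_neq0.
have [->|kn] := eqVneq k n.
  rewrite (eq_bigr (fun=> 1)); first by rewrite sumr_const card_ord.
  by move=> j _; rewrite mulVf// expf_neq0.
have [lt|gt] := ltnP n k.
  rewrite /= -[RHS](@root1_sum N (k - n)); last by rewrite subn_gt0 lt (leq_ltn_trans (leq_subr _ _) kN).
  by apply: eq_bigr => j _; rewrite -{1}(subnKC (ltnW lt)) exprD mulKf// expf_neq0.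
rewrite /= -[RHS](@root1_sumV N (n - k)); last first.
  by rewrite subn_gt0 ltn_neqAle kn gt (leq_ltn_trans (leq_subr _ _) nN).
apply: eq_bigr => j _; rewrite -{1}(subnK gt) exprD invfM -mulrA mulVf ?mulr1//.
by rewrite expf_neq0.
Qed.

End roots_of_unity.

(** * Compactness of the closed unit disc *)

Section disc.
Context {R : realType}.
Local Notation C := (fld R ComplexScalars).

Definition disc : set C^o := [set z | nm z <= 1].

Lemma disc_compact : compact disc.
Proof.
pose c (p : R * R) : C^o := (p.1 +i* p.2)%C.
have cc : continuous c.
  move=> [a b] O /nbhs_nm[e e0 eO].
  have e2 : 0 < e / 2 by rewrite divr_gt0.
  exists (ball a (e / 2), ball b (e / 2)); first by split; exact: nbhsx_ballx.
  move=> [a' b'] [/= ha hb]; apply: eO.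
  rewrite (le_lt_trans (nm_le_ReIm _))//= [e]splitr ltrD//.
    by move: ha; rewrite -ball_normE /ball_/= distrC.
  by move: hb; rewrite -ball_normE /ball_/= distrC.
have K := continuous_compact (continuous_subspaceT cc)
  (compact_setX (@segment_compact R (-1) 1) (@segment_compact R (-1) 1)).
apply: subclosed_compact K _.
  rewrite -openC; apply/open_nearP => z /= /negP; rewrite -ltNge => z1.
  have d0 : 0 < nm z - 1 by rewrite subr_gt0.
  apply: (nbhs_nm z _).2; exists (nm z - 1) => // t h /=; apply/negP; rewrite -ltNge.
  have := nmD (z - t) t; rewrite subrK -nmN opprB in h *.
  by move: h; rewrite -(nmN (z - t)) opprB; lra.
move=> [a b] /= h; exists (a, b) => //=; rewrite !in_itv /= -!ler_norml.
have h1 : a ^+ 2 + b ^+ 2 <= 1.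
  move: h; rewrite /disc /nm /=.
  by rewrite -{1}sqrtr1 ler_sqrt.
by split; rewrite -(@ler_pXn2r _ 2)// ?nnegrE// expr1n real_normK ?num_real//;
  apply: le_trans h1; rewrite ?lerDl ?lerDr sqr_ge0.
Qed.

(** Heine's theorem for one seminorm. The covering property is applied to the filter of small
    positive radii, in place of a Lebesgue number. *)
Lemma disc_unif (V : tvsType C) (q : V -> R) (g : C -> V) : csn q ->
  (forall z, disc z -> forall e, 0 < e -> exists2 d : R, 0 < d & forall z', disc z' ->
     nm (z' - z) < d -> q (g z' - g z) <= e) ->
  forall e, 0 < e -> exists2 d : R, 0 < d & forall z z', disc z -> disc z' ->
    nm (z' - z) < d -> q (g z' - g z) <= e.
Proof.
move=> hq cg e e0; have e2 : 0 < e / 2 by rewrite divr_gt0.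
pose P (d : R) (z : C^o) := disc z -> forall z', disc z' -> nm (z' - z) < d -> q (g z' - g z) <= e.
have := (compact_near_coveringP disc).1 disc_compact R (0^'+)%classic P _.
case.
  move=> z Dz; have [d d0 dP] := cg z Dz _ e2.
  have d2 : 0 < d / 2 by rewrite divr_gt0.
  exists ([set z' | nm (z' - z) < d / 2], [set r | r < d / 2]) => /=.
    split; first by apply: (nbhs_nm z _).2; exists (d / 2).
    exact: nbhs_right_lt.
  move=> [z1 r] [/= h1 h2] Dz1 z' Dz' h3.
  rewrite (le_trans (csn_trans hq (g z) _ _))// [e]splitr lerD//.
    apply: dP => //; have := nmD (z' - z1) (z1 - z); rewrite addrA subrK; lra.
  by rewrite csn_sym// dP//; lra.
move=> d /= d0 h; exists (d / 2); first by rewrite divr_gt0.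
move=> z z' Dz Dz'; apply: (h (d / 2)) => //.
- by rewrite /ball_ /= sub0r normrN gtr0_norm ?divr_gt0// ltr_pdivrMr// mulr_natr mulr2n ltrDl.
- by rewrite divr_gt0.
Qed.

Lemma compact_bounded (T : topologicalType) (K : set T) (V : tvsType C) (q : V -> R) (g : T -> V) :
  csn q -> compact K -> (forall z, K z -> {for z, continuous g}) ->
  exists M, 0 <= M /\ forall z, K z -> q (g z) <= M.
Proof.
move=> hq cK cg.
have := (compact_near_coveringP K).1 cK R (+oo)%R (fun M z => q (g z) <= M) _.
case.
  move=> z Kz; have n1 := (csn_contP g z).1 (cg z Kz) q hq 1 ltr01.
  exists ([set z' | q (g z' - g z) < 1], [set M | q (g z) + 1 <= M]) => /=.
    by split=> //; apply: nbhs_pinfty_ge; rewrite num_real.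
  move=> [z1 M] [/= h1 h2]; have := csnD hq (g z1 - g z) (g z); rewrite subrK; lra.
move=> M [Mr h]; exists (Num.max 0 (M + 1)); split; first by rewrite le_max lexx.
move=> z Kz; rewrite le_max; apply/orP; right; apply: h => //; lra.
Qed.

End disc.

(** * Differentiation of curves for one seminorm *)

Section curves.
Context {R : realType} {k : scalars}.
Local Notation C := (fld R k).
Context (V : tvsType C) (q : V -> R) (hq : csn q).

Lemma hasd_cst (c : V) z : hasd q (fun=> c) z 0.
Proof.
move=> e e0; exists 1 => // t _; rewrite subrr scaler0 subr0 csn0//.
by rewrite mulr_ge0 ?nm_ge0 ?ltW.
Qed.

Lemma hasdD (f g : C -> V) z l l' : hasd q f z l -> hasd q g z l' ->
  hasd q (fun z => f z + g z) z (l + l').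
Proof.
move=> h h' e e0; have e2 : 0 < e / 2 by rewrite divr_gt0.
have [d d0 dP] := h _ e2; have [d' d'0 dP'] := h' _ e2.
exists (Num.min d d'); first by rewrite lt_min d0.
move=> t; rewrite lt_min => /andP[td td'].
have -> : f (z + t) + g (z + t) - (f z + g z) - t *: (l + l') =
  (f (z + t) - f z - t *: l) + (g (z + t) - g z - t *: l') by lmodule V.
rewrite (le_trans (csnD hq _ _))// (le_trans (lerD (dP _ td) (dP' _ td')))//.
by rewrite -mulrDl -splitr.
Qed.

Lemma hasdZ (a : C) (f : C -> V) z l : hasd q f z l ->
  hasd q (fun z => a *: f z) z (a *: l).
Proof.
move=> h e e0; have a1 : 0 < nm a + 1 by rewrite ltr_wpDl ?nm_ge0.
have [d d0 dP] := h _ (divr_gt0 e0 a1); exists d => // t td.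
have -> : a *: f (z + t) - a *: f z - t *: (a *: l) =
  a *: (f (z + t) - f z - t *: l) by lmodule V.
rewrite csnZ// (le_trans (ler_wpM2l (nm_ge0 _) (dP _ td)))// mulrCA.
by rewrite ler_div1D ?nm_ge0 ?ltW.
Qed.

Lemma hasd_sum (I : Type) (s : seq I) (f : I -> C -> V) z (l : I -> V) :
  (forall i, hasd q (f i) z (l i)) ->
  hasd q (fun z => \sum_(i <- s) f i z) z (\sum_(i <- s) l i).
Proof.
move=> h; elim: s => [|i s IH].
  rewrite big_nil (_ : (fun z => _) = fun=> 0); first exact: hasd_cst.
  by apply/funext => y; rewrite big_nil.
rewrite big_cons (_ : (fun z => _) = fun z => f i z + \sum_(i <- s) f i z).
  exact: hasdD.
by apply/funext => y; rewrite big_cons.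
Qed.

Lemma hasd_affine (g : C -> V) (w c z : C) l : hasd q g (w + z * c) l ->
  hasd q (fun z => g (w + z * c)) z (c *: l).
Proof.
move=> h e e0; have c1 : 0 < nm c + 1 by rewrite ltr_wpDl ?nm_ge0.
have [d d0 dP] := h _ (divr_gt0 e0 c1); exists (d / (nm c + 1)); first exact: divr_gt0.
move=> t td; have tc : nm (t * c) < d.
  rewrite nmM (le_lt_trans _ (_ : nm t * (nm c + 1) < d))//; last by rewrite -ltr_pdivlMr.
  by rewrite ler_wpM2l ?nm_ge0// lerDl.
have := dP _ tc; have -> : w + z * c + t * c = w + (z + t) * c by ring.
rewrite scalerA => /le_trans; apply.
by rewrite nmM [nm t * _]mulrC ler_div1D ?nm_ge0 ?ltW.
Qed.

End curves.

(** * Discrete Cauchy formula and Taylor expansion on the disc *)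

Section cauchy.
Context {R : realType}.
Local Notation C := (fld R ComplexScalars).

Section formula.
Context (V : tvsType C) (q : V -> R) (g g' : C -> V) (a : nat -> V).
Hypothesis hq : csn q.
Hypothesis gd : forall z, disc z -> hasd q g z (g' z).
Hypothesis g'c : forall z, disc z -> forall e, 0 < e -> exists2 d : R, 0 < d &
  forall z', disc z' -> nm (z' - z) < d -> q (g' z' - g' z) <= e.

Let wj N j : C := root1 N ^+ j.

Lemma nm_wj N j : nm (wj N j) = 1. Proof. by rewrite nmX nm_root1 expr1n. Qed.
Lemma wj_neq0 N j : wj N j != 0. Proof. by rewrite -nm_gt0 nm_wj. Qed.

(** A Riemann sum over the N-th roots of unity for Cauchy's integral of the n-th Taylor
    coefficient. *)
Definition cauchy_coef (N n : nat) : V :=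
  (N%:R : C)^-1 *: \sum_(j < N) (wj N j ^- n) *: g (wj N j).

Let bnd : exists M, 0 <= M /\ forall z, disc z -> q (g' z) <= M.
Proof.
have := (compact_near_coveringP disc).1 (@disc_compact R) R (+oo)%R
  (fun M z => disc z -> q (g' z) <= M) _.
case.
  move=> z Kz; have [d d0 dP] := g'c Kz ltr01.
  exists ([set z' | nm (z' - z) < d], [set M | q (g' z) + 1 <= M]) => /=.
    split; first by apply: (nbhs_nm z _).2; exists d.
    by apply: nbhs_pinfty_ge; rewrite num_real.
  move=> [z1 M] [/= h1 h2] D1.
  have := csnD hq (g' z1 - g' z) (g' z); rewrite subrK; have := dP _ D1 h1; lra.
move=> M [Mr h]; exists (Num.max 0 (M + 1)); split; first by rewrite le_max lexx.
by move=> z Kz; rewrite le_max; apply/orP; right; apply: h => //; rewrite ltrDl.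
Qed.

Let disc_conv (w z : C) (s : R) : disc w -> disc z -> 0 <= s <= 1 ->
  disc (w + rC s * (z - w)).
Proof.
move=> Dw Dz /andP[s0 s1]; rewrite /disc /=.
have -> : w + rC s * (z - w) = rC (1 - s) * w + rC s * z by rewrite rCB rC1; ring.
rewrite (le_trans (nmD _ _))// !nmM !nm_rC !ger0_norm ?subr_ge0//.
have := ler_wpM2l s0 Dz; have := ler_wpM2l (_ : 0 <= 1 - s) Dw.
by rewrite subr_ge0 => /(_ s1); lra.
Qed.

(* Cauchy's formula with the circle replaced by the N-th roots of unity: the
   average of g(w + t(zeta - w)) weighted by the truncated kernel
   sum_(k < n) (w / zeta)^k has t-derivative
   avg (zeta - w^n zeta^(1-n)) g'(w + t(zeta - w)); the first part telescopes up
   to the modulus of continuity of g', the second is O(|w|^n). *)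
Lemma cauchy_discrete : exists M, 0 <= M /\ forall e, 0 < e -> exists N0, forall N w n,
  (N0 <= N)%N -> disc w -> (0 < n <= N)%N ->
  q (\sum_(k < n) w ^+ k *: cauchy_coef N k - g w) <= e + nm w ^+ n * M.
Proof.
have [M [M0 hM]] := bnd; exists M; split => // e e0.
have [d d0 dP] := disc_unif hq g'c e0.
have [N1 N1P] := root1_cvg d0.
(* Beyond [N1], neighbouring roots of unity are closer than the modulus d of uniform continuity of
   g'; from 2 on, the roots sum to 0. *)
exists (maxn N1 2) => N w n; rewrite geq_max => /andP[N1N N2] Dw /andP[n0 nN].
have N0 : (0 < N)%N by rewrite (leq_trans _ N2).
have Nn0 : (N%:R : C) != 0 by rewrite pnatr_eq0 -lt0n.
have NR0 : 0 < N%:R :> R by rewrite ltr0n.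
have Dj j : disc (wj N j) by rewrite /disc /= nm_wj.
pose c j : C := \sum_(i < n) (w / wj N j) ^+ i.
pose G z := (N%:R : C)^-1 *: \sum_(j < N) c j *: g (w + z * (wj N j - w)).
pose G' z := (N%:R : C)^-1 *: \sum_(j < N) c j *: ((wj N j - w) *: g' (w + z * (wj N j - w))).
(* At z = 0 all nodes collapse to w, and of the kernel only the power 0 has a nonzero average,
   because n <= N. *)
have G0 : G 0 = g w.
  rewrite /G; under eq_bigr do rewrite mul0r addr0.
  rewrite -scaler_suml scalerA /c exchange_big /=.
  rewrite -[RHS]scale1r; congr (_ *: _).
  case: n n0 nN @c @G @G' => [//|n] _ nN c G G'.
  rewrite big_ord_recl /= [X in _ + X]big1 ?addr0.
    by rewrite (eq_bigr (fun=> 1)) ?sumr_const ?card_ord ?mulVf// => j _; rewrite expr0.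
  move=> i _; transitivity (w ^+ i.+1 * \sum_(j < N) (wj N j) ^- i.+1).
    by rewrite mulr_sumr; apply: eq_bigr => j _; rewrite exprMn exprVn.
  rewrite root1_sumV ?mulr0//=; apply: leq_trans nN; rewrite ltnS; exact: ltn_ord.
have G1 : G 1 = \sum_(i < n) w ^+ i *: cauchy_coef N i.
  rewrite /G /cauchy_coef.
  transitivity ((N%:R : C)^-1 *: \sum_(j < N) \sum_(i < n) (w ^+ i * wj N j ^- i) *: g (wj N j)).
    congr (_ *: _); apply: eq_bigr => j _; rewrite mul1r addrC subrK scaler_suml.
    by apply: eq_bigr => i _; rewrite exprMn exprVn.
  rewrite exchange_big /= scaler_sumr; apply: eq_bigr => i _.
  rewrite [RHS]scalerA [w ^+ i * _]mulrC -[RHS]scalerA; congr (_ *: _).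
  by rewrite scaler_sumr; apply: eq_bigr => j _; rewrite scalerA.
have key s : 0 <= s <= 1 -> q (G' (rC s)) <= e + nm w ^+ n * M.
  move=> s01; pose u j := w + rC s * (wj N j - w).
  have Du j : disc (u j) by exact: disc_conv.
  have ckE j : c j * (wj N j - w) = wj N j - w ^+ n * (wj N j * wj N j ^- n).
    have -> : wj N j - w = wj N j * (1 - w / wj N j).
      by rewrite mulrBr mulr1 mulrCA mulfV ?wj_neq0// mulr1.
    rewrite /c mulrC -mulrA -[1 - _]opprB mulNr -subrX1 opprB mulrBr mulr1.
    by rewrite exprMn exprVn mulrCA.
  have -> : G' (rC s) = (N%:R : C)^-1 *: \sum_(j < N) wj N j *: g' (u j) -
     w ^+ n *: ((N%:R : C)^-1 *: \sum_(j < N) (wj N j * wj N j ^- n) *: g' (u j)).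
    rewrite scalerA mulrC -scalerA -scalerBr; congr (_ *: _).
    rewrite scaler_sumr -sumrB; apply: eq_bigr => j _.
    by rewrite scalerA ckE scalerBl scalerA.
  have avg (f : 'I_N -> V) B : (forall j, q (f j) <= B) ->
      q ((N%:R : C)^-1 *: \sum_(j < N) f j) <= B.
    move=> fB; rewrite csnZ// nmV -(rC_nat N) nm_rC gtr0_norm// ler_pdivrMl//.
    rewrite (le_trans (csn_sum hq _ _ _))// (le_trans (ler_sum _ (fun j _ => fB j)))//.
    by rewrite sumr_const card_ord mulr_natl.
  rewrite (le_trans (csnB hq _ _))// lerD//; last first.
    rewrite csnZ// nmX ler_wpM2l ?exprn_ge0 ?nm_ge0// avg// => j.
    by rewrite csnZ// nmM nmV nmX !nm_wj expr1n invr1 !mul1r hM.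
  (* For s = 0 the nodes coincide and the telescoping below would divide by 0; the vanishing sum of
     the roots replaces it. *)
  have [s0|s0] := eqVneq s 0.
    have -> : \sum_(j < N) wj N j *: g' (u j) = 0.
      rewrite (eq_bigr (fun j : 'I_N => wj N j *: g' w)); last first.
        by move=> j _; rewrite /u s0 rC0 mul0r addr0.
      rewrite -scaler_suml (_ : \sum_(j < N) wj N j = 0) ?scale0r//.
      have := @root1_sum R N 1; rewrite N2 => /(_ isT) h; rewrite -[RHS]h.
      by apply: eq_bigr => j _; rewrite expr1.
    by rewrite scaler0 csn0// ltW.
  have s0' : 0 < s by rewrite lt_def s0; case/andP: s01.
  have om0 : root1 N - 1 != 0 :> C.
    have := @root1_neq1 R N 1; rewrite N2 expr1 => /(_ isT).
    by rewrite -subr_eq0.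
  (* Since u (j+1) - u j = cc zeta_j, the sum is 1 / cc times a Riemann sum of g' around a closed
     polygon, where the increments of g cancel. *)
  pose cc := rC s * (root1 N - 1) : C.
  have cc0 : 0 < nm cc by rewrite nm_gt0 mulf_neq0// rC_eq0.
  have tel : \sum_(j < N) (g (u j.+1) - g (u j)) = 0.
    rewrite -(big_mkord xpredT (fun j => g (u j.+1) - g (u j))) telescope_sumr//.
    by rewrite /u /wj root1X// expr0 subrr.
  have eu j : u j.+1 - u j = cc * wj N j by rewrite /u /cc /wj exprS; ring.
  rewrite -(ler_pM2l cc0) -csnZ// scalerA mulrC -scalerA scaler_sumr.
  have -> : \sum_(j < N) cc *: (wj N j *: g' (u j)) =
     - \sum_(j < N) (g (u j.+1) - g (u j) - (u j.+1 - u j) *: g' (u j)).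
    rewrite [X in _ = - X]sumrB tel sub0r opprK.
    by apply: eq_bigr => j _; rewrite eu scalerA.
  rewrite scalerN csnN//; apply: avg => j.
  have := @mvt_curve R _ V q g g' (u j) (u j.+1) (g' (u j)) e hq.
  rewrite eu nmM nm_wj mulr1; apply=> r r01.
    by apply: gd; rewrite -eu; exact: disc_conv.
  rewrite dP//; first by rewrite -eu; exact: disc_conv.
  rewrite addrC addKr nmM nmM nm_wj mulr1 nm_rC.
  case/andP: r01 => r0 r1; rewrite ger0_norm// (le_lt_trans _ (N1P _ N1N))//.
  rewrite nmM nm_rC mulrA ler_piMl ?nm_ge0//.
  by rewrite mulr_ile1// ger0_norm ?(ltW s0')//; case/andP: s01.
have := @mvt_curve R _ V q G G' 0 1 0 (e + nm w ^+ n * M) hq.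
rewrite G0 G1 subr0 scaler0 subr0 nm1 mul1r; apply=> s s01; rewrite add0r mulr1.
  apply: hasdZ => //; apply: hasd_sum => // j; apply: hasdZ => //.
  apply: hasd_affine => //; apply: gd.
  by apply: disc_conv.
by rewrite subr0; apply: key.
Qed.

Hypothesis peano : forall m e, 0 < e -> exists2 d : R, 0 < d &
  forall w, nm w < d -> q (g w - \sum_(i < m.+1) w ^+ i *: a i) <= e * nm w ^+ m.

(** At a small w = r, the discrete formula and the Peano expansion both approximate g w. Once the
    coefficients below n agree in the limit, the difference of the n-th ones is what remains after
    division by r^n. *)
Lemma cauchy_coef_cvg n e : 0 < e -> exists N0, forall N, (N0 <= N)%N ->
  q (cauchy_coef N n - a n) <= e.
Proof.
have [M [M0 hM]] := cauchy_discrete.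
elim/ltn_ind: n e => n IH e e0.
have e4 : 0 < e / 4 by rewrite divr_gt0.
have [d d0 dP] := peano n e4.
have M1 : 0 < M + 1 by rewrite ltr_wpDl.
(* Each of four errors is at most e / 4 times r^n: the discretization, the remainder r^(n+1) M, the
   Peano remainder (r < d) and the lower coefficients (r <= 1). *)
pose r := Num.min (Num.min (d / 2) 1) (e / 4 / (M + 1)).
have r0 : 0 < r by rewrite !lt_min ltr01 (divr_gt0 d0)// divr_gt0.
have rd : r < d.
  by rewrite /r !gt_min ltr_pdivrMr// mulr_natr mulr2n ltrDl d0.
have r1 : r <= 1 by rewrite /r !ge_min lexx orbT.
have rM : r * M <= e / 4.
  rewrite (le_trans (_ : _ <= e / 4 / (M + 1) * (M + 1)))//; last by rewrite divfK ?gt_eqF.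
  by rewrite ler_pM ?(ltW r0)//; [rewrite /r ge_min lexx orbT|rewrite lerDl].
pose w : C := rC r; have nw : nm w = r by rewrite nm_rC gtr0_norm.
have rn0 : 0 < r ^+ n by rewrite exprn_gt0.
have [N1 h1] := hM (e / 4 * r ^+ n) (mulr_gt0 e4 rn0).
have n1 : 0 < (n.+1)%:R :> R by rewrite ltr0n.
have e5 : 0 < e / 4 * r ^+ n / n.+1%:R by rewrite divr_gt0// mulr_gt0.
have [N2 h2] : exists N2, forall i, (i < n)%N -> forall N, (N2 <= N)%N ->
    q (cauchy_coef N i - a i) <= e / 4 * r ^+ n / n.+1%:R.
  have /choice[f fP] : forall i : 'I_n, exists N2, forall N, (N2 <= N)%N ->
      q (cauchy_coef N i - a i) <= e / 4 * r ^+ n / n.+1%:R.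
    by move=> i; apply: IH.
  exists (\max_i f i) => i lin N hN; apply: (fP (Ordinal lin)).
  by apply: leq_trans hN; apply: (leq_bigmax (Ordinal lin)).
exists (maxn (maxn N1 N2) n.+1) => N; rewrite !geq_max => /andP[/andP[N1N N2N] nN].
have A1 := h1 N w n.+1 N1N _ _; rewrite nw /disc /= nw in A1.
have {}A1 := A1 r1 nN.
have A2 := dP w _; rewrite nw in A2; have {}A2 := A2 rd.
have S2 : q (\sum_(i < n) w ^+ i *: (cauchy_coef N i - a i)) <= e / 4 * r ^+ n.
  rewrite (le_trans (csn_sum hq _ _ _))//.
  apply: (@le_trans _ _ (\sum_(i < n) (e / 4 * r ^+ n / n.+1%:R))).
    apply: ler_sum => i _; rewrite csnZ// nmX nw -[leRHS]mul1r.
    by rewrite ler_pM ?exprn_ge0 ?csn_ge0 ?(ltW r0)// ?h2// exprn_ile1// ltW.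
  rewrite sumr_const card_ord -[_ *+ n]mulr_natr mulrAC ler_pdivrMr//.
  by apply: ler_wpM2l; [rewrite ltW ?mulr_gt0|rewrite ler_nat].
rewrite -(ler_pM2l rn0) -nw -nmX -csnZ//.
have -> : w ^+ n *: (cauchy_coef N n - a n) =
  (\sum_(i < n.+1) w ^+ i *: cauchy_coef N i - g w) +
  (g w - \sum_(i < n.+1) w ^+ i *: a i) - \sum_(i < n) w ^+ i *: (cauchy_coef N i - a i).
  have -> : \sum_(i < n) w ^+ i *: (cauchy_coef N i - a i) =
     \sum_(i < n) w ^+ i *: cauchy_coef N i - \sum_(i < n) w ^+ i *: a i.
    by rewrite -sumrB; apply: eq_bigr => i _; rewrite scalerBr.
  have recr (f : nat -> V) : \sum_(i < n.+1) w ^+ i *: f i = \sum_(i < n) w ^+ i *: f i + w ^+ n *: f n.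
    by rewrite big_ord_recr.
  by rewrite !recr; lmodule V.
rewrite (le_trans (csnB hq _ _))// (le_trans (lerD (csnD hq _ _) (lexx _)))//.
have A3 : r ^+ n.+1 * M <= e / 4 * r ^+ n.
  by rewrite exprSr -mulrA mulrC ler_wpM2r// ltW.
rewrite nmX nw; move: A1 A2 A3 S2; rewrite [r ^+ n * e]mulrC; lra.
Qed.

(** Let N tend to infinity in [cauchy_discrete]. The constant M does not depend on n, so the Taylor
    series converges inside the disc. *)
Lemma taylor_disc : exists M, 0 <= M /\ forall w n, disc w -> (0 < n)%N ->
  q (\sum_(i < n) w ^+ i *: a i - g w) <= nm w ^+ n * M.
Proof.
have [M [M0 hM]] := cauchy_discrete; exists M; split=> // w n Dw n0.
apply/ler_addgt0Pr => e e0; have e2 : 0 < e / 2 by rewrite divr_gt0.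
have [N1 h1] := hM _ e2.
have nR : 0 < n%:R :> R by rewrite ltr0n.
have /choice[f fP] : forall i : 'I_n, exists N2, forall N, (N2 <= N)%N ->
    q (cauchy_coef N i - a i) <= e / 2 / n%:R.
  by move=> i; apply: cauchy_coef_cvg; rewrite !divr_gt0.
pose N := maxn (maxn N1 (\max_i f i)) n.
have A1 := h1 N w n _ Dw; rewrite n0 /= in A1.
have {}A1 : q (\sum_(k < n) w ^+ k *: cauchy_coef N k - g w) <= e / 2 + nm w ^+ n * M.
  by apply: A1; rewrite /N !leq_max leqnn ?orbT.
have A2 : q (\sum_(i < n) w ^+ i *: (cauchy_coef N i - a i)) <= e / 2.
  rewrite (le_trans (csn_sum hq _ _ _))//.
  apply: (@le_trans _ _ (\sum_(i < n) (e / 2 / n%:R))).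
    apply: ler_sum => i _; rewrite csnZ// nmX -[leRHS]mul1r.
    apply: ler_pM; [by rewrite exprn_ge0 ?nm_ge0|exact: csn_ge0|by rewrite exprn_ile1 ?nm_ge0|].
    apply: fP; rewrite /N !leq_max; apply/orP; left; apply/orP; right.
    exact: leq_bigmax.
  by rewrite sumr_const card_ord -[_ *+ n]mulr_natr divfK ?gt_eqF.
have -> : \sum_(i < n) w ^+ i *: a i - g w =
  (\sum_(k < n) w ^+ k *: cauchy_coef N k - g w) - \sum_(i < n) w ^+ i *: (cauchy_coef N i - a i).
  have -> : \sum_(i < n) w ^+ i *: (cauchy_coef N i - a i) =
     \sum_(i < n) w ^+ i *: cauchy_coef N i - \sum_(i < n) w ^+ i *: a i.
    by rewrite -sumrB; apply: eq_bigr => i _; rewrite scalerBr.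
  by lmodule V.
rewrite (le_trans (csnB hq _ _))//; move: A1 A2; lra.
Qed.

End formula.
End cauchy.

(** * Estimates for the coefficients of power series *)

Section power_series_estimates.
Context {R : realType}.
Local Notation C := (fld R ComplexScalars).

Lemma geo_half (m : nat) : \sum_(i < m) (2^-1 : R) ^+ i <= 2.
Proof.
have h : \sum_(i < m) (2^-1 : R) ^+ i = 2 - 2 * 2^-1 ^+ m.
  elim: m => [|m IH]; first by rewrite big_ord0 expr0; lra.
  rewrite big_ord_recr /= IH exprS; lra.
have p : 0 <= (2^-1 : R) ^+ m by rewrite exprn_ge0.
by rewrite h; lra.
Qed.

Lemma half_cvg (B e : R) : 0 < e -> exists N0, forall N, (N0 <= N)%N -> B * 2^-1 ^+ N <= e.
Proof.
move=> e0; have h1 : `|2^-1| < 1 :> R by rewrite gtr0_norm// invf_lt1// ltr1n.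
have B1 : 0 < `|B| + 1 by rewrite ltr_wpDl.
have /cvgrPdist_lt/(_ _ (divr_gt0 e0 B1))[N0 _ h] := cvg_expr h1.
exists N0 => N /h; rewrite sub0r normrN ger0_norm ?exprn_ge0// ltr_pdivlMr// => {}h.
have p : 0 <= (2^-1 : R) ^+ N by rewrite exprn_ge0.
have := ler_wpM2r p (ler_norm B); lra.
Qed.

Context (V : tvsType C) (q : V -> R) (hq : csn q).

Definition ps_conv (a : nat -> V) (g : C -> V) := forall z, disc z ->
  forall e, 0 < e -> exists K0, forall K, (K0 <= K)%N ->
    q (\sum_(i < K) z ^+ i *: a i - g z) <= e.

(** Convergence at z = 1: from K0 on, a coefficient is the difference of two partial sums within 1
    of g 1. *)
Lemma ps_coef_bound a g : ps_conv a g -> exists B, 0 <= B /\ forall n, q (a n) <= B.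
Proof.
move=> h; have D1 : disc (1 : C) by rewrite /disc /= nm1.
have [K0 K0P] := h 1 D1 1 ltr01.
exists (2 + \sum_(i < K0) q (a i)); split.
  by rewrite addr_ge0// sumr_ge0// => i _; exact: csn_ge0.
move=> n; have [nK|nK] := ltnP n K0.
  rewrite (bigD1 (Ordinal nK))//= addrCA lerDl addr_ge0// sumr_ge0// => i _.
  exact: csn_ge0.
have e : a n = (\sum_(i < n.+1) 1 ^+ i *: a i - g 1) - (\sum_(i < n) 1 ^+ i *: a i - g 1).
  have -> : \sum_(i < n.+1) 1 ^+ i *: a i = \sum_(i < n) 1 ^+ i *: a i + 1 ^+ n *: a n.
    by rewrite big_ord_recr.
  by rewrite expr1n; lmodule V.
have s0 : 0 <= \sum_(i < K0) q (a i) by apply: sumr_ge0 => i _; exact: csn_ge0.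
have h1 := K0P _ (leqW nK); have h2 := K0P _ nK.
rewrite e (le_trans (csnB hq _ _))//; lra.
Qed.

(* Cauchy's estimate; the Taylor coefficient is read off on the circle of radius
   1/2 by averaging over roots of unity, which kills all but the n-th coefficient
   up to a geometric tail. *)
Lemma cauchy_estimate a g M : ps_conv a g -> (forall z, disc z -> q (g z) <= M) ->
  forall n, q (a n) <= 2 ^+ n * M.
Proof.
move=> h gM n; have [B [B0 aB]] := ps_coef_bound h.
suff : 2^-1 ^+ n * q (a n) <= M.
  by rewrite exprVn ler_pdivrMl ?exprn_gt0.
apply/ler_addgt0Pr => e e0; have e2 : 0 < e / 2 by rewrite divr_gt0.
have [N0 N0P] := half_cvg (B * 2) e2.
pose N := maxn N0 n.+1.
have nN : (n < N)%N by rewrite /N leq_max leqnn orbT.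
have Npos : (0 < N)%N by exact: leq_ltn_trans nN.
have tail := N0P N (leq_maxl _ _).
have NR0 : 0 < N%:R :> R by rewrite ltr0n.
pose w j : C := root1 N ^+ j.
have nw j : nm (w j) = 1 by rewrite nmX nm_root1 expr1n.
(* With coefficients known only to be bounded by B, a radius below 1 is needed for a summable tail;
   the choice 1/2 costs the factor 2^n. *)
pose hf : C := rC 2^-1.
have nh : nm hf = 2^-1 by rewrite nm_rC gtr0_norm.
have Dj j : disc (hf * w j) by rewrite /disc /= nmM nw nh mulr1 invf_le1// ler1n.
have /choice[F FP] : forall j : 'I_N, exists K0, forall K, (K0 <= K)%N ->
    q (\sum_(i < K) (hf * w j) ^+ i *: a i - g (hf * w j)) <= e / 2.
  by move=> j; exact: h.
pose m := (\max_j F j)%N.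
pose S j := \sum_(i < N + m) (hf * w j) ^+ i *: a i.
have SM (j : 'I_N) : q (S j) <= M + e / 2.
  have := FP j (N + m)%N; rewrite (leq_trans _ (leq_addl _ _)); last exact: leq_bigmax.
  move=> /(_ isT) h1; have := gM _ (Dj j).
  have := csnD hq (S j - g (hf * w j)) (g (hf * w j)); rewrite subrK.
  rewrite /S; move: h1; lra.
(* The factor that averaging puts before the k-th coefficient: 1 or 0 for k < N, and of modulus at
   most 1 in the tail. *)
pose c k : C := (N%:R)^-1 * \sum_(j < N) (w j) ^- n * (w j) ^+ k.
have cN k : (k < N)%N -> c k = (k == n)%:R.
  move=> kN; rewrite /c root1_sum_shift//; case: eqP => _; last by rewrite mulr0.
  by rewrite mulVf// pnatr_eq0 -lt0n.
have avg (f : 'I_N -> C) : (forall j, nm (f j) <= 1) -> nm (N%:R^-1 * \sum_(j < N) f j) <= 1.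
  move=> f1; rewrite nmM nmV -(rC_nat N) nm_rC gtr0_norm// ler_pdivrMl// mulr1.
  have : nm (\sum_(j < N) f j) <= \sum_(j < N) nm (f j).
    by elim/big_rec2: _ => [|i y x _ hh]; rewrite ?nm0// (le_trans (nmD _ _))// lerD2l.
  move=> /le_trans; apply; rewrite (le_trans (ler_sum _ (fun j _ => f1 j)))//.
  by rewrite sumr_const card_ord.
have c1 k : nm (c k) <= 1.
  by apply: avg => j; rewrite nmM nmV (nmX (w j) n) (nmX (w j) k) nw !expr1n invr1 mulr1.
have eS : (N%:R : C)^-1 *: \sum_(j < N) (w j ^- n) *: S j =
    hf ^+ n *: a n + \sum_(i < m) (hf ^+ (N + i) * c (N + i)%N) *: a (N + i)%N.
  transitivity (\sum_(i < N + m) (hf ^+ i * c i) *: a i).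
    rewrite /S; under eq_bigr do rewrite scaler_sumr.
    rewrite exchange_big /= scaler_sumr; apply: eq_bigr => i _.
    rewrite /c mulrCA -scalerA; congr (_ *: _).
    rewrite mulr_sumr scaler_suml; apply: eq_bigr => j _.
    by rewrite scalerA exprMn mulrCA.
  rewrite big_split_ord /=; congr (_ + _).
  rewrite (bigD1 (Ordinal nN))//= cN// eqxx mulr1 big1 ?addr0// => i ni.
  by rewrite cN// -(inj_eq val_inj) in ni *; rewrite (negbTE ni) mulr0 scale0r.
have -> : 2^-1 ^+ n * q (a n) = q (hf ^+ n *: a n) by rewrite csnZ// nmX nh.
have -> : hf ^+ n *: a n = (N%:R : C)^-1 *: \sum_(j < N) (w j ^- n) *: S j -
   \sum_(i < m) (hf ^+ (N + i) * c (N + i)%N) *: a (N + i)%N by rewrite eS addrK.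
rewrite (le_trans (csnB hq _ _))// [e]splitr addrA lerD//.
  rewrite csnZ// nmV -(rC_nat N) nm_rC gtr0_norm// ler_pdivrMl//.
  rewrite (le_trans (csn_sum hq _ _ _))//.
  apply: (@le_trans _ _ (\sum_(j < N) (M + e / 2))).
    by apply: ler_sum => j _; rewrite csnZ// nmV (nmX (w j) n) nw expr1n invr1 mul1r.
  by rewrite sumr_const card_ord mulr_natl.
rewrite (le_trans (csn_sum hq _ _ _))// (le_trans _ tail)//.
apply: (@le_trans _ _ (\sum_(i < m) (B * 2^-1 ^+ N) * 2^-1 ^+ i)).
  apply: ler_sum => i _; rewrite csnZ// nmM nmX nh exprD.
  have p1 : 0 <= 2^-1 ^+ N * 2^-1 ^+ i :> R by rewrite mulr_ge0 ?exprn_ge0.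
  have h1 := ler_pM (nm_ge0 _) (csn_ge0 hq _) (c1 (N + i)%N) (aB (N + i)%N).
  have := ler_wpM2l p1 h1; rewrite !mulrA; lra.
have p2 : 0 <= B * 2^-1 ^+ N by rewrite mulr_ge0 ?exprn_ge0.
rewrite -mulr_sumr; have := ler_wpM2l p2 (geo_half m); lra.
Qed.

(** For |t| <= 1/2 the terms of order at least 2 add up to at most 2 B |t|^2. *)
Lemma ps_hasd a g : ps_conv a g -> hasd q g 0 (a 1%N).
Proof.
move=> h; have [B [B0 aB]] := ps_coef_bound h.
have D0 : disc (0 : C) by rewrite /disc /= nm0.
have g0 : q (a 0%N - g 0) = 0.
  apply/eqP; rewrite eq_le csn_ge0// andbT; apply/ler_addgt0Pr => e e0; rewrite add0r.
  have [K0 /(_ K0.+1 (leqnSn _))] := h 0 D0 e e0.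
  rewrite big_ord_recl expr0 scale1r big1 ?addr0// => i _.
  by rewrite exprS mul0r scale0r.
move=> e e0; have B1 : 0 < 2 * B + 1 by rewrite ltr_wpDl// mulr_ge0.
exists (Num.min 2^-1 (e / (2 * B + 1))); first by rewrite lt_min invr_gt0 divr_gt0 ?ltr0n.
move=> t; rewrite lt_min => /andP[t2 te].
have Dt : disc t by rewrite /disc /= (le_trans (ltW t2))// invf_le1// ler1n.
have main : q (g t - a 0%N - t *: a 1%N) <= 2 * B * nm t * nm t.
  apply/ler_addgt0Pr => d d0; have [K0 K0P] := h t Dt d d0.
  have {}K0P := K0P K0.+2 (leqW (leqnSn _)).
  have -> : g t - a 0%N - t *: a 1%N =
    \sum_(i < K0) t ^+ i.+2 *: a i.+2 - (\sum_(i < K0.+2) t ^+ i *: a i - g t).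
    have -> : \sum_(i < K0.+2) t ^+ i *: a i =
       a 0%N + (t *: a 1%N + \sum_(i < K0) t ^+ i.+2 *: a i.+2).
      by rewrite 2!big_ord_recl expr0 scale1r /= expr1.
    by lmodule V.
  rewrite (le_trans (csnB hq _ _))// lerD//.
  rewrite (le_trans (csn_sum hq _ _ _))//.
  apply: (@le_trans _ _ (\sum_(i < K0) (B * nm t * nm t) * 2^-1 ^+ i)).
    apply: ler_sum => i _; rewrite csnZ// nmX !exprS mulrA.
    have h1 : nm t ^+ i <= 2^-1 ^+ i by rewrite lerXn2r ?nnegrE ?nm_ge0// ltW.
    have h2 : 0 <= nm t * nm t by rewrite mulr_ge0 ?nm_ge0.
    have h3 := ler_pM (exprn_ge0 i (nm_ge0 t)) (csn_ge0 hq _) h1 (aB i.+2).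
    have := ler_wpM2l h2 h3; rewrite !mulrA; lra.
  rewrite -mulr_sumr; have := geo_half K0.
  have : 0 <= B * nm t * nm t by rewrite !mulr_ge0 ?nm_ge0.
  by move=> h1 h2; have := ler_wpM2l h1 h2; lra.
rewrite add0r.
have -> : g t - g 0 - t *: a 1%N = (g t - a 0%N - t *: a 1%N) + (a 0%N - g 0) by lmodule V.
rewrite (le_trans (csnD hq _ _))// g0 addr0 (le_trans main)//.
rewrite ler_wpM2r ?nm_ge0//.
rewrite (le_trans (_ : _ <= (2 * B + 1) * nm t))//; first by rewrite ler_wpM2r ?nm_ge0// lerDl.
by rewrite mulrC -ler_pdivlMr// ltW.
Qed.

End power_series_estimates.

(** * Polynomial expansion of multilinear maps *)

Section multilinear_expansion.
Context {K : numFieldType} (X H : tvsType K) (n : nat) (b : ('I_n -> X) -> H).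
Hypothesis bl : multilinear b.

Definition upd (l : seq 'I_n) (A y : 'I_n -> X) : 'I_n -> X :=
  fun i => if i \in l then A i else y i.

Lemma upd_cons i l A y : upd (i :: l) A y = dfwith (upd l A y) i (A i).
Proof.
apply/funext => j; rewrite /upd inE; case: dfwithP => [|j' ij'].
  by rewrite eqxx.
by rewrite eq_sym (negbTE ij').
Qed.

Lemma dfwith_same (g : 'I_n -> X) i : dfwith g i (g i) = g.
Proof. by apply/funext => j; case: dfwithP. Qed.

Lemma upd_out i l A y : i \notin l -> upd l A y i = y i.
Proof. by rewrite /upd => /negbTE->. Qed.

Lemma upd_dfwith i l A y u : i \notin l -> dfwith (upd l A y) i u = upd l A (dfwith y i u).
Proof.
move=> il; apply/funext => j; rewrite /upd; case: dfwithP => [|j' ij'].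
  by rewrite (negbTE il) dfwithin.
by case: ifP => // _; rewrite dfwithout.
Qed.

Lemma multilinearZ z y l : uniq l ->
  b (upd l (fun i => z *: y i) y) = z ^+ size l *: b y.
Proof.
elim: l => [_|i l IH] /=; first by rewrite expr0 scale1r; congr b; apply/funext.
move=> /andP[il ul]; rewrite upd_cons (linZ (@bl i _)).
rewrite (_ : dfwith _ i (y i) = upd l (fun i => z *: y i) y).
  by rewrite IH// scalerA exprS.
by rewrite -[X in dfwith _ i X](upd_out (fun i => z *: y i) y il) dfwith_same.
Qed.

(** Moving the slots of l one by one exhibits b (y + s w) as a polynomial in s. Later only its
    constant and linear coefficients and its degree matter. *)
Lemma multilinear_expand l y w : uniq l -> exists c : nat -> H,
  [/\ forall s, b (upd l (fun i => y i + s *: w i) y) = \sum_(k < (size l).+1) s ^+ k *: c k,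
      c 0%N = b y, c 1%N = \sum_(i <- l) b (dfwith y i (w i)) &
      forall k, (size l < k)%N -> c k = 0].
Proof.
elim: l y => [|i l IH] y /=.
  move=> _; exists (fun k => if k is 0%N then b y else 0); split=> //.
  - by move=> s; rewrite big_ord_recl big_ord0 expr0 scale1r addr0; congr b; apply/funext.
  - by rewrite big_nil.
  - by case.
move=> /andP[il ul]; have [c [cE c0 c1 cs]] := IH y ul.
have [c' [cE' c0' c1' cs']] := IH (dfwith y i (w i)) ul.
exists (fun k => c k + (if k is k'.+1 then c' k' else 0)); split.
- move=> s; rewrite upd_cons.
  rewrite [y i + _]addrC (@bl i _ s) upd_dfwith//.
  have -> : dfwith (upd l (fun i => y i + s *: w i) y) i (y i) = upd l (fun i => y i + s *: w i) y.
    by rewrite -[X in dfwith _ i X](upd_out (fun i => y i + s *: w i) y il) dfwith_same.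
  have -> : upd l (fun i => y i + s *: w i) (dfwith y i (w i)) =
      upd l (fun j => dfwith y i (w i) j + s *: w j) (dfwith y i (w i)).
    apply/funext => j; rewrite /upd; case: ifP => // jl.
    by rewrite dfwithout//; apply: contraNneq il => ->.
  rewrite cE cE' addrC.
  transitivity (\sum_(k < (size l).+2) s ^+ k *: c k +
    \sum_(k < (size l).+2) s ^+ k *: (if (k : nat) is k'.+1 then c' k' else 0)); last first.
    by rewrite -big_split; apply: eq_bigr => k _; rewrite scalerDr.
  congr (_ + _); first by rewrite [RHS]big_ord_recr /= cs// scaler0 addr0.
  rewrite [RHS]big_ord_recl /= scaler0 add0r scaler_sumr; apply: eq_bigr => k _.
  by rewrite scalerA exprS.
- by rewrite addr0.
- by rewrite c1 c0' big_cons addrC.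
- by case=> // k; rewrite ltnS => lk; rewrite cs ?cs' ?addr0// ltnW.
Qed.

End multilinear_expansion.

(** * Complex analytic maps *)

Section analytic_to_smooth.
Context {R : realType}.
Local Notation C := (fld R ComplexScalars).
Implicit Types X H : tvsType C.

Lemma series_csnP H (u : nat -> H) (l : H) :
  (series u @ \oo --> l) <-> forall q, csn q -> forall e, 0 < e ->
    exists K0, forall K, (K0 <= K)%N -> q (\sum_(i < K) u i - l) <= e.
Proof.
rewrite csn_cvgP; split=> h q hq e e0.
  have [K0 _ K0P] := h q hq e e0; exists K0 => K /K0P /ltW.
  by rewrite /series /= big_mkord.
have e2 : 0 < e / 2 by rewrite divr_gt0.
have [K0 K0P] := h q hq _ e2; exists K0 => // K /K0P.
rewrite /series /= big_mkord => /le_lt_trans; apply.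
by rewrite ltr_pdivrMr// mulr_natr mulr2n ltrDl.
Qed.

(** The data hidden in [power_series_analytic] at one point, with the unit ball of [rho] as the
    domain of convergence. *)
Definition expansion X H (U : set X) (f : X -> H) (x : X) (p : nat -> X -> H)
    (b : forall n, ('I_n -> X) -> H) (rho : X -> R) :=
  [/\ forall n, continuous (p n), forall n, multilinear (b n),
      forall n y, p n y = b n (fun=> y), csn rho &
      forall y, rho y < 1 -> U (x + y) /\ forall q, csn q -> forall e, 0 < e ->
        exists K0, forall K, (K0 <= K)%N -> q (\sum_(i < K) p i y - f (x + y)) <= e].

Lemma expansion_ex X H (U : set X) (f : X -> H) x : power_series_analytic U f -> U x ->
  exists p b rho, expansion U f x p b rho.
Proof.
move=> [oU cf h] Ux; have [p pc pn] := h x Ux.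
have hb n : exists b : ('I_n -> X) -> H, multilinear b /\ forall x, p n x = b (fun=> x).
  by have [_ [b bl pb]] := pc n; exists b.
pose b n := sval (cid (hb n)); have bP n := svalP (cid (hb n)).
have nU := (near_shift x U).1 (open_near oU Ux).
have [rho hr rhoP] := csn_nbhs (filterI pn nU).
exists p, b, rho; split=> //.
- by move=> n; case: (pc n).
- by move=> n; case: (bP n).
- by move=> n; case: (bP n).
by move=> y /rhoP[/series_csnP s Uy].
Qed.

Section at_point.
Context (X H : tvsType C) (U : set X) (f : X -> H) (x : X) (p : nat -> X -> H)
  (b : forall n, ('I_n -> X) -> H) (rho : X -> R).
Arguments b : clear implicits.
Hypothesis hexp : expansion U f x p b rho.

Let pc n : continuous (p n). Proof. by case: hexp. Qed.
Let bl n : multilinear (b n). Proof. by case: hexp. Qed.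
Let pb n y : p n y = b n (fun=> y). Proof. by case: hexp. Qed.
Let hr : csn rho. Proof. by case: hexp. Qed.
Let ps y : rho y < 1 -> forall q, csn q -> forall e, 0 < e ->
  exists K0, forall K, (K0 <= K)%N -> q (\sum_(i < K) p i y - f (x + y)) <= e.
Proof. by case: hexp => _ _ _ _ /[apply] -[]. Qed.

Lemma expansionZ n z y : p n (z *: y) = z ^+ n *: p n y.
Proof.
have := @multilinearZ _ _ _ n (b n) (@bl n) z (fun=> y) (enum 'I_n) (enum_uniq _).
rewrite size_enum_ord -pb => <-; rewrite pb; congr b; apply/funext => i.
by rewrite /upd mem_enum.
Qed.

Lemma expansion_line q y : csn q -> rho y < 1 ->
  ps_conv q (fun n => p n y) (fun z => f (x + z *: y)).
Proof.
move=> hq ry z Dz e e0; have rz : rho (z *: y) < 1.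
  by rewrite csnZ// (le_lt_trans _ ry)// ler_piMl ?csn_ge0.
have [K0 K0P] := ps rz hq e0; exists K0 => K /K0P.
by under eq_bigr do rewrite expansionZ.
Qed.

Lemma expansion_dirder w : is_dirder f w x (p 1%N w).
Proof.
have c0 : 0 < rho w + 1 by rewrite ltr_wpDl ?csn_ge0.
(* Scales w into the unit ball of [rho]; homogeneity of the derivative undoes the scaling. *)
pose c : C := rC (rho w + 1)^-1.
have c1 : c != 0 by rewrite rC_eq0 invr_eq0 gt_eqF.
have rcw : rho (c *: w) < 1.
  rewrite csnZ// nm_rC gtr0_norm ?invr_gt0// ltr_pdivrMl// mulr1 ltrDl//.
have h : is_dirder f (c *: w) x (p 1%N (c *: w)).
  apply/dirderP => q hq e e0.
  have [d d0 dP] := ps_hasd hq (expansion_line hq rcw) e0; exists d => // t /dP.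
  by rewrite add0r scale0r addr0.
have := dirderZ (a := c^-1) h.
by rewrite expansionZ expr1 !scalerK.
Qed.

(** The derivative of p n at y along w. As b n need not be symmetric, the sum runs over all
    positions of w. *)
Definition polar n (y w : X) : H := \sum_(i < n) b n (dfwith (fun=> y) i w).

Lemma polarP n y w : exists c : nat -> H,
  [/\ forall s, p n (y + s *: w) = \sum_(k < n.+1) s ^+ k *: c k,
     c 0%N = p n y, c 1%N = polar n y w & forall k, (n < k)%N -> c k = 0].
Proof.
have := @multilinear_expand _ _ _ n (b n) (@bl n) (enum 'I_n) (fun=> y) (fun=> w) (enum_uniq _).
rewrite size_enum_ord => -[c [cE c0 c1 cs]]; exists c; split=> //.
- move=> s; rewrite -cE pb; congr b; apply/funext => i.
  by rewrite /upd mem_enum.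
- by rewrite pb.
- by rewrite c1 /polar big_enum.
Qed.

Lemma polarZ n y (a : C) w : polar n y (a *: w) = a *: polar n y w.
Proof.
rewrite /polar scaler_sumr; apply: eq_bigr => i _.
exact: (linZ (@bl n i (fun=> y))).
Qed.

(** Expresses the derivative of p n through values of p n, so that it inherits continuity although b
    n is not assumed continuous. With n + 2 roots the exponents 0, ..., n and the exponent 1 stay
    below the number of roots, also for n = 0. *)
Lemma polar_avg n y w : polar n y w = (n.+2%:R : C)^-1 *:
  \sum_(j < n.+2) (root1 n.+2 ^+ j)^-1 *: p n (y + root1 n.+2 ^+ j *: w).
Proof.
have [c [cE _ <- cs]] := polarP n y w.
under [in RHS]eq_bigr do rewrite cE scaler_sumr.
rewrite exchange_big /=.
transitivity ((n.+2%:R : C)^-1 *: \sum_(k < n.+1)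
   (\sum_(j < n.+2) (root1 n.+2 ^+ j) ^- 1 * (root1 n.+2 ^+ j) ^+ k : C) *: c k); last first.
  congr (_ *: _); apply: eq_bigr => k _; rewrite scaler_suml; apply: eq_bigr => j _.
  by rewrite expr1 scalerA.
have kn (k : 'I_n.+1) : (k < n.+2)%N by rewrite ltnS ltnW.
under eq_bigr do rewrite root1_sum_shift//.
have [n0|n0] := posnP n.
  rewrite cs ?n0// big1 ?scaler0// => k _; case: eqP => [k1|_]; last by rewrite scale0r.
  by have := ltn_ord k; rewrite k1.
have l1 : (1 < n.+1)%N by [].
rewrite (bigD1 (Ordinal l1))//= big1 ?addr0.
  by rewrite scalerA mulVf ?scale1r// pnatr_eq0.
by move=> i; rewrite -(inj_eq val_inj) => /negbTE /= ->; rewrite scale0r.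
Qed.

Lemma polar_cont n : continuous (fun yw : X * X => polar n yw.1 yw.2).
Proof.
rewrite (_ : (fun yw => _) = fun yw : X * X => (n.+2%:R : C)^-1 *:
  \sum_(j < n.+2) (root1 n.+2 ^+ j)^-1 *: p n (yw.1 + root1 n.+2 ^+ j *: yw.2)); last first.
  by apply/funext => yw; rewrite polar_avg.
have : IC 0 [set: X * X] (fun yw : X * X => (n.+2%:R : C)^-1 *:
  \sum_(j < n.+2) (root1 n.+2 ^+ j)^-1 *: p n (yw.1 + root1 n.+2 ^+ j *: yw.2)).
  apply: IC_scale; first exact: openT.
  apply: IC_sum; first exact: openT.
  move=> j _; apply: IC_scale; first exact: openT.
  apply: (@IC_comp _ _ 0 _ _ _ setT setT (fun yw : X * X => yw.1 + root1 n.+2 ^+ j *: yw.2) (p n)) => //;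
    try exact: openT.
    apply: IC_add; first exact: openT.
      by apply: IC_lin; [exact: lin_fst|exact: cont_fst].
    apply: IC_scale; first exact: openT.
    by apply: IC_lin; [exact: lin_snd|exact: cont_snd].
  by move=> y _; exact: pc.
by move=> h yw; exact: h.
Qed.

Section bounds.
Context (q : H -> R) (hq : csn q) (y w : X) (M : R).
Hypothesis yw8 : rho y < 8^-1 /\ rho w < 8^-1.
Hypothesis bd : forall z s, disc z -> disc s -> q (f (x + (4 * z) *: (y + s *: w))) <= M.

Let M0 : 0 <= M.
Proof.
by apply: le_trans (bd (z := 0) (s := 0) _ _); rewrite ?csn_ge0 /disc /= ?nm0.
Qed.

Let r4 (s : C) : disc s -> rho (4 *: (y + s *: w)) < 1.
Proof.
move=> Ds; rewrite csnZ// -(rC_nat 4) nm_rC gtr0_norm//.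
have := csnD hr y (s *: w); rewrite csnZ//.
have : nm s * rho w <= rho w by rewrite ler_piMl ?csn_ge0.
case: yw8; lra.
Qed.

(** Cauchy's estimate on the line through 4 (y + s w) loses 2^n, and homogeneity gains 4^n. The
    radius 1/8 for y and w keeps 4 (y + s w) in the unit ball of [rho]. *)
Lemma expansion_bound n s : disc s -> q (p n (y + s *: w)) <= 2^-1 ^+ n * M.
Proof.
move=> Ds; have := cauchy_estimate hq (expansion_line hq (r4 Ds)) _ n.
move=> /(_ M) h; have {h} : q (p n (4 *: (y + s *: w))) <= 2 ^+ n * M.
  by apply: h => z Dz; rewrite scalerA mulrC bd.
rewrite expansionZ csnZ// nmX -(rC_nat 4) nm_rC gtr0_norm//.
have -> : 4 = 2 * 2 :> R by lra.
have p2 : 0 < 2 ^+ n :> R by rewrite exprn_gt0.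
by rewrite exprMn -mulrA ler_pM2l// exprVn ler_pdivlMl.
Qed.

(** Cauchy's estimate for the coefficient of s in the polynomial s |-> p n (y + s w). *)
Lemma polar_bound n : q (polar n y w) <= 2 * (2^-1 ^+ n * M).
Proof.
have [c [cE c0 c1 cs]] := polarP n y w.
have := @cauchy_estimate R H q hq c (fun s => p n (y + s *: w)) (2^-1 ^+ n * M) _ _ 1%N.
rewrite c1 expr1; apply; last by move=> z; exact: expansion_bound.
move=> z Dz e e0; exists n.+1 => K nK.
rewrite -(subnKC nK) big_split_ord /= cE [X in q (_ + X - _)]big1 ?addr0.
  by rewrite subrr csn0// ltW.
by move=> i _; rewrite cs ?scaler0// leq_addr.
Qed.

End bounds.
End at_point.

(* Both sides are power series in s near 0; comparing the coefficients of s by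
   Cauchy's estimate exchanges the derivative with the sum. *)
Lemma polar_sum X H (U : set X) (f : X -> H) (x : X) p b rho (q : H -> R) (y w : X) M :
  expansion U f x p b rho -> csn q -> rho y < 8^-1 /\ rho w < 8^-1 ->
  (forall z s, disc z -> disc s -> q (f (x + (4 * z) *: (y + s *: w))) <= M) ->
  power_series_analytic U f -> forall l, is_dirder f w (x + y) l -> hausdorff_space H ->
  forall e, 0 < e -> exists K0, forall K, (K0 <= K)%N ->
    q (\sum_(n < K) polar b n y w - l) <= e.
Proof.
move=> hexp hq yw8 bd PA l hl hH e e0.
have [_ _ _ hr ps] := hexp.
have M0 : 0 <= M.
  by apply: le_trans (bd 0 0 _ _); rewrite ?csn_ge0 /disc /= ?nm0.
have D0 : disc (0 : C) by rewrite /disc /= nm0.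
have r1 (s : C) : disc s -> rho (y + s *: w) < 1.
  move=> Ds; have := csnD hr y (s *: w); rewrite csnZ//.
  have : nm s * rho w <= rho w by rewrite ler_piMl ?csn_ge0.
  case: yw8; lra.
have [Uy _] : U (x + y) /\ True by split=> //; apply: (ps y _).1; have := r1 0 D0; rewrite scale0r addr0.
have [p' [b' [rho' hexp']]] := expansion_ex PA Uy.
have hr' : csn rho' by case: hexp'.
have := csn_ge0 hr' w => rw0.
(* Brings w into the ball of convergence of the second expansion, the one at x + y. *)
pose r : R := (rho' w + 1)^-1.
have r0 : 0 < r by rewrite invr_gt0 ltr_wpDl.
have rle1 : r <= 1 by rewrite invf_le1 ?ltr_wpDl// lerDr.
have rrw : rho' (rC r *: w) < 1.
  by rewrite csnZ// nm_rC gtr0_norm// ltr_pdivrMl ?ltr_wpDl// mulr1 ltrDl.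
have hcc n : exists c : nat -> H,
  [/\ forall s, p n (y + s *: w) = \sum_(k < n.+1) s ^+ k *: c k,
     c 0%N = p n y, c 1%N = polar b n y w & forall k, (n < k)%N -> c k = 0] by exact: (polarP hexp).
pose cc n := sval (cid (hcc n)).
have ccE n s : p n (y + s *: w) = \sum_(k < n.+1) s ^+ k *: cc n k by case: (svalP (cid (hcc n))).
have cc1 n : cc n 1%N = polar b n y w by case: (svalP (cid (hcc n))).
have ccs n k : (n < k)%N -> cc n k = 0 by case: (svalP (cid (hcc n))) => _ _ _; apply.
have l1 : l = p' 1%N w by apply: dirder_unique hH hl _; exact: expansion_dirder hexp' w.
have key K : q (\sum_(n < K) polar b n y w - l) <= (r^-1 * 2 * 2 * M) * 2^-1 ^+ K.
  (* The coefficients in s of the tail [g] of the first expansion along y + s r w. The tail is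
     O(2^-K), and A 1 is r times the difference to be estimated, up to sign. *)
  pose A k := p' k (rC r *: w) - rC r ^+ k *: \sum_(n < K) cc n k.
  pose g (s : C) := f (x + y + s *: (rC r *: w)) - \sum_(n < K) p n (y + (s * rC r) *: w).
  have Dsr s : disc s -> disc (s * rC r).
    by rewrite /disc /= nmM nm_rC gtr0_norm// => Ds; rewrite mulr_ile1 ?nm_ge0// ltW.
  have hA : ps_conv q A g.
    move=> z Dz d d0; have [K1 K1P] := expansion_line hexp' hq rrw Dz d0.
    exists (maxn K1 K) => K'; rewrite geq_max => /andP[/K1P h KK'].
    suff -> : \sum_(i < K') z ^+ i *: A i - g z =
        \sum_(i < K') z ^+ i *: p' i (rC r *: w) - f (x + y + z *: (rC r *: w)) by [].
    have -> : \sum_(i < K') z ^+ i *: A i = \sum_(i < K') z ^+ i *: p' i (rC r *: w) -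
        \sum_(i < K') \sum_(n < K) (z * rC r) ^+ i *: cc n i.
      rewrite -sumrB; apply: eq_bigr => i _; rewrite /A scalerBr; congr (_ - _).
      by rewrite scalerA -exprMn scaler_sumr.
    have -> : \sum_(i < K') \sum_(n < K) (z * rC r) ^+ i *: cc n i =
        \sum_(n < K) p n (y + (z * rC r) *: w).
      rewrite exchange_big /=; apply: eq_bigr => n _; rewrite ccE.
      have nK' : (n < K')%N by exact: leq_trans (ltn_ord n) KK'.
      rewrite -(subnKC nK') big_split_ord /= [X in _ + X]big1 ?addr0// => i _.
      by rewrite ccs ?scaler0// leq_addr.
    by rewrite /g; lmodule H.
  have gM s : disc s -> q (g s) <= 2 * M * 2^-1 ^+ K.
    move=> /Dsr Ds; apply/ler_addgt0Pr => d d0.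
    have [K1 K1P] := (ps _ (r1 _ Ds)).2 q hq d d0.
    have {}K1P := K1P (K + K1)%N (leq_addl _ _).
    have -> : g s = \sum_(i < K1) p (K + i)%N (y + (s * rC r) *: w) -
       (\sum_(i < K + K1) p i (y + (s * rC r) *: w) - f (x + (y + (s * rC r) *: w))).
      have -> : \sum_(i < K + K1) p i (y + (s * rC r) *: w) =
        \sum_(i < K) p i (y + (s * rC r) *: w) + \sum_(i < K1) p (K + i)%N (y + (s * rC r) *: w).
        by rewrite big_split_ord.
      have -> : x + (y + (s * rC r) *: w) = x + y + s *: (rC r *: w) by lmodule X.
      by rewrite /g; lmodule H.
    rewrite (le_trans (csnB hq _ _))// lerD// (le_trans (csn_sum hq _ _ _))//.
    apply: (@le_trans _ _ (\sum_(i < K1) (M * 2^-1 ^+ K) * 2^-1 ^+ i)).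
      apply: ler_sum => i _; rewrite (le_trans (expansion_bound hexp hq yw8 bd _ Ds))// exprD; lra.
    have h1 : 0 <= M * 2^-1 ^+ K by rewrite mulr_ge0 ?exprn_ge0.
    rewrite -mulr_sumr; have := ler_wpM2l h1 (geo_half K1); lra.
  have := cauchy_estimate hq hA gM 1%N.
  rewrite /A !expr1 (expansionZ hexp') expr1 -l1 -scalerBr.
  under eq_bigr do rewrite cc1.
  rewrite csnZ// nm_rC gtr0_norm// csn_sym// mulrC -ler_pdivlMr// => /le_trans; apply.
  by rewrite le_eqVlt; apply/orP; left; apply/eqP; ring.
have [K0 K0P] := half_cvg (r^-1 * 2 * 2 * M) e0.
by exists K0 => K /K0P; apply: le_trans.
Qed.

Lemma disc0 : disc (0 : C). Proof. by rewrite /disc /= nm0. Qed.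

Lemma small_4 X (rho : X -> R) y w (z s : C) : csn rho -> rho y < 8^-1 -> rho w < 8^-1 ->
  disc z -> disc s -> rho ((4 * z) *: (y + s *: w)) < 1.
Proof.
rewrite /disc /= => hr ry rw Dz Ds; rewrite csnZ// nmM -(rC_nat 4) nm_rC gtr0_norm//.
have := csnD hr y (s *: w); rewrite csnZ//.
have : nm s * rho w <= rho w by rewrite ler_piMl ?csn_ge0.
have r0 := csn_ge0 hr (y + s *: w).
have : nm z * rho (y + s *: w) <= rho (y + s *: w) by rewrite ler_piMl.
have := nm_ge0 z; lra.
Qed.

Section derivative.
Context (X H : tvsType C) (U : set X) (f : X -> H).
Hypothesis (hH : hausdorff_space H) (PA : power_series_analytic U f).
Let df (p : X * X) := dirder f p.2 p.1.

Let oU : open U. Proof. by case: PA. Qed.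
Let cf : cont_on U f.
Proof. by case: PA => oU' cf _; apply/within_contP. Qed.

Lemma analytic_dirder x w : U x -> is_dirder f w x (df (x, w)).
Proof.
move=> Ux; have [p [b [rho hexp]]] := expansion_ex PA Ux.
by apply: dirder_ex; exists (p 1%N w); exact: expansion_dirder hexp w.
Qed.

Let dfZ x (c : C) w : U x -> df (x, c *: w) = c *: df (x, w).
Proof.
by move=> Ux; apply: dirderE => //; apply: dirderZ; exact: analytic_dirder.
Qed.

Section at_x.
Context (x : X) (p : nat -> X -> H) (b : forall n, ('I_n -> X) -> H) (rho : X -> R).
Arguments b : clear implicits.
Hypothesis hexp : expansion U f x p b rho.
Hypothesis Ux : U x.
Let hr : csn rho. Proof. by case: hexp. Qed.
Let xU y : rho y < 1 -> U (x + y). Proof. by case: hexp => _ _ _ _ /[apply] -[]. Qed.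

(** The bound M required by [polar_sum] comes from compactness of disc x disc; an arbitrary w is
    first scaled below 1/8. *)
Lemma polar_sum_df q y w : csn q -> rho y < 8^-1 ->
  forall e, 0 < e -> exists K0, forall K, (K0 <= K)%N ->
    q (\sum_(n < K) polar b n y w - df (x + y, w)) <= e.
Proof.
move=> hq ry e e0.
have Uy : U (x + y) by apply: xU; lra.
have c0 : 0 < 8 * rho w + 1 by rewrite ltr_wpDl// mulr_ge0 ?csn_ge0.
pose c : C := rC (8 * rho w + 1)^-1.
have nc : nm c = (8 * rho w + 1)^-1 by rewrite nm_rC gtr0_norm// invr_gt0.
have cn0 : c != 0 by rewrite rC_eq0 invr_eq0 gt_eqF.
pose w1 := c *: w.
have rw1 : rho w1 < 8^-1.
  by rewrite csnZ// nc ltr_pdivrMl// mulrC; have := csn_ge0 hr w; lra.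
pose h (zs : C^o * C^o) := f (x + (4 * zs.1) *: (y + zs.2 *: w1)).
have ch zs : (disc `*` disc) zs -> {for zs, continuous h}.
  case: zs => z s [/= Dz Ds]; apply: (@continuous_comp _ _ _ (fun zs : C^o * C^o => x + (4 * zs.1) *: (y + zs.2 *: w1)) f);
    last by apply: cf; apply: xU; exact: small_4.
  have cs : continuous (fun zs : C^o * C^o => zs.2 *: w1).
    by apply: cont_comp (@scale_contr _ _ _ w1); exact: cont_snd.
  have cz : continuous (fun zs : C^o * C^o => (4 * zs.1 : C^o)).
    exact: (cont_comp (@cont_fst _ _ _ _) (@scale_contl _ _ (C^o : tvsType C) 4)).
  have cadd (g : C^o * C^o -> X) a : continuous g -> continuous (fun zs => a + g zs).
    move=> cg zs; apply: (@continuous_comp _ (X * X)%type _ (fun zs => (a, g zs)) (fun p => p.1 + p.2)).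
      by apply: cont_pair; [exact: cont_cst|exact: cg].
    exact: add_continuous.
  apply: (cadd (fun zs => (4 * zs.1) *: (y + zs.2 *: w1))) => zs'.
  apply: (@continuous_comp _ (C^o * X)%type _ (fun zs : C^o * C^o => (4 * zs.1 : C^o, y + zs.2 *: w1))
    (fun z : C^o * X => z.1 *: z.2)); last exact: scale_continuous.
  by apply: cont_pair_at; [exact: cz|apply: cadd].
have [M [M0 hM]] := compact_bounded hq (compact_setX (@disc_compact R) (@disc_compact R)) ch.
have nc0 : 0 < nm c by rewrite nc invr_gt0.
have hl := analytic_dirder (w := w1) Uy.
have bd z s : disc z -> disc s -> q (f (x + (4 * z) *: (y + s *: w1))) <= M.
  by move=> Dz Ds; exact: (hM (z, s) (conj Dz Ds)).
have [K0 K0P] := polar_sum hexp hq (conj ry rw1) bd PA hl hH (mulr_gt0 nc0 e0).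
exists K0 => K /K0P; rewrite dfZ//; under eq_bigr do rewrite (polarZ hexp).
by rewrite -scaler_sumr -scalerBr csnZ// ler_pM2l.
Qed.

(** The series of the [polar] terms converges to [df] uniformly near (x, w0), and its partial sums
    are continuous. *)
Lemma df_cont_at w0 : {for (x, w0), continuous df}.
Proof.
apply/csn_contP => q hq e e0.
have [q' hq' q'P] := csn_nbhsx ((csn_contP f x).1 (cf Ux) q hq 1 ltr01).
(* Controls convergence through [rho] and, through q', the oscillation of f at x, so that one bound
   M serves all small y and w. *)
pose sg v := rho v + q' v; have hs : csn sg by exact: csn_max.
have rs v : rho v <= sg v by rewrite lerDl csn_ge0.
have qs v : q' v <= sg v by rewrite lerDr csn_ge0.
pose M := q (f x) + 1.
have M0 : 0 <= M by rewrite addr_ge0 ?csn_ge0.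
have bd y w : sg y < 8^-1 -> sg w < 8^-1 ->
    forall z s, disc z -> disc s -> q (f (x + (4 * z) *: (y + s *: w))) <= M.
  move=> sy sw z s Dz Ds.
  have := small_4 hs sy sw Dz Ds => /(le_lt_trans (qs _)) h.
  have := q'P (x + (4 * z) *: (y + s *: w)); rewrite [X in q' X]addrC addKr => /(_ h) /ltW h1.
  have := csnD hq (f (x + (4 * z) *: (y + s *: w)) - f x) (f x).
  rewrite subrK /M; move: h1; lra.
have tail y w : sg y < 8^-1 -> sg w < 8^-1 -> forall K,
    q (df (x + y, w) - \sum_(n < K) polar b n y w) <= (4 * M) * 2^-1 ^+ K.
  move=> sy sw K; apply/ler_addgt0Pr => d d0.
  have ry := le_lt_trans (rs y) sy; have rw := le_lt_trans (rs w) sw.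
  have [K0 K0P] := polar_sum_df w hq ry d0.
  have {}K0P := K0P (K + K0)%N (leq_addl _ _).
  have -> : df (x + y, w) - \sum_(n < K) polar b n y w =
     \sum_(n < K0) polar b (K + n) y w - (\sum_(n < K + K0) polar b n y w - df (x + y, w)).
    have -> : \sum_(n < K + K0) polar b n y w = \sum_(n < K) polar b n y w +
       \sum_(n < K0) polar b (K + n) y w by rewrite big_split_ord.
    by lmodule H.
  rewrite (le_trans (csnB hq _ _))// lerD// (le_trans (csn_sum hq _ _ _))//.
  apply: (@le_trans _ _ (\sum_(i < K0) (2 * M * 2^-1 ^+ K) * 2^-1 ^+ i)).
    apply: ler_sum => i _.
    rewrite (le_trans (polar_bound hexp hq (conj ry rw) (bd _ _ sy sw) _))// exprD; lra.
  have h1 : 0 <= 2 * M * 2^-1 ^+ K by rewrite !mulr_ge0 ?exprn_ge0.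
  rewrite -mulr_sumr; have := ler_wpM2l h1 (geo_half K0); lra.
have c0 : 0 < 16 * sg w0 + 1 by rewrite ltr_wpDl// mulr_ge0 ?csn_ge0.
(* One 1/16 for c w0 and one for c (w - w0) give the 1/8 that the tail estimate needs. *)
pose c : C := rC (16 * sg w0 + 1)^-1.
have nc : nm c = (16 * sg w0 + 1)^-1 by rewrite nm_rC gtr0_norm// invr_gt0.
have nc0 : 0 < nm c by rewrite nc invr_gt0.
have sw0 : sg (c *: w0) < 16^-1.
  by rewrite csnZ// nc ltr_pdivrMl// mulrC; have := csn_ge0 hs w0; lra.
have e3 : 0 < nm c * e / 4 by rewrite divr_gt0// mulr_gt0.
have [K KP] := half_cvg (4 * M) e3; have {}KP := KP K (leqnn _).
pose P (yw : X * X) := \sum_(n < K) polar b n yw.1 (c *: yw.2).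
have cP : {for (0, w0), continuous P}.
  have : IC 0 setT P.
    apply: IC_sum; first exact: openT.
    move=> n _; apply: (@IC_comp _ _ 0 _ _ _ setT setT (fun yw : X * X => (yw.1, c *: yw.2))
      (fun yw => polar b n yw.1 yw.2)) => //; try exact: openT.
      apply: IC_pair; first by apply: IC_lin; [exact: lin_fst|exact: cont_fst].
      apply: IC_scale; first exact: openT.
      by apply: IC_lin; [exact: lin_snd|exact: cont_snd].
    by move=> yw _; exact: (polar_cont hexp).
  by apply.
have nP := (csn_contP P _).1 cP q hq _ e3.
have [A [B [nA nB AB]]] := near_pairP nP.
have h8 : 0 < 8^-1 :> R by rewrite invr_gt0.
have nA8 : nbhs (0 : X) (A `&` [set y | sg (y - 0) < 8^-1]).
  by apply: filterI; [exact: nA|exact: csn_near].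
have h16 : 0 < 16^-1 / nm c by rewrite divr_gt0 ?invr_gt0.
have nB16 : nbhs (w0 : X) (B `&` [set w | sg (w - w0) < 16^-1 / nm c]).
  by apply: filterI; [exact: nB|exact: csn_near].
have nAx : \forall x' \near x, A (x' - x) /\ sg (x' - x) < 8^-1.
  apply: (near_shift x (fun x' => A (x' - x) /\ sg (x' - x) < 8^-1)).2.
  have : nbhs (0 : X) (fun y => A (x + y - x) /\ sg (x + y - x) < 8^-1).
    by apply: filterS nA8 => y [Ay]; rewrite /= subr0 => sy; rewrite [x + y]addrC addrK.
  by [].
have nUx : nbhs (x : X) ([set x' | A (x' - x) /\ sg (x' - x) < 8^-1] `&` U).
  by apply: filterI; [exact: nAx|exact: open_near].
apply: filterS (near_pair nUx nB16) => -[x' w] [/= [[Ax' sx'] Ux'] [Bw sw]].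
rewrite -(ltr_pM2l nc0) -csnZ// scalerBr -!dfZ//.
have ex' : x + (x' - x) = x' by rewrite addrC subrK.
have swc : sg (c *: w) < 8^-1.
  have := csnD hs (c *: (w - w0)) (c *: w0); rewrite -scalerDr subrK.
  rewrite (csnZ hs c (w - w0)); move: sw; rewrite ltr_pdivlMr// mulrC.
  move: sw0; lra.
have s00 : sg 0 < 8^-1 by rewrite csn0.
have swc0 : sg (c *: w0) < 8^-1 by move: sw0; lra.
have t1 := tail (x' - x) (c *: w) sx' swc K; rewrite ex' in t1.
have t2 := tail 0 (c *: w0) s00 swc0 K; rewrite addr0 in t2.
have t3 := AB (x' - x) w Ax' Bw; rewrite /P /= in t3.
have -> : df (x', c *: w) - df (x, c *: w0) =
  (df (x', c *: w) - \sum_(n < K) polar b n (x' - x) (c *: w)) +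
  (\sum_(n < K) polar b n (x' - x) (c *: w) - \sum_(n < K) polar b n 0 (c *: w0)) -
  (df (x, c *: w0) - \sum_(n < K) polar b n 0 (c *: w0)) by lmodule H.
rewrite (le_lt_trans (csnB hq _ _))// (le_lt_trans (lerD (csnD hq _ _) (lexx _)))//.
have := mulr_gt0 nc0 e0; move: t1 t2 t3 KP; lra.
Qed.

End at_x.

Lemma df_cont x w : U x -> {for (x, w), continuous df}.
Proof.
move=> Ux; have [p [b [rho hexp]]] := expansion_ex PA Ux.
exact: df_cont_at hexp Ux w.
Qed.

Lemma df_linear x : U x -> linear (fun w => df (x, w)).
Proof.
move=> Ux; apply: (@C1_linear _ _ _ _ U f df) => //.
  by move=> x' y Ux'; exact: analytic_dirder.
by move=> w; exact: df_cont.
Qed.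

(** The n-form on pairs (y, v) whose diagonal is the derivative of p n at y along v. *)
Definition dform1 n (b : ('I_n -> X) -> H) (Y : 'I_n -> X * X) : H :=
  \sum_(i < n) b (dfwith (fun j => (Y j).1) i (Y i).2).

(** The n-form whose diagonal is the derivative of p (n+1) at y along w0: the vector w0 occupies
    position i, and the other n positions are renumbered by [unlift]. *)
Definition dform2 n (b : ('I_n.+1 -> X) -> H) (w0 : X) (Y : 'I_n -> X * X) : H :=
  \sum_(i < n.+1) b (fun j => if unlift i j is Some j' then (Y j').1 else w0).

Lemma multilinear_sum n (I : Type) (s : seq I) (b : I -> ('I_n -> X * X) -> H) :
  (forall i, multilinear (b i)) -> multilinear (fun Y => \sum_(i <- s) b i Y).
Proof.
move=> bl i Y a u v; rewrite scaler_sumr -big_split; apply: eq_bigr => j _.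
exact: (bl j i Y).
Qed.

Lemma dform1_multilinear n (b : ('I_n -> X) -> H) : multilinear b -> multilinear (dform1 b).
Proof.
move=> bl; apply: (@multilinear_sum n _ _ (fun i Y => b (dfwith (fun j => (Y j).1) i (Y i).2))) => i i0 Y a u v.
have [->|ii0] := eqVneq i0 i.
  have e (z : X * X) : dfwith (fun j => (dfwith Y i z j).1) i (dfwith Y i z i).2 =
      dfwith (fun j => (Y j).1) i z.2.
    apply/funext => j; case: dfwithP => [|j' ij']; first by rewrite !dfwithin.
    by rewrite !dfwithout.
  by rewrite !e; exact: (bl i).
have e (z : X * X) : dfwith (fun j => (dfwith Y i0 z j).1) i (dfwith Y i0 z i).2 =
    dfwith (dfwith (fun j => (Y j).1) i (Y i).2) i0 z.1.
  apply/funext => j; have [->|ji] := eqVneq j i.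
    rewrite dfwithin; have -> : dfwith Y i0 z i = Y i by rewrite dfwithout.
    by rewrite [RHS]dfwithout// [RHS]dfwithin.
  rewrite dfwithout 1?eq_sym//; have [->|ji0] := eqVneq j i0; first by rewrite !dfwithin.
  by rewrite !dfwithout// eq_sym.
by rewrite !e; exact: (bl i0).
Qed.

Lemma dform2_multilinear n (b : ('I_n.+1 -> X) -> H) w0 :
  multilinear b -> multilinear (dform2 b w0).
Proof.
move=> bl; apply: (@multilinear_sum n _ _ (fun i Y => b (fun j => if unlift i j is Some j' then (Y j').1 else w0))) => i i0 Y a u v.
have e (z : X * X) : (fun j => if unlift i j is Some j' then (dfwith Y i0 z j').1 else w0) =
    dfwith (fun j => if unlift i j is Some j' then (Y j').1 else w0) (lift i i0) z.1.
  apply/funext => j; case: unliftP => [j'|] ->.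
    have [->|ne] := eqVneq j' i0; first by rewrite !dfwithin.
    have -> : dfwith Y i0 z j' = Y j' by rewrite dfwithout// eq_sym.
    rewrite [RHS]dfwithout ?liftK//.
    by rewrite (inj_eq (@lift_inj _ i)) eq_sym.
  by rewrite dfwithout ?unlift_none// eq_sym neq_lift.
by rewrite !e; exact: (bl (lift i i0)).
Qed.

(* The degree n part of the expansion of (x, w) |-> D_w f(x) at (x0, w0) is
   (y, v) |-> D_w0 p_(n+1) (y) + D_v p_n (y). *)
Lemma analytic_df : power_series_analytic (U `*` setT) df.
Proof.
have oUT : open (U `*` [set: X]) by exact: open_prod oU openT.
split=> //.
  by apply/within_contP => // -[x w] [/= Ux _]; exact: df_cont.
move=> [x w0] [/= Ux _]; have [p [b [rho hexp]]] := expansion_ex PA Ux.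
have [pc bl pb hr xU] := hexp.
exists (fun n yv => polar b n.+1 yv.1 w0 + polar b n yv.1 yv.2).
  move=> n; split.
    have : IC 0 [set: X * X] (fun yv => polar b n.+1 yv.1 w0 + polar b n yv.1 yv.2).
      apply: IC_add; first exact: openT.
        apply: (@IC_comp _ _ 0 _ _ _ setT setT (fun yw : X * X => (yw.1, w0))
           (fun yw => polar b n.+1 yw.1 yw.2)) => //; try exact: openT.
          by apply: IC_pair; [apply: IC_lin; [exact: lin_fst|exact: cont_fst]|exact: IC_cst].
        by move=> yw _; exact: (polar_cont hexp).
      by move=> yw _; exact: (polar_cont hexp).
    by move=> h yw; exact: h.
  exists (fun Y => dform2 (b n.+1) w0 Y + dform1 (b n) Y).
    move=> i Y a u v; rewrite (dform2_multilinear w0 (bl n.+1) i Y) (dform1_multilinear (bl n) i Y).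
    by rewrite /= scalerDr addrACA.
  move=> [y v] /=; congr (_ + _); apply: eq_bigr => i _; congr (b _ _); apply/funext => j /=.
  by case: dfwithP => [|j']; [rewrite unlift_none|case: unliftP => //= ->; rewrite eqxx].
have h8 : 0 < 8^-1 :> R by rewrite invr_gt0.
have n8 := csn_near 0 hr h8.
apply: filterS (near_pair n8 (filterT : nbhs (0 : X) setT)) => -[y v] [/=]; rewrite subr0 => ry _.
apply/series_csnP => q hq e e0; have e2 : 0 < e / 2 by rewrite divr_gt0.
have Uy : U (x + y) by apply: (xU _ _).1; lra.
have [K1 K1P] := polar_sum_df hexp w0 hq ry e2.
have [K2 K2P] := polar_sum_df hexp v hq ry e2.
exists (maxn K1 K2) => K; rewrite geq_max => /andP[/leqW/K1P h1 /K2P h2].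
(* Since the term of index 0 vanishes, the shifted sum over K terms is the unshifted one over K + 1
   terms. *)
have p0 : polar b 0 y w0 = 0 by rewrite /polar big_ord0.
have -> : \sum_(i < K) (polar b i.+1 y w0 + polar b i y v) - df (x + y, w0 + v) =
  (\sum_(n < K.+1) polar b n y w0 - df (x + y, w0)) + (\sum_(n < K) polar b n y v - df (x + y, v)).
  rewrite (linD (df_linear Uy)) /=.
  have -> : \sum_(n < K.+1) polar b n y w0 = \sum_(n < K) polar b n.+1 y w0.
    by rewrite big_ord_recl p0 add0r.
  rewrite big_split /=; lmodule H.
by rewrite (le_trans (csnD hq _ _))// [e]splitr lerD.
Qed.

End derivative.

Lemma analytic_IC n X H (U : set X) (f : X -> H) : hausdorff_space H ->
  power_series_analytic U f -> IC n U f.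
Proof.
move=> hH; elim: n X U f => [|n IH] X U f PA.
  by case: PA => oU + _; move/(within_contP _ oU).
split; first by case: PA => oU + _; move/(within_contP _ oU).
exists (fun p => dirder f p.2 p.1); split; last exact: IH (analytic_df hH PA).
by move=> x y Ux; exact: (analytic_dirder PA).
Qed.
End analytic_to_smooth.

(** * Taylor expansion with Peano's remainder *)

Section peano.
Context {R : realType} {k : scalars}.
Local Notation C := (fld R k).
Context (V : tvsType C) (q : V -> R) (hq : csn q).

Lemma hasd_cont (f : C -> V) z l e : hasd q f z l -> 0 < e ->
  exists2 d : R, 0 < d & forall t, nm t < d -> q (f (z + t) - f z) <= e.
Proof.
move=> h e0; have [d d0 dP] := h 1 ltr01.
have c0 : 0 < q l + 1 by rewrite ltr_wpDl ?csn_ge0.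
exists (Num.min d (e / (q l + 1))); first by rewrite lt_min d0 divr_gt0.
move=> t; rewrite lt_min => /andP[td te].
rewrite -[X in q X](subrK (t *: l)) (le_trans (csnD hq _ _))//.
have h1 := dP t td; rewrite mul1r in h1.
rewrite csnZ//; move: te; rewrite ltr_pdivlMr//; move: h1; lra.
Qed.

Lemma hasd_mulz (f : C -> V) z l : hasd q f z l ->
  hasd q (fun z => z *: f z) z (f z + z *: l).
Proof.
move=> h e e0; have e2 : 0 < e / 2 by rewrite divr_gt0.
have [d d0 dP] := hasd_cont h e2.
have z1 : 0 < nm z + 1 by rewrite ltr_wpDl ?nm_ge0.
have [d' d'0 dP'] := h _ (divr_gt0 e2 z1).
exists (Num.min d d'); first by rewrite lt_min d0.
move=> t; rewrite lt_min => /andP[td td'].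
have -> : (z + t) *: f (z + t) - z *: f z - t *: (f z + z *: l) =
  z *: (f (z + t) - f z - t *: l) + t *: (f (z + t) - f z) by lmodule V.
rewrite (le_trans (csnD hq _ _))// !csnZ// [e]splitr mulrDl lerD//; last first.
  by rewrite mulrC ler_wpM2r ?nm_ge0// dP.
rewrite (le_trans (ler_wpM2l (nm_ge0 _) (dP' t td')))// mulrCA.
by rewrite ler_div1D ?nm_ge0 ?ltW.
Qed.

Lemma hasd_monomial n (v : V) z : hasd q (fun z => z ^+ n.+1 *: v) z ((n.+1%:R * z ^+ n) *: v).
Proof.
elim: n => [|n IH].
  rewrite (_ : (fun z => _) = fun z => z *: v); last by apply/funext => y; rewrite expr1.
  have := hasd_mulz (hasd_cst hq v z); rewrite scaler0 addr0 expr0 mulr1.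
  by rewrite scale1r.
rewrite (_ : (fun z => _) = fun z => z *: (z ^+ n.+1 *: v)); last first.
  by apply/funext => y; rewrite scalerA -exprS.
have -> : (n.+2%:R * z ^+ n.+1) *: v = z ^+ n.+1 *: v + z *: ((n.+1%:R * z ^+ n) *: v).
  by rewrite -[n.+2%:R]natr1 exprS; lmodule V.
exact: hasd_mulz IH.
Qed.

(** The remainder of order m + 1 vanishes at 0, and its derivative is the remainder of order m of
    the shifted family; the mean value inequality gains a factor |w|. *)
Lemma peano_expansion (G : nat -> C -> V) : (exists2 r : R, 0 < r &
    forall z i, nm z < r -> hasd q (G i) z (G i.+1 z)) ->
  forall m e, 0 < e -> exists2 d : R, 0 < d & forall w, nm w < d ->
    q (G 0%N w - \sum_(i < m.+1) w ^+ i *: ((i`!%:R : C)^-1 *: G i 0)) <= e * nm w ^+ m.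
Proof.
move=> hG m; elim: m G hG => [|m IH] G [r r0 hG] e e0.
  have h0 := hG 0 0%N; rewrite nm0 in h0; have [d d0 dP] := hasd_cont (h0 r0) e0.
  exists d => // w /dP; rewrite add0r big_ord_recl big_ord0 expr0 !scale1r addr0 mulr1.
  by rewrite fact0 invr1 scale1r.
have [|d d0 dP] := IH (fun i => G i.+1) _ e e0.
  by exists r => // z i zr; exact: hG.
have fn0 i : (i`!%:R : C) != 0 by rewrite pnatr_eq0 -lt0n fact_gt0.
pose phi w := G 0%N w - \sum_(i < m.+2) w ^+ i *: ((i`!%:R : C)^-1 *: G i 0).
pose phi' w := G 1%N w - \sum_(i < m.+1) w ^+ i *: ((i`!%:R : C)^-1 *: G i.+1 0).
exists (Num.min d r); first by rewrite lt_min d0.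
move=> w; rewrite lt_min => /andP[wd wr].
have phi0 : phi 0 = 0.
  rewrite /phi big_ord_recl big1 ?addr0; last first.
    by move=> i _; rewrite exprS mul0r scale0r.
  by rewrite expr0 fact0 invr1 !scale1r subrr.
have dphi z : nm z < r -> hasd q phi z (phi' z).
  move=> zr; rewrite /phi /phi'.
  rewrite (_ : (fun w => _) = fun w => G 0%N w +
     (- (G 0%N 0) + \sum_(i < m.+1) (- 1) *: (w ^+ i.+1 *: ((i.+1`!%:R : C)^-1 *: G i.+1 0)))); last first.
    apply/funext => u; rewrite big_ord_recl expr0 fact0 invr1 !scale1r opprD.
    congr (_ + (_ + _)); rewrite -sumrN; apply: eq_bigr => i _; by rewrite scaleN1r.
  apply: (hasdD hq (hG z 0%N zr)).
  rewrite -[X in hasd _ _ _ X]add0r; apply: (hasdD hq (hasd_cst hq _ _)).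
  rewrite -sumrN; apply: (hasd_sum hq) => i; rewrite -[X in hasd _ _ _ X]scaleN1r.
  apply: (hasdZ hq).
  have -> : z ^+ i *: ((i`!%:R : C)^-1 *: G i.+1 0) =
     (i.+1%:R * z ^+ i) *: ((i.+1`!%:R : C)^-1 *: G i.+1 0).
    rewrite !scalerA; congr (_ *: _); rewrite factS natrM invfM.
    by rewrite [i.+1%:R * _]mulrC -[RHS]mulrA mulVKf ?pnatr_eq0.
  exact: hasd_monomial.
have := @mvt_curve R k V q phi phi' 0 w 0 (e * nm w ^+ m) hq.
rewrite phi0 !subr0 scaler0 subr0 exprS => h.
rewrite (le_trans (h _ _))//.
- move=> s /andP[s0 s1]; rewrite add0r; apply: dphi.
  by rewrite nmM nm_rC ger0_norm// (le_lt_trans _ wr)// ler_piMl ?nm_ge0.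
- move=> s /andP[s0 s1]; rewrite add0r subr0.
  have sw : nm (rC s * w) <= nm w by rewrite nmM nm_rC ger0_norm// ler_piMl ?nm_ge0.
  rewrite (le_trans (dP _ (le_lt_trans sw wd)))// (ler_wpM2l (ltW e0))//.
  by rewrite lerXn2r ?nnegrE ?nm_ge0.
- by rewrite mulrCA.
Qed.

End peano.

(** * Complex smooth maps are analytic *)

Section smooth_to_analytic.
Context {R : realType}.
Local Notation C := (fld R ComplexScalars).
Implicit Types X H : tvsType C.

Section taylor.
Context (X H : tvsType C) (U : set X) (f : X -> H).
Hypothesis (hH : hausdorff_space H) (oU : open U) (hf : forall n, IC n U f).

Let hd n : has_dirders n U f. Proof. by case: (IC_dirders hH oU (hf n)). Qed.
Let hs n : slot_cont n U f. Proof. by case: (IC_dirders hH oU (hf n)) => _; apply. Qed.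

Lemma dirders_curve i x y : U x ->
  is_dirder (dirders f (nseq i y)) y x (dirders f (nseq i.+1 y) x).
Proof.
move=> Ux; have := dirder_ex (@hd i.+1 (nseq i y) y x _ Ux).
rewrite size_nseq => /(_ (leqnn _)).
have -> // : dirder (dirders f (nseq i y)) y = dirders f (nseq i.+1 y).
by rewrite -addn1 nseqD dirders_cat.
Qed.

(** On a complex line the iterated derivatives of f form the family required by [peano_expansion],
    which supplies the hypothesis of [taylor_disc]. *)
Lemma taylor_line q x y : csn q -> (forall z : C, disc z -> U (x + z *: y)) ->
  exists M, 0 <= M /\ forall w n, disc w -> (0 < n)%N ->
    q (\sum_(i < n) w ^+ i *: ((i`!%:R : C)^-1 *: dirders f (nseq i y) x) - f (x + w *: y))
      <= nm w ^+ n * M.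
Proof.
move=> hq xU; pose G i (z : C) := dirders f (nseq i y) (x + z *: y).
have hG z i : U (x + z *: y) -> hasd q (G i) z (G i.+1 z).
  by move=> Uz; apply: dirder_hasd => //; exact: dirders_curve.
have Ux : U x by have := xU 0 disc0; rewrite scale0r addr0.
apply: (@taylor_disc R H q (G 0%N) (G 1%N) (fun i => (i`!%:R : C)^-1 *: dirders f (nseq i y) x) hq).
- by move=> z Dz; apply: hG; exact: xU.
- move=> z Dz e e0; have := hasd_cont hq (hG z 1%N (xU z Dz)) e0.
  by case=> d d0 dP; exists d => // z' _ zd; have := dP _ zd; rewrite [z + _]addrC subrK.
- move=> m e e0.
  have [|d d0 dP] := @peano_expansion R _ H q hq G _ m e e0.
    have [r r0 rP] := near_line y (open_near oU Ux).
    by exists r => // z i /rP; exact: hG.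
  exists d => // w /dP; congr (q (_ - _) <= _); apply: eq_bigr => i _.
  by rewrite /G scale0r addr0.
Qed.

Lemma dirders_multilinear n x : U x ->
  multilinear (fun Y : 'I_n -> X => dirders f [seq Y i | i <- enum 'I_n] x).
Proof.
move=> Ux i Y a u v.
have : uniq (enum 'I_n) by exact: enum_uniq.
have : size (enum 'I_n) = n by exact: size_enum_ord.
have : i \in enum 'I_n by rewrite mem_enum.
case/splitPr => s1 s2 sz.
rewrite cat_uniq /= negb_or => /and3P[_ /andP[i1 _] /andP[i2 _]].
have e w : [seq dfwith Y i w j | j <- s1 ++ i :: s2] = map Y s1 ++ w :: map Y s2.
  rewrite map_cat /= dfwithin; congr (_ ++ _ :: _); apply/eq_in_map => j js.
    by rewrite dfwithout//; apply: contraNneq i1 => ->.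
  by rewrite dfwithout//; apply: contraNneq i2 => ->.
rewrite !e; apply: (dirders_linear hH oU (@hd n) (fun j _ => @hs j)) => //.
by rewrite size_cat /= !size_map -[leqRHS]sz size_cat.
Qed.

Lemma dirders_power_cont n x : U x -> continuous (fun y => dirders f (nseq n y) x).
Proof.
move=> Ux y; have := hs (p0 := y) (a0 := fun=> x) (s := nseq n id).
rewrite size_nseq => /(_ n erefl Ux (@cont_cst _ _ x y)) h.
apply: (cont_near _ (h _)); first by near=> y'; rewrite map_nseq.
move=> a; elim: n {h} => [//|n IH] /= [<-|/IH//].
exact: cont_id.
Unshelve. all: by end_near. Qed.

Lemma IC_analytic : power_series_analytic U f.
Proof.
split=> //; first by apply/within_contP => //; exact: IC_cont (hf 0).
move=> x Ux; pose p n y := ((n`!%:R : C)^-1 *: dirders f (nseq n y) x).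
pose b n (Y : 'I_n -> X) := (n`!%:R : C)^-1 *: dirders f [seq Y i | i <- enum 'I_n] x.
have bl n : multilinear (@b n).
  by move=> i Y a u v; rewrite /b (dirders_multilinear Ux i Y); lmodule H.
have pb n y : p n y = b n (fun=> y).
  rewrite /p /b; congr (_ *: dirders f _ x).
  by rewrite -[n in LHS]size_enum_ord; elim: (enum _) => //= _ l ->.
exists p.
  move=> n; split; last by exists (b n).
  by apply: cont_comp (@scale_contl _ _ _ _); exact: dirders_power_cont.
have pZ n z y : p n (z *: y) = z ^+ n *: p n y.
  have := @multilinearZ _ _ _ n (b n) (@bl n) z (fun=> y) (enum 'I_n) (enum_uniq _).
  rewrite size_enum_ord -pb => <-; rewrite pb; congr b; apply/funext => i.
  by rewrite /upd mem_enum.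
have [rho hr rU] := csn_nbhs ((near_shift x U).1 (open_near oU Ux)).
have h2 : 0 < 2^-1 :> R by rewrite invr_gt0.
apply: filterS (csn_near 0 hr h2) => y; rewrite subr0 => ry.
apply/series_csnP => q hq e e0.
(* The point x + y is the value at w = 1/2 on the line through 2 y, where the remainder M |w|^K
   tends to 0. *)
have [|M [M0 hM]] := @taylor_line q x (2 *: y) hq.
  move=> z Dz; apply: rU; rewrite !csnZ// -(rC_nat 2) nm_rC gtr0_norm//.
  have : nm z * (2 * rho y) <= 2 * rho y by rewrite ler_piMl ?mulr_ge0 ?csn_ge0.
  move: ry; lra.
have [K0 K0P] := half_cvg M e0; exists K0.+1 => K KK.
pose w : C := rC 2^-1.
have nw : nm w = 2^-1 by rewrite nm_rC gtr0_norm.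
have Dw : disc w by rewrite /disc /= nw invf_le1// ler1n.
have w2 : w * 2 = 1 by rewrite -(rC_nat 2) -rCM mulVf// rC1.
have := hM w K Dw (leq_trans (ltn0Sn _) KK).
rewrite scalerA w2 scale1r nw.
have -> : \sum_(i < K) w ^+ i *: ((i`!%:R : C)^-1 *: dirders f (nseq i (2 *: y)) x) =
    \sum_(i < K) p i y.
  by apply: eq_bigr => i _; rewrite -/(p i (2 *: y)) pZ scalerA -exprMn w2 expr1n scale1r.
by move=> /le_trans; apply; rewrite mulrC K0P// ltnW.
Qed.

(** Identity theorem on a disc: zeros along a real interval force all derivatives at the centre to
    vanish, the Taylor series settles the open disc, and continuity its boundary. *)
Lemma analytic_disc_zero x y : (forall z : C, disc z -> U (x + z *: y)) ->
  (exists2 d : R, 0 < d & forall t : R, `|t| < d -> f (x + rC t *: y) = 0) ->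
  forall z, disc z -> f (x + z *: y) = 0.
Proof.
move=> xU [d d0 dP].
have Ux : U x by have := xU 0 disc0; rewrite scale0r addr0.
have [d1 d10 d1P] := near_line y (open_near oU Ux).
pose d2 := Num.min d d1; have d20 : 0 < d2 by rewrite lt_min d0.
(* A complex derivative that exists can be computed with real increments, so every derivative
   vanishes along the same interval. *)
have hz i (t : R) : `|t| < d2 -> dirders f (nseq i y) (x + rC t *: y) = 0.
  elim: i t => [|i IH] t td; first by apply: dP; move: td; rewrite lt_min => /andP[].
  have Ut : U (x + rC t *: y).
    by apply: d1P; rewrite nm_rC; move: td; rewrite lt_min => /andP[].
  apply: csn_sep hH _ => q hq; rewrite subr0.
  have /dirderP/(_ q hq) h := dirders_curve (i := i) (y := y) Ut.
  apply/eqP; rewrite eq_le csn_ge0// andbT; apply/ler_addgt0Pr => e e0; rewrite add0r.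
  have [r r0 rP] := h e e0.
  pose s := Num.min (r / 2) ((d2 - `|t|) / 2).
  have s0 : 0 < s by rewrite lt_min !divr_gt0// subr_gt0.
  have sr : s < r by rewrite gt_min ltr_pdivrMr// mulr_natr mulr2n ltrDl r0.
  have st : `|t + s| < d2.
    rewrite (le_lt_trans (ler_normD _ _))// (gtr0_norm s0).
    have : s <= (d2 - `|t|) / 2 by rewrite ge_min lexx orbT.
    move: td; lra.
  have := rP (rC s); rewrite nm_rC gtr0_norm// => /(_ sr).
  have -> : x + rC t *: y + rC s *: y = x + rC (t + s) *: y by rewrite rCD; lmodule X.
  rewrite !IH// subrr sub0r csnN// csnZ// nm_rC gtr0_norm// mulrC ler_pM2r//.
have hz0 i : dirders f (nseq i y) x = 0.
  by have := hz i 0; rewrite normr0 rC0 scale0r addr0; apply.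
have inner z : nm z < 1 -> f (x + z *: y) = 0.
  move=> z1; apply: csn_sep hH _ => q hq; rewrite subr0.
  have [M [M0 hM]] := taylor_line hq xU.
  apply/eqP; rewrite eq_le csn_ge0// andbT; apply/ler_addgt0Pr => e e0; rewrite add0r.
  have M1 : 0 < M + 1 by rewrite ltr_wpDl.
  have zn : `|nm z| < 1 by rewrite ger0_norm ?nm_ge0.
  have /cvgrPdist_lt/(_ _ (divr_gt0 e0 M1))[N0 _ h] := cvg_expr zn.
  have {}h := h N0.+1 (leqnSn _); rewrite /= sub0r normrN ger0_norm ?exprn_ge0 ?nm_ge0// in h.
  have := hM z N0.+1 (ltW z1) isT; rewrite big1 ?sub0r ?csnN//; last first.
    by move=> i _; rewrite hz0 !scaler0.
  move=> /le_trans; apply; move: h; rewrite ltr_pdivlMr//.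
  have : 0 <= nm z ^+ N0.+1 by rewrite exprn_ge0 ?nm_ge0.
  lra.
move=> z Dz; apply: csn_sep hH _ => q hq; rewrite subr0.
apply/eqP; rewrite eq_le csn_ge0// andbT; apply/ler_addgt0Pr => e e0; rewrite add0r.
(* A boundary point z is approached radially by (1 - s) z. *)
have cz := (csn_contP f _).1 (IC_cont (hf 0) (xU z Dz)) q hq e e0.
have [r r0 rP] := near_line (- (z *: y)) cz.
pose s := Num.min (r / 2) 2^-1.
have s0 : 0 < s by rewrite lt_min divr_gt0//= invr_gt0.
have sr : s < r by rewrite gt_min ltr_pdivrMr// mulr_natr mulr2n ltrDl r0.
have s1 : s <= 2^-1 by rewrite ge_min lexx orbT.
have := rP (rC s); rewrite nm_rC gtr0_norm// => /(_ sr).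
have -> : x + z *: y + rC s *: - (z *: y) = x + (rC (1 - s) * z) *: y.
  by rewrite rCB rC1; lmodule X.
rewrite inner; first by rewrite sub0r csnN// => /ltW.
rewrite nmM nm_rC ger0_norm ?subr_ge0; last by rewrite (le_trans s1)// invf_le1// ler1n.
have : (1 - s) * nm z <= (1 - s) * 1.
  by rewrite ler_wpM2l// subr_ge0 (le_trans s1)// invf_le1// ler1n.
by rewrite mulr1 => /le_lt_trans; apply; rewrite ltrBlDr ltrDl.
Qed.

End taylor.
End smooth_to_analytic.

(** * Real analytic maps *)

Section products.

Lemma hausdorff_prod (A B : topologicalType) : hausdorff_space A -> hausdorff_space B ->
  hausdorff_space (A * B)%type.
Proof.
move=> hA hB [a b] [a' b'] h; congr (_, _).
  apply: hA => P Q nP nQ.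
  have [[x y] [[/= Px _] [/= Qx _]]] := h _ _ (near_pair nP (filterT : nbhs b setT))
     (near_pair nQ (filterT : nbhs b' setT)).
  by exists x.
apply: hB => P Q nP nQ.
have [[x y] [[/= _ Px] [/= _ Qx]]] := h _ _ (near_pair (filterT : nbhs a setT) nP)
   (near_pair (filterT : nbhs a' setT) nQ).
by exists y.
Qed.

End products.

Section complexification.
Context {R : realType}.
Implicit Types X Y H F : tvsType (fld R RealScalars).

Definition cplx X : tvsType (fld R ComplexScalars) := cplxfication X.

Definition re_emb X (x : X) : cplx X := (x, 0).

Lemma cplx_scaleE X (a b : R) (x y : X) :
  ((a +i* b)%C : fld R ComplexScalars) *: ((x, y) : cplx X) =
  ((a : fld R RealScalars) *: x - (b : fld R RealScalars) *: y,
   (a : fld R RealScalars) *: y + (b : fld R RealScalars) *: x) :> cplx X.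
Proof. by []. Qed.

Lemma cplx_addE X (x y x' y' : X) :
  ((x, y) : cplx X) + ((x', y') : cplx X) = (x + x', y + y') :> cplx X.
Proof. by []. Qed.

Lemma re_embD X (x y : X) : re_emb (x + y) = re_emb x + re_emb y.
Proof. by rewrite /re_emb cplx_addE addr0. Qed.

Lemma re_embZ X (t : R) (x : X) : re_emb ((t : fld R RealScalars) *: x) = rC t *: re_emb x.
Proof. by rewrite /re_emb (cplx_scaleE t 0) !scale0r subr0 scaler0 addr0. Qed.

Lemma cplx_decomp X (x y : X) : (x, y) = re_emb x + ('i%C : fld R ComplexScalars) *: re_emb y :> cplx X.
Proof. by rewrite /re_emb (cplx_scaleE 0 1) cplx_addE !scale0r !scale1r subr0 addr0 !add0r. Qed.

Lemma re_emb_cont X : continuous (@re_emb X).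
Proof. exact: (cont_pair (@cont_id _) (@cont_cst X X 0)). Qed.

Lemma cplx_hausdorff X : hausdorff_space X -> hausdorff_space (cplx X).
Proof. by move=> hX; exact: (hausdorff_prod hX hX). Qed.

Definition map_cplx X Y (l : X -> Y) : cplx X -> cplx Y := fun p => (l p.1, l p.2).

Lemma map_cplx_lin X Y (l : X -> Y) : linear l -> linear (map_cplx l).
Proof.
move=> ll [a b] [x y] [x' y'].
rewrite (cplx_scaleE a b) cplx_addE /map_cplx /= (cplx_scaleE a b) cplx_addE.
by rewrite !(linD ll) (linN ll) !(linZ ll).
Qed.

Lemma map_cplx_cont X Y (l : X -> Y) : continuous l -> continuous (map_cplx l).
Proof.
move=> cl; apply: (@cont_pair (X * X)%type Y Y (l \o fst) (l \o snd)).
  exact: cont_comp (@cont_fst _ _ X X) cl.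
exact: cont_comp (@cont_snd _ _ X X) cl.
Qed.

Lemma map_cplx_re X Y (l : X -> Y) x : linear l -> map_cplx l (re_emb x) = re_emb (l x).
Proof. by move=> ll; rewrite /map_cplx /re_emb /= (lin0 ll). Qed.

(** The complexification of a product and the product of the complexifications have the same four
    components in different order. *)
Definition cplx_split X Y (p : cplx (X * Y)%type) : (cplx X * cplx Y)%type :=
  ((p.1.1, p.2.1), (p.1.2, p.2.2)).
Definition cplx_merge X Y (p : (cplx X * cplx Y)%type) : cplx (X * Y)%type :=
  ((p.1.1, p.2.1), (p.1.2, p.2.2)).

Lemma swap_cont (A B D E : topologicalType) :
  continuous (fun p : (A * B) * (D * E) => ((p.1.1, p.2.1), (p.1.2, p.2.2))).
Proof.
have c11 : continuous (fun p : (A * B) * (D * E) => p.1.1).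
  by move=> p; apply: continuous_comp; [exact: cvg_fst|exact: cvg_fst].
have c12 : continuous (fun p : (A * B) * (D * E) => p.1.2).
  by move=> p; apply: continuous_comp; [exact: cvg_fst|exact: cvg_snd].
have c21 : continuous (fun p : (A * B) * (D * E) => p.2.1).
  by move=> p; apply: continuous_comp; [exact: cvg_snd|exact: cvg_fst].
have c22 : continuous (fun p : (A * B) * (D * E) => p.2.2).
  by move=> p; apply: continuous_comp; [exact: cvg_snd|exact: cvg_snd].
by apply: cont_pair; apply: cont_pair.
Qed.

Lemma cplx_split_cont X Y : continuous (@cplx_split X Y).
Proof. exact: (@swap_cont X Y X Y). Qed.
Lemma cplx_merge_cont X Y : continuous (@cplx_merge X Y).
Proof. exact: (@swap_cont X X Y Y). Qed.

(* Real analyticity restated through the smoothness of the extension. *)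
Definition RA X H (U : set X) (f : X -> H) := open U /\
  exists (W : set (cplx X)) (g : cplx X -> cplx H), [/\ open W, forall n, IC n W g &
    forall x, U x -> W (re_emb x) /\ g (re_emb x) = re_emb (f x)].

Lemma real_analyticP X H (U : set X) (f : X -> H) : hausdorff_space H ->
  real_analytic U f <-> RA U f.
Proof.
move=> hH; split=> -[oU [W [g]]].
  move=> [PA gf]; split=> //; exists W, g; split => //; first by case: PA.
  by move=> n; apply: (@analytic_IC R n (cplx X) (cplx H) W g (cplx_hausdorff hH) PA).
move=> [oW hg gf]; split=> //; exists W, g; split=> //.
exact: (@IC_analytic R (cplx X) (cplx H) W g (cplx_hausdorff hH) oW hg).
Qed.

Lemma open_inter (T : topologicalType) (A B : set T) : open A -> open B -> open [set x | A x /\ B x].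
Proof. exact: openI. Qed.

Lemma RA_cont X H (U : set X) (f : X -> H) : RA U f -> cont_on U f.
Proof.
move=> [oU [W [g [oW hg gf]]]] x Ux.
apply: (@cont_near _ _ (fun x => (g (re_emb x)).1)).
  by near=> y; rewrite (gf y _).2//; near: y; exact: open_near.
apply: (@continuous_comp _ (cplx H) _ (g \o @re_emb X) fst); last exact: cvg_fst.
apply: continuous_comp; first exact: re_emb_cont.
by apply: (IC_cont (hg 0%N)); case: (gf x Ux).
Unshelve. all: by end_near. Qed.

Lemma RA_sub X H (U U' : set X) (f f' : X -> H) : open U' -> U' `<=` U ->
  (forall x, U' x -> f x = f' x) -> RA U f -> RA U' f'.
Proof.
move=> oU' U'U ff' [oU [W [g [oW hg gf]]]]; split=> //; exists W, g; split=> // x Ux.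
by rewrite -ff'//; apply/gf/U'U.
Qed.

Lemma RA_comp X Y H (U : set X) (V : set Y) (f : X -> Y) (f' : Y -> H) :
  (forall x, U x -> V (f x)) -> RA U f -> RA V f' -> RA U (f' \o f).
Proof.
move=> UV [oU [W [g [oW hg gf]]]] [oV [W' [g' [oW' hg' gf']]]]; split=> //.
have oW2 : open [set p | W p /\ W' (g p)] by apply: open_preim => //; exact: (IC_cont (hg 0%N)).
exists [set p | W p /\ W' (g p)], (g' \o g); split=> //.
  move=> n; apply: (IC_comp oW2 oW' _ _ (hg' n)); first by move=> p [].
  by apply: IC_sub (hg n) => // p [].
move=> x Ux; have [Wx gx] := gf x Ux; have [Wy gy] := gf' _ (UV x Ux).
by rewrite /= gx.
Qed.

Lemma RA_pair X Y H (U : set X) (f : X -> Y) (f' : X -> H) :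
  RA U f -> RA U f' -> RA U (fun x => (f x, f' x)).
Proof.
move=> [oU [W [g [oW hg gf]]]] [_ [W' [g' [oW' hg' gf']]]]; split=> //.
have oW2 := open_inter oW oW'.
exists [set x | W x /\ W' x], (@cplx_merge Y H \o (fun p => (g p, g' p))); split=> //.
  move=> n; apply: IC_postlin => //; first exact: cplx_merge_cont.
  by apply: IC_pair; [apply: IC_sub (hg n) => // p []|apply: IC_sub (hg' n) => // p []].
move=> x Ux; have [Wx gx] := gf x Ux; have [Wy gy] := gf' _ Ux.
by rewrite /= gx gy.
Qed.

Lemma RA_lin X H (l : X -> H) : linear l -> continuous l -> RA setT l.
Proof.
move=> ll cl; split; first exact: openT.
exists setT, (map_cplx l); split; first exact: openT.
  by move=> n; apply: IC_lin; [exact: map_cplx_lin|exact: map_cplx_cont].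
by move=> x _; rewrite map_cplx_re.
Qed.

Lemma disc_i : disc ('i%C : fld R ComplexScalars).
Proof. by rewrite /disc /nm /= expr0n expr1n add0r sqrtr1. Qed.

(** For p = a + i b, both extensions equal f at the real points a + t b near t = 0. Hence they agree
    on the disc a + z b, which reaches p at z = i. *)
Lemma RA_ext_unique X H (f : X -> H) (V V' : set X) (W W' : set (cplx X))
    (g g' : cplx X -> cplx H) (p : cplx X) : hausdorff_space H ->
  open V -> open W -> (forall n, IC n W g) ->
  (forall x, V x -> W (re_emb x) /\ g (re_emb x) = re_emb (f x)) ->
  open V' -> open W' -> (forall n, IC n W' g') ->
  (forall x, V' x -> W' (re_emb x) /\ g' (re_emb x) = re_emb (f x)) ->
  V p.1 -> (forall z, disc z -> W (re_emb p.1 + z *: re_emb p.2)) ->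
  V' p.1 -> (forall z, disc z -> W' (re_emb p.1 + z *: re_emb p.2)) ->
  g p = g' p.
Proof.
move=> hH oV oW hg gf oV' oW' hg' gf' Va Wd Va' Wd'.
have oWW := open_inter oW oW'.
have hd n : IC n [set p | W p /\ W' p] (fun p => g p + (-1) *: g' p).
  apply: IC_add => //; first by apply: IC_sub (hg n) => // ? [].
  by apply: IC_scale => //; apply: IC_sub (hg' n) => // ? [].
have hW z : disc z -> [set p | W p /\ W' p] (re_emb p.1 + z *: re_emb p.2).
  by move=> Dz; split; [exact: Wd|exact: Wd'].
have h0 : exists2 r : R, 0 < r & forall t : R, `|t| < r ->
    g (re_emb p.1 + rC t *: re_emb p.2) + (-1) *: g' (re_emb p.1 + rC t *: re_emb p.2) = 0.
  have [r r0 rP] := near_line (p.2 : X) (filterI (open_near oV Va) (open_near oV' Va')).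
  exists r => // t /rP[Vt Vt']; rewrite -re_embZ -re_embD.
  by rewrite (gf _ Vt).2 (gf' _ Vt').2 scaleN1r subrr.
have := analytic_disc_zero (cplx_hausdorff hH) oWW hd hW h0 disc_i.
have e : re_emb p.1 + ('i%C : fld R ComplexScalars) *: re_emb p.2 = p.
  by rewrite -cplx_decomp; case: (p).
by rewrite e scaleN1r => /eqP; rewrite subr_eq0 => /eqP.
Qed.

(* The value at a + ib of the extension is continued from the real line along
   the disc a + zb, |z| <= 1, so it does not depend on the local extension used. *)
Lemma RA_local X H (U : set X) (f : X -> H) : hausdorff_space H -> open U ->
  (forall x, U x -> exists V, V x /\ RA V f) -> RA U f.
Proof.
move=> hH oU loc; split=> //.
pose data := (set X * (set (cplx X) * (cplx X -> cplx H)))%type.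
pose ok (d : data) := [/\ open d.1, open d.2.1, forall n, IC n d.2.1 d.2.2 &
    forall x, d.1 x -> d.2.1 (re_emb x) /\ d.2.2 (re_emb x) = re_emb (f x)].
pose good (d : data) (p : cplx X) := d.1 p.1 /\
  forall z, disc z -> d.2.1 (re_emb p.1 + z *: re_emb p.2).
have goodW d p : good d p -> d.2.1 p.
  by case=> ? hz; have := hz _ disc_i; rewrite -cplx_decomp; case: (p).
have uniq d d' p : ok d -> ok d' -> good d p -> good d' p -> d.2.2 p = d'.2.2 p.
  move=> [q1 q2 q3 q4] [q1' q2' q3' q4'] [g1 g2] [g1' g2'].
  exact: (RA_ext_unique hH q1 q2 q3 q4 q1' q2' q3' q4' g1 g2 g1' g2').
(* A whole neighbourhood of good points is required, which makes W open by construction. *)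
pose W : set (cplx X) := [set p | exists d, ok d /\ nbhs p (good d)].
pose G (p : cplx X) := xget 0 [set v | exists d, [/\ ok d, good d p & v = d.2.2 p]].
have GE d p : ok d -> good d p -> G p = d.2.2 p.
  move=> od gd; rewrite /G; case: xgetP => [v _ [d' [od' gd' ->]]|]; first exact: uniq.
  by move/(_ (d.2.2 p)); case; exists d.
exists W, G; split.
- apply/open_nearP => p [d [od nd]]; apply: filterS (nbhs_interior nd) => p' nd'.
  by exists d.
- move=> n; apply: IC_local; first exact: cplx_hausdorff.
  move=> p [d [od nd]]; exists (interior (good d)); split=> //; first exact: open_interior.
  have [_ oW hg _] := od; apply: IC_sub (hg n); first exact: open_interior.
    by move=> p' /nbhs_singleton /goodW.
  by move=> p' /nbhs_singleton gd; rewrite (GE d).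
- move=> x Ux; have [V [Vx [oV [W1 [g [oW hg gf]]]]]] := loc x Ux.
  pose d : data := (V, (W1, g)); have od : ok d by [].
  have gd : good d (re_emb x).
    by split=> //= z _; rewrite /re_emb scaler0 addr0; case: (gf x Vx).
  split; last by rewrite (GE d)//; case: (gf x Vx).
  exists d; split=> //.
  have [W1x _] := gf x Vx; have [q hq qW] := csn_nbhsx (open_near oW W1x).
  have h2 : 0 < 2^-1 :> R by rewrite invr_gt0.
  (* Half of the q-ball is for the real part and half for the imaginary part b, whose multiples z b
     with |z| <= 1 are no larger. *)
  have n1 : nbhs (re_emb x) [set p : cplx X | q (re_emb p.1 - re_emb x) < 2^-1].
    have : {for re_emb x, continuous (fun p : cplx X => re_emb p.1)}.
      apply: (@continuous_comp _ X _ (fun p : cplx X => p.1) (@re_emb X)); first exact: cvg_fst.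
      exact: re_emb_cont.
    by move=> /csn_contP/(_ q hq _ h2).
  have n2 : nbhs (re_emb x) [set p : cplx X | q (re_emb p.2) < 2^-1].
    have : {for re_emb x, continuous (fun p : cplx X => re_emb p.2)}.
      apply: (@continuous_comp _ X _ (fun p : cplx X => p.2) (@re_emb X)); first exact: cvg_snd.
      exact: re_emb_cont.
    move=> /csn_contP/(_ q hq _ h2); apply: filterS => p /=.
    by rewrite [re_emb 0](_ : _ = 0)// subr0.
  have n3 : nbhs (re_emb x) [set p : cplx X | V p.1].
    by apply: (@cvg_fst _ _ (nbhs x) (nbhs (0 : X))); exact: open_near.
  apply: filterS (filterI (filterI n1 n2) n3) => p [[/= h3 h4] Vp]; split=> // z Dz.
  apply: qW; rewrite addrAC (le_lt_trans (csnD hq _ _))// [ltRHS]splitr div1r.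
  rewrite ltr_leD// csnZ// (le_trans _ (ltW h4))// ler_piMl ?csn_ge0//.
Qed.

Lemma dirder_real_unique (k : scalars) (X H : tvsType (fld R k)) (f : X -> H) y x l l' :
  hausdorff_space H -> is_dirder f y x l ->
  (exists2 d : R, 0 < d & forall t : R, `|t| < d -> f (x + rC t *: y) - f x = rC t *: l') ->
  l = l'.
Proof.
move=> hH /dirderP h [d d0 dP]; apply: csn_sep hH _ => q hq.
apply/eqP; rewrite eq_le csn_ge0// andbT; apply/ler_addgt0Pr => e e0; rewrite add0r.
have [r r0 rP] := h q hq e e0.
pose s := Num.min r d / 2.
have m0 : 0 < Num.min r d by rewrite lt_min r0.
have s0 : 0 < s by rewrite divr_gt0.
have : s < Num.min r d by rewrite ltr_pdivrMr// mulr_natr mulr2n ltrDl.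
rewrite lt_min => /andP[sr sd].
have := rP (rC s); rewrite nm_rC gtr0_norm// => /(_ sr).
rewrite dP ?gtr0_norm// -scalerBr csnZ// nm_rC gtr0_norm// csn_sym// mulrC ler_pM2r//.
Qed.

Lemma tvs_complete_prod (V : tvsType (fld R RealScalars)) : tvs_complete V -> tvs_complete (cplx V).
Proof.
move=> cV F PF cF.
have c1 : exists x : V, ((fun p : cplx V => fst p) @ F) --> x.
  apply: cV => O nO.
  have [A FA AO] := cF _ (near_pair nO (filterT : nbhs (0 : V) setT)).
  exists [set x : V | exists2 p : cplx V, A p & fst p = x]; first by apply: (@filterS _ F _ A) FA => p Ap; exists p.
  by move=> _ _ [p Ap <-] [p' Ap' <-]; have [] := AO p p' Ap Ap'.
have c2 : exists x : V, ((fun p : cplx V => snd p) @ F) --> x.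
  apply: cV => O nO.
  have [A FA AO] := cF _ (near_pair (filterT : nbhs (0 : V) setT) nO).
  exists [set x : V | exists2 p : cplx V, A p & snd p = x]; first by apply: (@filterS _ F _ A) FA => p Ap; exists p.
  by move=> _ _ [p Ap <-] [p' Ap' <-]; have [] := AO p p' Ap Ap'.
have [x hx] := c1; have [y hy] := c2; exists ((x, y) : cplx V).
move=> P /near_pairP[A [B [nA nB AB]]].
have FA : F [set p : cplx V | A p.1] := hx A nA.
have FB : F [set p : cplx V | B p.2] := hy B nB.
apply: (@filterS _ F _ _ P _ (filterI FA FB)) => -[a b] [Aa Bb].
exact: AB.
Qed.

(** A complex seminorm on F_C is not assembled from real ones on the two components, so domination
    is obtained for unit balls and transferred by [homog_le]. *)
Lemma dense_emb_cplx F (Ft : tvsType (fld R RealScalars)) (j : F -> Ft) : dense_emb j -> dense_emb (map_cplx j).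
Proof.
move=> [lj cj dj domj]; split; [exact: map_cplx_lin|exact: map_cplx_cont| |].
  apply/seteqP; split=> // -[v w] _ N /near_pairP[A [B [nA nB AB]]].
  have [v1 h1] := dense_near dj nA; have [w1 h2] := dense_near dj nB.
  by exists (j v1, j w1); split; [exists (v1, w1)|exact: AB].
move=> p hp; have [_ _ /(_ _ ltr01) n0] := hp.
have [A [B [nA nB AB]]] := near_pairP n0.
have [q hq qA] := @csn_nbhs R RealScalars F _ (filterI nA nB).
have [q' hq' qq'] := domj q hq.
have nq : nbhs (0 : Ft) [set v | q' v < 1] by have [_ _ /(_ _ ltr01)] := hq'.
have [p' hp' pP] := @csn_nbhs R ComplexScalars (cplx Ft) _ (near_pair nq nq).
exists p' => // v.
have hpj : csn (p' \o map_cplx j).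
  by apply: csn_comp hp'; [exact: map_cplx_lin|exact: map_cplx_cont].
apply: (homog_le (p := p' \o map_cplx j)) => [y|a y|a y|]; rewrite ?csn_ge0 ?csnZ//.
move=> [y z] /pP[/= h1 h2]; apply: AB.
  by have [] := qA y (le_lt_trans (qq' y) h1).
by have [] := qA z (le_lt_trans (qq' z) h2).
Qed.

(* The fibrewise linear extension h of f to the complexification is a derivative
   of any local extension g at v = 0, which makes it globally defined in v. *)
Lemma RA_fibrewise_ext (X F Ft Z : tvsType (fld R RealScalars)) (j : F -> Ft) (U : set X)
    (f : X * F -> Z) (ft : X * Ft -> Z) :
  dense_emb j -> hausdorff_space Z -> tvs_complete Z -> open U ->
  (forall x, U x -> linear (fun v => f (x, v))) ->
  (forall x, U x -> continuous (fun v => ft (x, v))) ->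
  (forall x v, U x -> ft (x, j v) = f (x, v)) ->
  RA (U `*` setT) f -> RA (U `*` setT) ft.
Proof.
move=> je hZ cZ oU lf cft ftj [_ [W [g [oW hg gf]]]].
have [lj cj dj domj] := je.
split; first exact: open_prod oU openT.
have hZC := cplx_hausdorff hZ; have cZC := tvs_complete_prod cZ.
have jeC := dense_emb_cplx je.
pose W' : set (cplx X * cplx F) := [set p | setT p /\ W (cplx_merge p)].
have oW' : open W'.
  by apply: open_preim => //; [exact: openT|move=> p _; exact: cplx_merge_cont].
pose g' : cplx X * cplx F -> cplx Z := g \o @cplx_merge X F.
have hg' n : IC n W' g'.
  by apply: IC_prelin (hg n) => // [p []|] //; exact: cplx_merge_cont.
pose W0 : set (cplx X) := [set x | setT x /\ W' (x, 0)].
have oW0 : open W0.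
  apply: open_preim => //; first exact: openT.
  by move=> x _; apply: (cont_pair (@cont_id _) (@cont_cst _ _ 0)).
pose h (p : cplx X * cplx F) : cplx Z := dirder g' (0, p.2) (p.1, 0).
(* The derivative obtained from the class of g' depends on n; [h] is defined by [dirder] so that one
   map serves all n. *)
have hdg n : exists dg, (forall p y, W' p -> is_dirder g' y p (dg (p, y))) /\ IC n (W' `*` setT) dg.
  by have [_ [dg]] := hg' n.+1; exists dg.
have hE n dg x v : (forall p y, W' p -> is_dirder g' y p (dg (p, y))) /\ IC n (W' `*` setT) dg ->
    W0 x -> h (x, v) = dg ((x, 0), (0, v)).
  by move=> [dgP _] [_ Wx]; apply: dirderE => //; exact: dgP.
have oW0T : open (W0 `*` [set: cplx F]) by exact: open_prod oW0 openT.
have hh n : IC n (W0 `*` setT) h.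
  have [dg hdg'] := hdg n; have [_ dgn] := hdg'.
  apply: (@IC_eq _ _ _ _ _ _ (dg \o (fun p : cplx X * cplx F => ((p.1, 0 : cplx F), (0 : cplx X, p.2))))) => //.
    by move=> [x v] [/= W0x _]; rewrite (hE n dg).
  apply: (@IC_prelin _ _ n _ _ _ _ (W' `*` setT)) dgn => //.
  - exact: open_prod oW' openT.
  - by move=> [x v] [/= [_ Wx] _].
  - by move=> a [x v] [x' v']; congr ((_, _), (_, _)); rewrite /= scaler0 addr0.
  - apply: cont_pair; apply: cont_pair; try exact: cont_cst; [exact: cont_fst|exact: cont_snd].
have lh x : W0 x -> linear (fun v => h (x, v)).
  move=> W0x; have [dg hdg'] := hdg 0%N; have [dgP dgn] := hdg'.
  have lin := @C1_linear R _ _ _ W' g' dg dgP oW' (x, 0) hZC W0x.2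
    (fun w => dgn ((x, 0), w) (conj W0x.2 I)).
  move=> a u v; rewrite !(hE 0%N dg)//.
  have -> : (0, a *: u + v) = a *: (0, u) + (0, v) :> cplx X * cplx F.
    by congr (_, _); rewrite /= scaler0 addr0.
  exact: lin.
have W0re x : U x -> W0 (re_emb x).
  move=> Ux; split=> //; split=> //.
  have [+ _] := gf (x, 0) (conj Ux I).
  by [].
(* Over a real x and along a real v, g' is the real linear map f (x, _), so its difference quotients
   at 0 with real t are constant. *)
have hre x v : U x -> h (re_emb x, re_emb v) = re_emb (f (x, v)).
  move=> Ux; have [dg hdg'] := hdg 0%N; rewrite (hE 0%N dg)//; last exact: W0re.
  have [dgP _] := hdg'.
  apply: (dirder_real_unique hZC (dgP (re_emb x, 0) (0, re_emb v) (W0re x Ux).2)).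
  exists 1 => // t _.
  have e (w : F) : g' (re_emb x, re_emb w) = re_emb (f (x, w)).
    have [_ <-] := gf (x, w) (conj Ux I); by [].
  have -> : (re_emb x, 0) + rC t *: (0, re_emb v) = (re_emb x, re_emb ((t : fld R RealScalars) *: v)) :> cplx X * cplx F.
    by congr (_, _); rewrite /= ?scaler0 ?addr0// add0r re_embZ.
  rewrite e (_ : 0 = re_emb 0 :> cplx F)// e (linZ (lf x Ux)) (lin0 (lf x Ux)).
  by rewrite re_embZ [re_emb 0](_ : _ = 0)// subr0.
have [ht htP] := fibrewise_ext_ex jeC hZC cZC oW0 lh (IC_cont (hh 0%N)).
have hht n : IC n (W0 `*` setT) ht.
  by apply: (IC_fibrewise_ext jeC hZC cZC oW0 lh _ _ _ (hh n)) => x => [/htP[]|/htP[]|v /htP[]].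
have oW0Tt : open (W0 `*` [set: cplx Ft]) by exact: open_prod oW0 openT.
pose Wt : set (cplx (X * Ft)%type) := [set p | setT p /\ (W0 `*` [set: cplx Ft]) (cplx_split p)].
have oWt : open Wt.
  by apply: open_preim => //; [exact: openT|move=> p _; exact: cplx_split_cont].
exists Wt, (ht \o @cplx_split X Ft); split=> //.
  by move=> n; apply: IC_prelin (hht n) => // [p []|] //; exact: cplx_split_cont.
move=> [x v] [/= Ux _]; split; first by split=> //; split=> //=; exact: W0re.
have [lht cht htj] := htP _ (W0re x Ux).
have := @dense_eq R _ F Ft (cplx Z) j (fun v => ht (re_emb x, re_emb v)) (fun v => re_emb (ft (x, v))) dj hZC.
move=> /(_ _ _ _)/(congr1 (@^~ v)); apply.
- exact: cont_comp (@re_emb_cont Ft) cht.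
- exact: cont_comp (cft x Ux) (@re_emb_cont Z).
- by move=> w; rewrite -(map_cplx_re _ lj) htj hre// ftj.
Qed.

End complexification.

(** * The classes C^r *)

Section smoothness_classes.
Context {R : realType}.

Definition finite_order (r : smoothness) (n : nat) : bool :=
  if r is Fin m then (n <= m)%N else true.

(** Except for real analyticity, every class is a family of conditions [IC n]; each closure property
    below therefore has one proof through [IC] and one through [RA]. *)
Lemma Cr_IC k r (X H : tvsType (fld R k)) (U : set X) (f : X -> H) :
  k = ComplexScalars \/ r <> Omega -> hausdorff_space H ->
  Cr r U f <-> open U /\ forall n, finite_order r n -> IC n U f.
Proof.
case: r => [m||] kr hH; [exact: (@Keller_CrP _ _ (Fin m))|exact: (@Keller_CrP _ _ Infty)|].
case: kr => // ek; move: X H U f hH; rewrite ek => X H U f hH.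
split=> [PA|[oU hf]]; last by apply: IC_analytic => // n; exact: hf.
by split=> [|n _]; [case: PA|exact: analytic_IC].
Qed.

Lemma Cr_RA (X H : tvsType (fld R RealScalars)) (U : set X) (f : X -> H) :
  hausdorff_space H -> Cr Omega U f <-> RA U f.
Proof. exact: real_analyticP. Qed.

Lemma real_analytic_or k r : (k = ComplexScalars \/ r <> Omega) \/ (k = RealScalars /\ r = Omega).
Proof. by case: k r => [] [m||]; try (left; right; discriminate); [right|left; left]. Qed.

Lemma Cr_open k r (X H : tvsType (fld R k)) (U : set X) (f : X -> H) : Cr r U f -> open U.
Proof. by case: r => [m||]; [case|case|case: k X H U f => X H U f []]. Qed.

Lemma Cr_cont k r (X H : tvsType (fld R k)) (U : set X) (f : X -> H) :
  hausdorff_space H -> Cr r U f -> cont_on U f.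
Proof.
have [hkr|[ek er]] := real_analytic_or k r.
  by move=> hH /(Cr_IC _ _ hkr hH)[_ h]; apply: (IC_cont (h 0%N _)); case: r {hkr h}.
move: X H U f; rewrite ek er => X H U f hH /(Cr_RA _ _ hH); exact: RA_cont.
Qed.

Lemma Cr_sub k r (X H : tvsType (fld R k)) (U U' : set X) (f f' : X -> H) :
  hausdorff_space H -> open U' -> U' `<=` U -> (forall x, U' x -> f x = f' x) ->
  Cr r U f -> Cr r U' f'.
Proof.
have [hkr|[ek er]] := real_analytic_or k r.
  move=> hH oU' U'U ff' /(Cr_IC _ _ hkr hH)[_ h]; apply/(Cr_IC _ _ hkr hH); split=> // n /h.
  exact: IC_sub.
move: X H U U' f f'; rewrite ek er => X H U U' f f' hH oU' U'U ff' /(Cr_RA _ _ hH) h.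
by apply/(Cr_RA _ _ hH); exact: RA_sub h.
Qed.

Lemma Cr_eq k r (X H : tvsType (fld R k)) (U : set X) (f f' : X -> H) :
  hausdorff_space H -> (forall x, U x -> f x = f' x) -> Cr r U f -> Cr r U f'.
Proof. by move=> hH e h; apply: (Cr_sub hH (Cr_open h) _ e h). Qed.

Lemma Cr_local k r (X H : tvsType (fld R k)) (U : set X) (f : X -> H) :
  hausdorff_space H -> (forall x, U x -> exists V, V x /\ Cr r (U `&` V) f) -> Cr r U f.
Proof.
move=> hH loc.
have oU : open U.
  apply/open_nearP => x Ux; have [V [Vx /Cr_open oV]] := loc x Ux.
  by have := open_near oV (conj Ux Vx); apply: filterS => y [].
move: X H U f hH loc oU; have [hkr|[-> ->]] := real_analytic_or k r => X H U f hH loc oU.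
  apply/(Cr_IC _ _ hkr hH); split=> // n hn; apply: IC_local => // x Ux.
  have [V [Vx hV]] := loc x Ux; exists (U `&` V); split=> //; first exact: Cr_open hV.
  by move/(Cr_IC _ _ hkr hH) : hV => [_ /(_ n hn)].
apply/(Cr_RA _ _ hH); apply: RA_local => // x Ux; have [V [Vx hV]] := loc x Ux.
by exists (U `&` V); split=> //; apply/(Cr_RA _ _ hH).
Qed.

Lemma Cr_comp k r (X Y H : tvsType (fld R k)) (U : set X) (V : set Y) (f : X -> Y) (g : Y -> H) :
  hausdorff_space Y -> hausdorff_space H -> (forall x, U x -> V (f x)) ->
  Cr r U f -> Cr r V g -> Cr r U (g \o f).
Proof.
move: X Y H U V f g; have [hkr|[-> ->]] := real_analytic_or k r => X Y H U V f g hY hH UV.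
  move=> /(Cr_IC _ _ hkr hY)[oU hf] /(Cr_IC _ _ hkr hH)[oV hg].
  apply/(Cr_IC _ _ hkr hH); split=> // n hn.
  exact: (IC_comp oU oV UV (hf n hn) (hg n hn)).
by move=> /(Cr_RA _ _ hY) hf /(Cr_RA _ _ hH) hg; apply/(Cr_RA _ _ hH); exact: RA_comp UV hf hg.
Qed.

Lemma Cr_pair k r (X Y H : tvsType (fld R k)) (U : set X) (f : X -> Y) (g : X -> H) :
  hausdorff_space Y -> hausdorff_space H ->
  Cr r U f -> Cr r U g -> Cr r U (fun x => (f x, g x)).
Proof.
move=> hY hH; have hYH := hausdorff_prod hY hH.
move: X Y H U f g hY hH hYH; have [hkr|[-> ->]] := real_analytic_or k r => X Y H U f g hY hH hYH.
  move=> /(Cr_IC _ _ hkr hY)[oU hf] /(Cr_IC _ _ hkr hH)[_ hg].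
  apply/(Cr_IC _ _ hkr hYH); split=> // n hn.
  by apply: IC_pair; [exact: hf|exact: hg].
by move=> /(Cr_RA _ _ hY) hf /(Cr_RA _ _ hH) hg; apply/(Cr_RA _ _ hYH); exact: RA_pair.
Qed.

Lemma Cr_lin k r (X H : tvsType (fld R k)) (U : set X) (l : X -> H) :
  hausdorff_space H -> open U -> linear l -> continuous l -> Cr r U l.
Proof.
move=> hH oU ll cl; apply: (@Cr_sub k r X H setT U l l) => //.
move: X H U l hH oU ll cl; have [hkr|[-> ->]] := real_analytic_or k r => X H U l hH oU ll cl.
  by apply/(Cr_IC _ _ hkr hH); split=> [|n hn]; [exact: openT|exact: IC_lin].
by apply/(Cr_RA _ _ hH); exact: RA_lin.
Qed.

Lemma Cr_fibrewise_ext k r (X F Ft Z : tvsType (fld R k)) (j : F -> Ft) (U : set X)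
    (f : X * F -> Z) (ft : X * Ft -> Z) :
  dense_emb j -> hausdorff_space Z -> tvs_complete Z -> open U ->
  (forall x, U x -> linear (fun v => f (x, v))) ->
  (forall x, U x -> linear (fun v => ft (x, v))) ->
  (forall x, U x -> continuous (fun v => ft (x, v))) ->
  (forall x v, U x -> ft (x, j v) = f (x, v)) ->
  Cr r (U `*` setT) f -> Cr r (U `*` setT) ft.
Proof.
move: X F Ft Z j U f ft; have [hkr|[-> ->]] := real_analytic_or k r.
  move=> X F Ft Z j U f ft je hZ cZ oU lf lft cft ftj /(Cr_IC _ _ hkr hZ)[_ hf].
  apply/(Cr_IC _ _ hkr hZ); split=> [|n hn]; first exact: open_prod oU openT.
  exact: (IC_fibrewise_ext je hZ cZ oU lf lft cft ftj (hf n hn)).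
move=> X F Ft Z j U f ft je hZ cZ oU lf lft cft ftj /(Cr_RA _ _ hZ) hf.
by apply/(Cr_RA _ _ hZ); exact: (RA_fibrewise_ext je hZ cZ oU lf cft ftj hf).
Qed.

Lemma Cr_pred k r (X H : tvsType (fld R k)) (U : set X) (f : X -> H) :
  Cr r U f -> Cr (pred_smooth r) U f.
Proof.
case: r => [m||] //= [oU cf hf]; split=> // j hj; apply: hf.
by apply: leq_trans hj _; exact: leq_pred.
Qed.

End smoothness_classes.

(** * Continuous linear extensions to completions *)

Section completions.
Context {R : realType}.

Section extension.
Context {k : scalars}.
Context (V V' : lmodType (fld R k)) (oV : set (set V)) (oV' : set (set V')).
Context (W W' : tvsType (fld R k)) (j : V -> W) (j' : V' -> W') (b : V -> V').
Hypotheses (cj : is_completion oV j) (cj' : is_completion oV' j').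
Hypotheses (lb : linear b) (cb : forall O, oV' O -> oV (b @^-1` O)).

(** The topology of V is only a family of open sets. An open set around 0 is the trace of one in W,
    which contains the unit ball of a seminorm of W. *)
Lemma completion_dominates (q : V -> R) : (forall (a : fld R k) v, q (a *: v) = nm a * q v) ->
  (exists O, [/\ oV O, O 0 & forall v, O v -> q v < 1]) ->
  exists2 p, csn p & forall v, q v <= p (j v).
Proof.
move=> qZ [N [+ N0 Nq]]; have [_ _ [lj _] oj _] := cj.
move=> /oj[N' oN' NE]; have n0 : nbhs (0 : W) N'.
  by apply: open_near => //; move: N0; rewrite NE /= (lin0 lj).
have [p hp pN] := csn_nbhs n0; exists p => //.
apply: (homog_le (p := p \o j)) => [v|a v|//|v h].
- exact: csn_ge0.
- by rewrite /= (linZ lj) csnZ.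
- by apply: Nq; rewrite NE; exact: pN.
Qed.

(** An extension exists, so the default value in [cont_ext] is never taken. *)
Lemma cont_extP : [/\ linear (cont_ext j j' b), continuous (cont_ext j j' b) &
  forall v, cont_ext j j' b (j v) = j' (b v)].
Proof.
have [hW cW [lj _] oj dj] := cj; have [hW' cW' [lj' _] oj' dj'] := cj'.
rewrite /cont_ext; case: xgetP => [g _ //|].
suff [g hg] : exists g : W -> W', [/\ linear g, continuous g & forall v, g (j v) = j' (b v)].
  by move=> /(_ g).
apply: (@extension_ex R k V W W' j (fun v => j' (b v))) => //.
  by move=> a u v; rewrite lb lj'.
move=> q hq; apply: (completion_dominates (q := fun v => q (j' (b v)))).
  by move=> a v; rewrite (linZ lb) (linZ lj') csnZ.
have [_ _ /(_ _ ltr01) n0] := hq.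
exists (b @^-1` (j' @^-1` interior [set w | q w < 1])); split.
- by apply/cb/oj'; exists (interior [set w | q w < 1]) => //; exact: open_interior.
- by rewrite /= (lin0 lb) (lin0 lj'); exact: n0.
- by move=> v /= /nbhs_singleton.
Qed.

End extension.

Lemma completion_dense_emb {k : scalars} (V W : tvsType (fld R k)) (j : V -> W) :
  is_completion (fun O : set V => open O) j -> dense_emb j.
Proof.
move=> cj; have [hW cW [lj _] oj dj] := cj; split=> //.
  by apply/continuousP => O oO; apply/oj; exists O.
move=> p hp; apply: (completion_dominates cj); first by move=> a v; rewrite csnZ.
have [_ _ /(_ _ ltr01) n0] := hp.
exists (interior [set w | p w < 1]); split=> //; first exact: open_interior.
by move=> v /nbhs_singleton.
Qed.

Lemma restr_linear {K L : scalars} (h : K = RealScalars \/ K = L) 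
    (V W : tvsType (fld R L)) (f : V -> W) : linear f -> linear (f : restr h V -> restr h W).
Proof. by move=> lf a u v; exact: lf. Qed.

Lemma restr_completion {K L : scalars} (h : K = RealScalars \/ K = L)
    (V W : tvsType (fld R L)) (j : V -> W) :
  is_completion (fun O : set V => open O) j ->
  is_completion (fun O : set (restr h V) => open O) (j : restr h V -> restr h W).
Proof.
move=> [hW cW [lj ij] oj dj]; split=> //; split=> //; exact: restr_linear.
Qed.

End completions.

(** * Maps into manifolds *)

Arguments chart_dom {R k T} c _.
Arguments chart_img {R k T} c _.
Arguments chart_fun {R k T} c _.
Arguments chart_inv {R k T} c _.
Arguments mfd_chart {R k T} m i.

Section maps_into_manifolds.
Context {R : realType} {k : scalars}.
Implicit Types (r : smoothness).

Lemma is_chart_inv_open (T : topologicalType) (c : chart R k T) (W : set T) :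
  is_chart c -> open W -> open [set y | chart_img c y /\ W (chart_inv c y)].
Proof.
move=> [_ [_ oi] [_ ci] _ _] oW; apply: open_preim => //.
exact/within_contP.
Qed.

Lemma within_cont_prod (A B D E : topologicalType) (U : set A) (V : set B) (f : A -> D) (g : B -> E) :
  open U -> open V -> {within U, continuous f} -> {within V, continuous g} ->
  {within U `*` V, continuous (fun p : A * B => (f p.1, g p.2))}.
Proof.
move=> oU oV cf cg; apply/within_contP; first exact: open_prod.
move=> [x x'] [/= Ux Vx']; apply: (@cont_pair_at (A * B)%type D E (fun p => f p.1) (fun p => g p.2)).
  by apply: (@continuous_comp (A * B)%type _ _ fst f); [exact: cvg_fst|exact: (within_contP _ oU).1].
by apply: (@continuous_comp (A * B)%type _ _ snd g); [exact: cvg_snd|exact: (within_contP _ oV).1].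
Qed.

(** The manifold axioms that mention no class, so that G of class C^s and M of class C^r can be
    handled together. *)
Definition has_charts (T : Type) (m : manifold R k T) :=
  (forall x, exists i, chart_dom (mfd_chart m i) x) /\ forall i, is_chart (mfd_chart m i).

Lemma Cr_manifold_charts r (T : Type) (m : manifold R k T) : is_Cr_manifold r m -> has_charts m.
Proof. by case. Qed.

Lemma Lie_group_charts s (G : groupType) (mG : manifold R k G) : is_Lie_group s mG -> has_charts mG.
Proof. by case=> /Cr_manifold_charts. Qed.

Lemma tvs_has_charts (V : tvsType (fld R k)) : hausdorff_space V -> has_charts (tvs_manifold V).
Proof.
move=> hV; split=> [x|i]; first by exists tt.
split=> //; first by split; exact: openT.
have ci : {within [set: V], continuous (@id V)} by apply/(within_contP _ openT) => x _; exact: cvg_id.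
by split.
Qed.

Lemma prod_has_charts (T T' : Type) (m : manifold R k T) (m' : manifold R k T') :
  has_charts m -> has_charts m' -> has_charts (prod_manifold m m').
Proof.
move=> [cov ch] [cov' ch']; split=> [[x x']|[i i']].
  by have [i hi] := cov x; have [i' hi'] := cov' x'; exists (i, i').
have [h1 [od oi] [cf ci] fi inf] := ch i.
have [h1' [od' oi'] [cf' ci'] fi' inf'] := ch' i'.
have oD : open (chart_dom (mfd_chart m i) `*` chart_dom (mfd_chart m' i')) by exact: open_prod.
have oI : open (chart_img (mfd_chart m i) `*` chart_img (mfd_chart m' i')) by exact: open_prod.
split; first exact: hausdorff_prod.
- by split.
- split; [exact: (within_cont_prod od od' cf cf')|exact: (within_cont_prod oi oi' ci ci')].
- move=> [x x'] [/= dx dx']; have [? e] := fi x dx; have [? e'] := fi' x' dx'.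
  by rewrite e e'.
- move=> [x x'] [/= dx dx']; have [? e] := inf x dx; have [? e'] := inf' x' dx'.
  by rewrite e e'.
Qed.

Definition smooth_into r (P : tvsType (fld R k)) (T : Type) (m : manifold R k T)
    (S : set P) (f : P -> T) :=
  open S /\ forall i, Cr r [set x | S x /\ chart_dom (mfd_chart m i) (f x)]
    (chart_fun (mfd_chart m i) \o f).

(* A weak form of [smooth_into] using one chart at each point; unlike
   [smooth_into] it holds for the inverse of a chart of a manifold which is
   of another class than [r]. *)
Definition chartwise r (P : tvsType (fld R k)) (T : Type) (m : manifold R k T)
    (S : set P) (f : P -> T) :=
  open S /\ forall x, S x -> exists i, chart_dom (mfd_chart m i) (f x) /\
    Cr r [set x | S x /\ chart_dom (mfd_chart m i) (f x)] (chart_fun (mfd_chart m i) \o f).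

Section basics.
Context (r : smoothness) (P : tvsType (fld R k)) (T : Type) (m : manifold R k T).
Hypothesis hm : has_charts m.

Lemma smooth_into_chartwise (S : set P) (f : P -> T) : smooth_into r m S f -> chartwise r m S f.
Proof. by move=> [oS h]; split=> // x Sx; have [i hi] := hm.1 (f x); exists i. Qed.

Lemma chartwise_cont (S : set P) (f : P -> T) : chartwise r m S f ->
  forall x, S x -> {for x, continuous (f : P -> mspace m)}.
Proof.
move=> [oS h] x Sx; have [i [di hi]] := h x Sx; have [hH [od oi] [cf ci] fi inf] := hm.2 i.
apply: (@cont_near _ _ (chart_inv (mfd_chart m i) \o (chart_fun (mfd_chart m i) \o f))).
  have := open_near (Cr_open hi) (conj Sx di); apply: filterS => y [_ dy] /=.
  by case: (fi _ dy).
apply: continuous_comp; first exact: (Cr_cont hH hi (conj Sx di)).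
by apply: (within_contP _ oi).1 => //; case: (fi _ di).
Qed.

Lemma smooth_into_sub (S S' : set P) (f f' : P -> T) : open S' -> S' `<=` S ->
  (forall x, S' x -> f x = f' x) -> smooth_into r m S f -> smooth_into r m S' f'.
Proof.
move=> oS' S'S ff' sf; have [oS hf] := sf; split=> // i.
have [hH [od _] _ _ _] := hm.2 i.
have cf := chartwise_cont (smooth_into_chartwise sf).
have oD : open [set x | S' x /\ chart_dom (mfd_chart m i) (f x)].
  by apply: (@open_preim P (mspace m)) => // x S'x; apply: cf; exact: S'S.
have eD : [set x | S' x /\ chart_dom (mfd_chart m i) (f' x)] =
    [set x | S' x /\ chart_dom (mfd_chart m i) (f x)].
  by apply/seteqP; split=> x [S'x]; rewrite /= ff'.
rewrite eD; apply: (Cr_sub hH oD _ _ (hf i)).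
  by move=> x [S'x dx]; split=> //; exact: S'S.
by move=> x [S'x dx]; rewrite /= ff'.
Qed.

Lemma smooth_into_pre (Q : tvsType (fld R k)) (S : set P) (S' : set Q) (l : Q -> P) (f : P -> T) :
  hausdorff_space P -> (forall x, S' x -> S (l x)) -> Cr r S' l -> smooth_into r m S f ->
  smooth_into r m S' (f \o l).
Proof.
move=> hP S'S hl [oS hf]; split=> [|i]; first exact: Cr_open hl.
have [hH [od _] _ _ _] := hm.2 i.
have oD : open [set x | S' x /\ [set x | S x /\ chart_dom (mfd_chart m i) (f x)] (l x)].
  by apply: open_preim; [exact: Cr_open hl|exact: Cr_open (hf i)|exact: Cr_cont hP hl].
have eD : [set x | S' x /\ chart_dom (mfd_chart m i) ((f \o l) x)] =
    [set x | S' x /\ [set x | S x /\ chart_dom (mfd_chart m i) (f x)] (l x)].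
  by apply/seteqP; split=> x [S'x] => [dx|[]]; split=> //; split=> //; exact: S'S.
rewrite eD; apply: (Cr_comp hP hH _ _ (hf i)); first by move=> x [].
by apply: (Cr_sub hP oD _ _ hl) => // x [].
Qed.

(** [Cr_map] is tested in all pairs of charts, so near each point the one chart in which f is known
    to be smooth suffices. *)
Lemma smooth_into_comp (T' : Type) (m' : manifold R k T') (S : set P) (f : P -> T)
    (W : set T) (g : T -> T') :
  (forall i, is_chart (mfd_chart m' i)) -> (forall x, S x -> W (f x)) ->
  chartwise r m S f -> Cr_map r m m' W g -> smooth_into r m' S (g \o f).
Proof.
move=> hm' SW [oS hf] [oW cg hg]; split=> // j; have [hH _ _ _ _] := hm' j.
apply: Cr_local => // x [Sx dx]; have [i [di hi]] := hf x Sx.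
have [hH' [od oi] [cf ci] fi inf] := hm.2 i; have hij := hg i j.
exists [set x | chart_dom (mfd_chart m i) (f x)]; split=> //.
pose N := [set x | S x /\ chart_dom (mfd_chart m i) (f x)].
pose D : set (chart_model (mfd_chart m i)) := [set y | [/\ chart_img (mfd_chart m i) y, W (chart_inv (mfd_chart m i) y) &
   chart_dom (mfd_chart m' j) (g (chart_inv (mfd_chart m i) y))]].
have oN : open [set x | N x /\ D ((chart_fun (mfd_chart m i) \o f) x)].
  by apply: open_preim; [exact: Cr_open hi|exact: Cr_open hij|exact: Cr_cont hH' hi].
have eN : [set x | S x /\ chart_dom (mfd_chart m' j) ((g \o f) x)] `&`
    [set x | chart_dom (mfd_chart m i) (f x)] =
    [set x | N x /\ D ((chart_fun (mfd_chart m i) \o f) x)].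
  apply/seteqP; split=> y /=.
    move=> [[Sy dy] dfy]; have [iy ey] := fi _ dfy.
    by split=> //; split=> //=; rewrite ey//; exact: SW.
  move=> [[Sy dfy] [/= _ _]]; have [iy ey] := fi _ dfy.
  by rewrite ey.
rewrite eN; apply: (@Cr_eq _ _ _ _ _ _ ((chart_fun (mfd_chart m' j) \o g \o chart_inv (mfd_chart m i)) \o (chart_fun (mfd_chart m i) \o f))) => //.
  by move=> y [[_ dy] _] /=; have [_ ->] := fi _ dy.
apply: (Cr_comp hH' hH _ _ hij); first by move=> y [].
by apply: (Cr_sub hH' oN _ _ hi) => // y [].
Qed.

(** Read in the chart i itself the map is l, so no transition map of m enters and the class r is
    arbitrary. *)
Lemma chartwise_inv i (S : set P) (l : P -> chart_model (mfd_chart m i)) :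
  (forall x, S x -> chart_img (mfd_chart m i) (l x)) -> Cr r S l ->
  chartwise r m S (chart_inv (mfd_chart m i) \o l).
Proof.
have [hH [od oi] [cf ci] fi inf] := hm.2 i => Sl hl; split=> [|y Sy]; first exact: Cr_open hl.
exists i; split; first by case: (inf _ (Sl _ Sy)).
have -> : [set x | S x /\ chart_dom (mfd_chart m i) ((chart_inv (mfd_chart m i) \o l) x)] = S.
  by apply/seteqP; split=> x => [[]//|Sx]; split=> //=; case: (inf _ (Sl _ Sx)).
by apply: Cr_eq hl => // x /Sl /inf[_ /= ->].
Qed.

End basics.

Lemma smooth_into_inv r (T : Type) (m : manifold R k T) i : is_Cr_manifold r m ->
  smooth_into r m (chart_img (mfd_chart m i)) (chart_inv (mfd_chart m i)).
Proof. by move=> [_ _ ch tr]; split=> [|j]; [have [_ []] := ch i|exact: tr]. Qed.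

Lemma smooth_into_tvs r (P V : tvsType (fld R k)) (S : set P) (f : P -> V) : hausdorff_space V ->
  Cr r S f -> smooth_into r (tvs_manifold V) S f.
Proof.
move=> hV hf; have oS := Cr_open hf; split=> // i.
have eS : [set x | S x /\ chart_dom (mfd_chart (tvs_manifold V) i) (f x)] = S.
  by apply/seteqP; split=> x // [].
by rewrite eS; exact: (Cr_eq _ _ hf).
Qed.

Lemma chartwise_tvs r (P V : tvsType (fld R k)) (S : set P) (f : P -> V) : hausdorff_space V ->
  Cr r S f -> chartwise r (tvs_manifold V) S f.
Proof.
by move=> hV hf; apply: smooth_into_chartwise; [exact: tvs_has_charts|exact: smooth_into_tvs].
Qed.

Lemma Cr_of_smooth_into_tvs r (P V : tvsType (fld R k)) (S : set P) (f : P -> V) : hausdorff_space V ->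
  smooth_into r (tvs_manifold V) S f -> Cr r S f.
Proof.
move=> hV [oS /(_ tt)]; apply: Cr_sub => // x Sx; split=> //.
Qed.

Section products.
Context (r : smoothness) (P : tvsType (fld R k)) (T T' : Type).
Context (m : manifold R k T) (m' : manifold R k T').
Hypotheses (hm : has_charts m) (hm' : has_charts m').

Let coordinates (S : set P) (f : P -> T) (g : P -> T') i j :
  Cr r [set x | S x /\ chart_dom (mfd_chart m i) (f x)] (chart_fun (mfd_chart m i) \o f) ->
  Cr r [set x | S x /\ chart_dom (mfd_chart m' j) (g x)] (chart_fun (mfd_chart m' j) \o g) ->
  Cr r [set x | S x /\ chart_dom (mfd_chart (prod_manifold m m') (i, j)) (f x, g x)]
    (chart_fun (mfd_chart (prod_manifold m m') (i, j)) \o (fun x => (f x, g x))).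
Proof.
have [hH _ _ _ _] := hm.2 i; have [hH' _ _ _ _] := hm'.2 j => hf hg.
have oD := open_inter (Cr_open hf) (Cr_open hg).
have -> : [set x | S x /\ chart_dom (mfd_chart (prod_manifold m m') (i, j)) (f x, g x)] =
    [set x | [set x | S x /\ chart_dom (mfd_chart m i) (f x)] x /\
             [set x | S x /\ chart_dom (mfd_chart m' j) (g x)] x].
  by apply/seteqP; split=> x /= => [[Sx [dx dx']]|[[Sx dx] [_ dx']]].
by apply: (Cr_pair hH hH'); [apply: (Cr_sub hH oD _ _ hf)|apply: (Cr_sub hH' oD _ _ hg)] => // x [].
Qed.

Lemma smooth_into_pair (S : set P) (f : P -> T) (g : P -> T') :
  smooth_into r m S f -> smooth_into r m' S g ->
  smooth_into r (prod_manifold m m') S (fun x => (f x, g x)).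
Proof. by move=> [oS hf] [_ hg]; split=> // -[i j]; exact: coordinates. Qed.

Lemma chartwise_pair (S : set P) (f : P -> T) (g : P -> T') :
  chartwise r m S f -> chartwise r m' S g ->
  chartwise r (prod_manifold m m') S (fun x => (f x, g x)).
Proof.
move=> [oS hf] [_ hg]; split=> // x Sx.
have [i [di hi]] := hf x Sx; have [j [dj hj]] := hg x Sx.
by exists (i, j); split=> //; exact: coordinates.
Qed.

Lemma smooth_into_snd (S : set P) (f : P -> T * T') :
  smooth_into r (prod_manifold m m') S f -> smooth_into r m' S (snd \o f).
Proof.
move=> sf; have [oS hf] := sf; split=> // j; have [hH' [od _] _ _ _] := hm'.2 j.
apply: Cr_local => // x [Sx dx]; have [i di] := hm.1 (f x).1; have [hH _ _ _ _] := hm.2 i.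
exists [set x | chart_dom (mfd_chart m i) (f x).1]; split=> //.
have hij := hf (i, j).
have -> : [set x0 | S x0 /\ chart_dom (mfd_chart m' j) ((snd \o f) x0)] `&`
     [set x0 | chart_dom (mfd_chart m i) (f x0).1] =
     [set x | S x /\ chart_dom (mfd_chart (prod_manifold m m') (i, j)) (f x)].
  by apply/seteqP; split=> y /= => [[[Sy dy] dy']|[Sy [dy dy']]].
apply: (@Cr_comp _ _ _ _ _ _ _ setT (chart_fun (mfd_chart (prod_manifold m m') (i, j)) \o f) snd) => //.
  exact: hausdorff_prod.
by apply: Cr_lin => //; [exact: openT|exact: cont_snd].
Qed.

End products.

Lemma Cr_map_of_charts r (T T' : Type) (m : manifold R k T) (m' : manifold R k T')
    (W : set T) (f : T -> T') :
  has_charts m -> has_charts m' -> open (W : set (mspace m)) ->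
  (forall i, smooth_into r m' [set y | chart_img (mfd_chart m i) y /\ W (chart_inv (mfd_chart m i) y)]
     (f \o chart_inv (mfd_chart m i))) -> Cr_map r m m' W f.
Proof.
move=> hm hm' oW hf; split=> //.
  apply/(within_contP (f : mspace m -> mspace m') oW) => x Wx.
  have [i di] := hm.1 x; have [hH [od oi] [cf ci] fi inf] := hm.2 i; have [ix ex] := fi _ di.
  apply: (@cont_near (mspace m) (mspace m') ((f \o chart_inv (mfd_chart m i)) \o chart_fun (mfd_chart m i))).
    by have := open_near od di; apply: filterS => y /fi[_ /= ->].
  apply: (@continuous_comp (mspace m) _ (mspace m')).
    exact: (within_contP _ od).1.
  apply: (chartwise_cont hm' (smooth_into_chartwise hm' (hf i))).
  by split=> //; rewrite ex.
move=> i j /=; have [_ /(_ j)] := hf i; congr Cr; apply/seteqP; split=> y /=.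
  by move=> [[]].
by move=> [].
Qed.

End maps_into_manifolds.

(** * A manifold structure glued from charts on a bare set *)

Definition glued (I T : Type) (A : I -> topologicalType) (img : forall i, set (A i))
  (inv : forall i, A i -> T) : Type := T.

Section gluing.
Context (I T : Type) (A : I -> topologicalType) (img : forall i, set (A i)).
Context (inv : forall i, A i -> T).
Arguments img : clear implicits.
Arguments inv : clear implicits.

(* The guard [open (img i)] makes this a topology without hypotheses. *)
Let op : set_system (glued img inv) := fun W =>
  forall i, open (img i) -> open [set y | img i y /\ W (inv i y)].

Let opT : op setT.
Proof. by move=> i oi; rewrite [X in open X](_ : _ = img i)//; apply/seteqP; split=> y // []. Qed.

Let opI : setI_closed op.
Proof.
move=> W W' oW oW' i oi; rewrite [X in open X](_ : _ =
  [set y | img i y /\ W (inv i y)] `&` [set y | img i y /\ W' (inv i y)]).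
  by apply: openI; [exact: oW|exact: oW'].
by apply/seteqP; split=> y /= [] => [iy []|[iy Wy] [_ W'y]].
Qed.

Let op_bigU (J : Type) (f : J -> set (glued img inv)) : (forall j, op (f j)) -> op (\bigcup_j f j).
Proof.
move=> oW i oi; rewrite [X in open X](_ : _ = \bigcup_j [set y | img i y /\ f j (inv i y)]).
  by apply: bigcup_open => j _; exact: oW.
by apply/seteqP; split=> y /= => [[iy [j _ fj]]|[j _ [iy fj]]]; [exists j|split=> //; exists j].
Qed.

HB.instance Definition _ := gen_eqMixin (glued img inv).
HB.instance Definition _ := gen_choiceMixin (glued img inv).
HB.instance Definition _ := isOpenTopological.Build (glued img inv) opT opI op_bigU.

Lemma open_glued (W : set (glued img inv)) :
  open W <-> forall i, open (img i) -> open [set y | img i y /\ W (inv i y)].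
Proof.
split=> [oW|oW]; last by apply/open_nearP => x Wx; exists W; split.
have -> : W = \bigcup_(B : {B | op B /\ B `<=` W}) sval B.
  apply/seteqP; split=> x; last by move=> [[B [oB BW]] _] /BW.
  by move=> /(open_near oW) [B [oB Bx BW]]; exists (exist _ B (conj oB BW)).
by apply: op_bigU => -[B []].
Qed.

End gluing.

Lemma hausdorff_separate (T B : topologicalType) (p : T -> B) (x y : T) : hausdorff_space B ->
  {for x, continuous p} -> {for y, continuous p} -> cluster (nbhs x) y -> p x = p y.
Proof.
move=> hB cx cy xy; apply: hB => P Q nP nQ.
by have [z [Pz Qz]] := xy _ _ (cx P nP) (cy Q nQ); exists (p z).
Qed.

Section glued_manifold.
Context {R : realType} {k : scalars} (T I : Type) (model : I -> tvsType (fld R k)).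
Context (dom : I -> set T) (img : forall i, set (model i)).
Context (fn : forall i, T -> model i) (inv : forall i, model i -> T).
Arguments img : clear implicits.
Arguments fn : clear implicits.
Arguments inv : clear implicits.

Definition glued_manifold : manifold R k T :=
  @Manifold R k T (Topological.class (@glued I T model img inv)) I
    (fun i => @Chart R k (@glued I T model img inv) (model i) (dom i) (img i) (fn i) (inv i)).

Context (r : smoothness).
Hypotheses (hH : forall i, hausdorff_space (model i)) (oI : forall i, open (img i)).
Hypothesis fnK : forall i x, dom i x -> img i (fn i x) /\ inv i (fn i x) = x.
Hypothesis invK : forall i y, img i y -> dom i (inv i y) /\ fn i (inv i y) = y.
Hypothesis cov : forall x, exists i, dom i x.
Hypothesis tr : forall i j, Cr r [set y | img i y /\ dom j (inv i y)] (fn j \o inv i).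

Let oG (W : set (mspace glued_manifold)) :
  open W <-> forall i, open [set y | img i y /\ W (inv i y)].
Proof. by split=> [/open_glued h i|h]; [exact: h|apply/open_glued]. Qed.

Let open_dom i : open (dom i : set (mspace glued_manifold)).
Proof. by apply/oG => j; exact: Cr_open (tr j i). Qed.

Lemma glued_has_charts : has_charts glued_manifold.
Proof.
split=> // i; split=> /=; [exact: hH|by split; [exact: open_dom|exact: oI]| |exact: fnK|exact: invK].
split.
  apply/(@within_contP (mspace glued_manifold)); first exact: open_dom.
  move=> x dx N nN.
  have oW : open ([set x | dom i x /\ interior N (fn i x)] : set (mspace glued_manifold)).
    apply/oG => j; rewrite [X in open X](_ : _ = [set y | [set y | img j y /\ dom i (inv j y)] y /\
       interior N ((fn i \o inv j) y)]); last by apply/seteqP; split=> y /= => [[? []]|[[]]].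
    by apply: open_preim; [exact: Cr_open (tr j i)|exact: open_interior|exact: Cr_cont (tr j i)].
  apply: filterS (open_near oW _); last by split.
  by move=> y [_ /nbhs_singleton].
apply/(@within_contP _ (mspace glued_manifold)); first exact: oI.
move=> y iy N; rewrite nbhsE => -[W [oW Wy] WN].
apply: filterS (open_near ((oG _).1 oW i) _); last by split.
by move=> z [_ /WN].
Qed.

(** Points that cannot be separated have the same image under p, hence lie in one chart, and that
    chart separates them. *)
Lemma glued_hausdorff (B : topologicalType) (p : T -> B) : hausdorff_space B ->
  (forall i y, img i y -> {for y, continuous (p \o inv i)}) ->
  (forall x y, p x = p y -> exists i, dom i x /\ dom i y) ->
  hausdorff_space (mspace glued_manifold).
Proof.
move=> hB cp sep x y xy.
have cpx z : {for z, continuous (p : mspace glued_manifold -> B)}.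
  move=> N nN; have oW : open ([set x | interior N (p x)] : set (mspace glued_manifold)).
    by apply/oG => i; apply: (open_preim (oI i) (open_interior N)); exact: cp.
  apply: filterS (open_near oW _); last exact: nN.
  by move=> w /nbhs_singleton.
have [i [dx dy]] := sep x y (hausdorff_separate hB (cpx x) (cpx y) xy).
have [_ [od _] [cf _] _ _] := glued_has_charts.2 i.
have e := hausdorff_separate (@hH i) ((within_contP _ od).1 cf x dx) ((within_contP _ od).1 cf y dy) xy.
by have [_ <-] := fnK dx; have [_ <-] := fnK dy; move: e => /= ->.
Qed.

Lemma glued_Cr_manifold : hausdorff_space (mspace glued_manifold) -> is_Cr_manifold r glued_manifold.
Proof. by move=> hG; split=> //; exact: glued_has_charts.2. Qed.

End glued_manifold.

(** * The completed bundle *)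

Section total_space.
Context {M : Type}.

(* Equality proofs in [M] are irrelevant, so the second projection is injective
   on each fibre. *)
Lemma existT_inj (E : M -> Type) x (v w : E x) : existT E x v = existT E x w -> v = w.
Proof.
have gen (p q : {x & E x}) (e : p = q) :
    eq_rect _ E (projT2 p) _ (f_equal (@projT1 _ E) e) = projT2 q by case: q / e.
move=> e; have := gen _ _ e; move: (f_equal _ e) => /= q.
by rewrite (Prop_irrelevance q erefl).
Qed.

End total_space.

(** * Local trivializations on the fibres *)

Section trivializations.
Context {R : realType} {K L : scalars} (h : K = RealScalars \/ K = L).
Context (M : Type) (mM : manifold R K M) (r : smoothness).
Context (F : tvsType (fld R L)) (E : M -> lmodType (fld R L)).
Context (mE : manifold R K (bundle_total E)).

Definition fibre_inv (psi : bundle_total E -> M * F) (x : M) (v : F) : E x :=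
  xget 0 [set w : E x | fibre_part psi w = v].

Hypothesis hF : hausdorff_space F.
Hypotheses (hM : has_charts mM) (hE : has_charts mE).
Context (U : set M) (psi : bundle_total E -> M * F).
Hypothesis hpsi : is_local_triv h mM r mE U psi.

Lemma triv_tag x (w : E x) : U x -> psi (existT _ x w) = (x, fibre_part psi w).
Proof.
case: hpsi => _ _ _ im _ Ux; rewrite /fibre_part [LHS]surjective_pairing; congr (_, _).
have : (psi @` [set e | tag e = x]) (psi (existT _ x w)) by exists (existT _ x w).
by rewrite im// => -[].
Qed.

(** The inverse given by [is_local_triv] maps into the total space without a declared fibre; here it
    is identified with [fibre_inv], which then inherits its smoothness. *)
Lemma triv_phi : exists phi : M * F -> bundle_total E,
  Cr_map r (prod_manifold mM (tvs_manifold (restr h F))) mE (U `*` setT) phi /\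
  forall x, U x -> [/\ forall v, phi (x, v) = existT _ x (fibre_inv psi x v),
    forall v, fibre_part psi (fibre_inv psi x v) = v &
    forall w, fibre_inv psi x (fibre_part psi w) = w].
Proof.
have [_ _ [phi [cphi phiK psiK]] im _] := hpsi; exists phi; split=> // x Ux.
have inj (w w' : E x) : fibre_part psi w = fibre_part psi w' -> w = w'.
  move=> e; apply: (@existT_inj M E).
  rewrite -[LHS](phiK (existT _ x w) Ux).2 -[RHS](phiK (existT _ x w') Ux).2.
  by rewrite !triv_tag// e.
have sur v : exists2 w : E x, phi (x, v) = existT _ x w & fibre_part psi w = v.
  have [Ut] := psiK (x, v) Ux; case: (phi (x, v)) Ut => x' w /= Ux'.
  by rewrite triv_tag// => -[]; move: w; rewrite -/x'; move=> w; case: _ / => <-; exists w.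
have invK v : fibre_part psi (fibre_inv psi x v) = v.
  rewrite /fibre_inv; case: xgetP => [w _ //|].
  by have [w _ hw] := sur v => /(_ w).
split=> // [v|w]; last exact: inj.
by have [w -> hw] := sur v; congr existT; apply: inj; rewrite invK.
Qed.

Lemma triv_invK x v : U x -> fibre_part psi (fibre_inv psi x v) = v.
Proof. by have [phi [_ h']] := triv_phi => /h'[]. Qed.

Lemma triv_partK x (w : E x) : U x -> fibre_inv psi x (fibre_part psi w) = w.
Proof. by have [phi [_ h']] := triv_phi => /h'[]. Qed.

Lemma triv_lin x : U x -> linear (fibre_part psi (x := x)).
Proof. by case: hpsi => _ _ _ _; apply. Qed.

Lemma triv_inv_lin x : U x -> linear (fibre_inv psi x).
Proof.
move=> Ux a u v; rewrite -[RHS](triv_partK _ Ux) (triv_lin Ux).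
by rewrite !triv_invK.
Qed.

Lemma triv_part_open x (O : set F) : U x -> open O ->
  fibre_open mE (fibre_part psi (x := x) @^-1` O).
Proof.
move=> Ux oO; have [oU [oEU cpsi _] _ _ _] := hpsi.
exists ([set e | U (tag e) /\ O (psi e).2] : set (mspace mE)).
  apply: (@open_preim (mspace mE) F [set e | U (tag e)] (fun e => (psi e).2)) => // e Ue.
  apply: (@continuous_comp (mspace mE) (mspace mM * F)%type F psi snd); last exact: cvg_snd.
  exact: (within_contP _ oEU).1.
by apply/seteqP; split=> w //= [].
Qed.

Lemma triv_inv_open x (N : set (E x)) : U x -> fibre_open mE N ->
  open (fibre_inv psi x @^-1` N).
Proof.
move=> Ux [N' oN' ->]; have [phi [[oUT cphi _] phiE]] := triv_phi.
have [e _ _] := phiE x Ux.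
rewrite [X in open X](_ : _ = [set v | setT v /\ N' (phi (x, v))]); last first.
  by apply/seteqP; split=> v /=; rewrite e => // -[].
apply: (@open_preim F (mspace mE)) => // [|v _]; first exact: openT.
apply: (@continuous_comp F (mspace mM * F)%type (mspace mE) (fun v => (x, v)) phi).
  by apply: (@cont_pair_at F (mspace mM) F (fun=> x) id); [exact: cvg_cst|exact: cvg_id].
exact: (within_contP _ oUT).1.
Qed.

Lemma smooth_triv_inv (X : tvsType (fld R K)) (D : set X) (a : X -> M) : hausdorff_space X ->
  (forall y, D y -> U (a y)) -> smooth_into r mM D a ->
  smooth_into r mE (D `*` [set: restr h F])
    (fun p => existT _ (a p.1) (fibre_inv psi (a p.1) p.2) : bundle_total E).
Proof.
move=> hX DU sa; have [phi [cphi phiE]] := triv_phi.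
have oD : open D by case: sa.
have oDT : open (D `*` [set: restr h F]) by apply: open_prod => //; exact: openT.
have hF' : hausdorff_space (restr h F) := hF.
have s1 : chartwise r (prod_manifold mM (tvs_manifold (restr h F))) (D `*` [set: restr h F])
    (fun p => (a p.1, p.2)).
  apply: chartwise_pair => //; first exact: tvs_has_charts.
    apply: smooth_into_chartwise => //; apply: (smooth_into_pre hM (l := fst)) sa => //; first by move=> p [].
    by apply: Cr_lin => //; exact: cont_fst.
  by apply: chartwise_tvs => //; apply: Cr_lin => //; exact: cont_snd.
have hP := prod_has_charts hM (tvs_has_charts hF').
have DU' (p : X * restr h F) : (D `*` setT) p -> (U `*` setT) (a p.1, p.2).
  by move=> [Dp _]; split=> //; exact: DU.
have sf := smooth_into_comp hP hE.2 DU' s1 cphi.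
apply: (smooth_into_sub hE oDT _ _ sf) => //.
by move=> [y v] [/= Dy _]; have [-> _ _] := phiE _ (DU y Dy).
Qed.

Lemma smooth_triv_part (X : tvsType (fld R K)) (D : set X) (f : X -> bundle_total E) :
  (forall y, D y -> U (tag (f y))) -> smooth_into r mE D f ->
  Cr r D (fun y => fibre_part psi (tagged (f y)) : restr h F).
Proof.
move=> DU sf; have [_ cpsi _ _ _] := hpsi.
have hF' : hausdorff_space (restr h F) := hF.
have hP := prod_has_charts hM (tvs_has_charts hF').
have := smooth_into_comp hE hP.2 DU (smooth_into_chartwise hE sf) cpsi.
move=> /(smooth_into_snd hM (tvs_has_charts hF')) /(Cr_of_smooth_into_tvs hF').
by apply: Cr_eq => // y _ /=; rewrite /fibre_part; case: (f y).
Qed.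

End trivializations.

(** * Charts of the completed bundle *)

Section extended_trivializations.
Context {R : realType} {K L : scalars} (h : K = RealScalars \/ K = L).
Context (M : Type) (mM : manifold R K M) (r : smoothness).
Context (F : tvsType (fld R L)) (E : M -> lmodType (fld R L)).
Context (mE : manifold R K (bundle_total E)).
Context (Ft : tvsType (fld R L)) (jF : F -> Ft).
Context (Et : M -> tvsType (fld R L)) (jE : forall x, E x -> Et x).
Arguments jE : clear implicits.
Hypothesis hF : hausdorff_space F.
Hypotheses (hM : is_Cr_manifold r mM) (hE : is_Cr_manifold r mE).
Hypothesis hjF : is_completion (fun O : set F => open O) jF.
Hypothesis hjE : forall x, is_completion (@fibre_open R K L M E mE x) (jE x).

Let hcM := Cr_manifold_charts hM.
Let hcE := Cr_manifold_charts hE.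
Let hFt : hausdorff_space Ft. Proof. by case: hjF. Qed.
Let hEt x : hausdorff_space (Et x). Proof. by case: (hjE x). Qed.

Definition part_ext (psi : bundle_total E -> M * F) (x : M) : Et x -> Ft :=
  cont_ext (jE x) jF (fibre_part psi (x := x)).

Definition inv_ext (psi : bundle_total E -> M * F) (x : M) : Ft -> Et x :=
  cont_ext jF (jE x) (fibre_inv psi x).

Section one.
Context (U : set M) (psi : bundle_total E -> M * F).
Hypothesis hpsi : is_local_triv h mM r mE U psi.

Lemma part_extP x : U x -> [/\ linear (@part_ext psi x), continuous (@part_ext psi x) &
  forall w, @part_ext psi x (jE x w) = jF (fibre_part psi w)].
Proof.
move=> Ux; apply: (cont_extP (hjE x) hjF (triv_lin hpsi Ux)) => O oO.
exact: (triv_part_open hpsi).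
Qed.

Lemma inv_extP x : U x -> [/\ linear (inv_ext psi x), continuous (inv_ext psi x) &
  forall v, inv_ext psi x (jF v) = jE x (fibre_inv psi x v)].
Proof.
move=> Ux; apply: (cont_extP hjF (hjE x) (triv_inv_lin hpsi Ux)) => O oO.
exact: (triv_inv_open hpsi).
Qed.

Lemma inv_extK x v : U x -> part_ext psi (inv_ext psi x v) = v.
Proof.
move=> Ux; have [_ c1 e1] := part_extP Ux; have [_ c2 e2] := inv_extP Ux.
have [_ _ _ _ dj] := hjF.
have := @dense_eq R L F Ft Ft jF (fun v => part_ext psi (inv_ext psi x v)) id dj hFt.
move=> /(_ _ _ _)/(congr1 (@^~ v)); apply => //.
- exact: cont_comp c2 c1.
- exact: cont_id.
- by move=> w; rewrite e2 e1 (triv_invK hpsi).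
Qed.

Lemma part_extK x (w : Et x) : U x -> inv_ext psi x (part_ext psi w) = w.
Proof.
move=> Ux; have [_ c1 e1] := part_extP Ux; have [_ c2 e2] := inv_extP Ux.
have [_ _ _ _ dj] := hjE x.
have := @dense_eq R L (E x) (Et x) (Et x) (jE x) (fun w => inv_ext psi x (part_ext psi w)) id dj (@hEt x).
move=> /(_ _ _ _)/(congr1 (@^~ w)); apply => //.
- exact: cont_comp c1 c2.
- exact: cont_id.
- by move=> v; rewrite e1 e2 (triv_partK hpsi).
Qed.

End one.

(* Every coordinate expression of the extended bundle and of the extended action
   has this form: it is the fibrewise extension of a map of class C^r. *)
Lemma ext_coordinate (X : tvsType (fld R K)) (D : set X) (a a' : X -> M)
    (b : forall y, E (a y) -> E (a' y)) (bt : forall y, Et (a y) -> Et (a' y))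
    (U U' : set M) (psi psi' : bundle_total E -> M * F) :
  is_local_triv h mM r mE U psi -> is_local_triv h mM r mE U' psi' ->
  open D -> (forall y, D y -> U (a y)) -> (forall y, D y -> U' (a' y)) ->
  (forall y, D y -> linear (b y)) ->
  (forall y, D y -> [/\ linear (bt y), continuous (bt y) &
     forall w, bt y (jE (a y) w) = jE (a' y) (b y w)]) ->
  smooth_into r mE (D `*` [set: restr h F])
    (fun p => existT _ (a' p.1) (b p.1 (fibre_inv psi (a p.1) p.2)) : bundle_total E) ->
  Cr r (D `*` [set: restr h Ft])
    (fun p => part_ext psi' (bt p.1 (inv_ext psi (a p.1) p.2)) : restr h Ft).
Proof.
move=> hpsi hpsi' oD DU DU' lb btP sf.
have hFt' : hausdorff_space (restr h Ft) := hFt.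
have hF' : hausdorff_space (restr h F) := hF.
have jc := restr_completion h hjF; have je := completion_dense_emb jc.
have [_ cFt _ _ _] := jc; have [ljF cjF _ _] := je.
pose f (p : X * restr h F) : restr h Ft := jF (fibre_part psi' (b p.1 (fibre_inv psi (a p.1) p.2))).
apply: (Cr_fibrewise_ext (j := jF : restr h F -> restr h Ft) (f := f) je hFt' cFt oD).
- move=> y Dy c u v; rewrite /f /=; apply: (etrans _ (ljF _ _ _)); congr jF.
  have ll := triv_inv_lin hpsi (DU y Dy).
  apply: (etrans _ (triv_lin hpsi' (DU' y Dy) _ _ _)); congr fibre_part.
  by apply: (etrans _ (lb y Dy _ _ _)); congr (b y); exact: ll.
- move=> y Dy c u v /=.
  have [l1 _ _] := inv_extP hpsi (DU y Dy); have [l2 _ _] := btP y Dy.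
  have [l3 _ _] := part_extP hpsi' (DU' y Dy).
  apply: (etrans _ (l3 _ _ _)); congr part_ext.
  by apply: (etrans _ (l2 _ _ _)); congr (bt y); exact: l1.
- move=> y Dy /=.
  have [_ l1 _] := inv_extP hpsi (DU y Dy); have [_ l2 _] := btP y Dy.
  have [_ l3 _] := part_extP hpsi' (DU' y Dy).
  exact: (cont_comp (cont_comp l1 l2) l3).
- move=> y v Dy /=.
  have [_ _ e1] := inv_extP hpsi (DU y Dy); have [_ _ e2] := btP y Dy.
  have [_ _ e3] := part_extP hpsi' (DU' y Dy).
  by rewrite e1 e2 e3.
- have DU2 (p : X * restr h F) : (D `*` setT) p -> U' (a' p.1) by move=> [/DU'].
  have hc := smooth_triv_part hF hcM hcE hpsi' (f := fun p : X * restr h F =>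
    existT _ (a' p.1) (b p.1 (fibre_inv psi (a p.1) p.2)) : bundle_total E) DU2 sf.
  apply: (@Cr_comp R K r _ _ _ _ setT _ (jF : restr h F -> restr h Ft) hF' hFt' _ hc) => //.
  by apply: Cr_lin => //; exact: openT.
Qed.

(** All local trivializations enter the atlas, so that each of them extends to one of the completed
    bundle, as the conclusion demands. *)
Definition triv_index := {t : set M * (bundle_total E -> M * F) | is_local_triv h mM r mE t.1 t.2}.

Section bundle_charts.
Context (i : triv_index * mfd_index mM).
Let U := (sval i.1).1.
Let psi := (sval i.1).2.
Let c := mfd_chart mM i.2.

Definition bundle_model : tvsType (fld R K) := (chart_model c * restr h Ft)%type.
Definition bundle_dom : set (bundle_total Et) := [set e | U (tag e) /\ chart_dom c (tag e)].
Definition bundle_img : set bundle_model :=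
  [set y | chart_img c y.1 /\ U (chart_inv c y.1)].
Definition bundle_fun (e : bundle_total Et) : bundle_model :=
  (chart_fun c (tag e), part_ext psi (tagged e)).
Definition bundle_inv (y : bundle_model) : bundle_total Et :=
  existT _ (chart_inv c y.1) (inv_ext psi (chart_inv c y.1) y.2).

Lemma bundle_model_hausdorff : hausdorff_space bundle_model.
Proof. by apply: hausdorff_prod; [have [] := hcM.2 i.2|exact: hFt]. Qed.

Lemma open_bundle_base (W : set M) : open (W : set (mspace mM)) ->
  open [set y | chart_img c y /\ W (chart_inv c y)].
Proof. by move=> oW; exact: is_chart_inv_open (hcM.2 i.2) oW. Qed.

Lemma bundle_imgE : bundle_img = [set y | chart_img c y /\ U (chart_inv c y)] `*` setT.
Proof. by apply/seteqP; split=> -[y v] //= []. Qed.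

Lemma open_bundle_img : open bundle_img.
Proof.
rewrite bundle_imgE; apply: open_prod; last exact: openT.
by apply: open_bundle_base; case: (svalP i.1).
Qed.

Lemma bundle_funK e : bundle_dom e -> bundle_img (bundle_fun e) /\ bundle_inv (bundle_fun e) = e.
Proof.
case: e => x w [/= Ux dx]; have [_ _ _ fi _] := hcM.2 i.2; have [ix ex] := fi x dx.
rewrite /bundle_img /bundle_inv /bundle_fun /= ex; split=> //.
by rewrite (part_extK (svalP i.1)).
Qed.

Lemma bundle_invK y : bundle_img y -> bundle_dom (bundle_inv y) /\ bundle_fun (bundle_inv y) = y.
Proof.
case: y => y v [/= iy Uy]; have [_ _ _ _ inf] := hcM.2 i.2; have [dy ey] := inf y iy.
rewrite /bundle_dom /bundle_inv /bundle_fun /= ey; split=> //.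
by rewrite (inv_extK (svalP i.1)).
Qed.

Lemma smooth_chart_inv (D : set (chart_model c)) : open D ->
  (forall y, D y -> chart_img c y) -> smooth_into r mM D (chart_inv c).
Proof. by move=> oD Di; exact: (smooth_into_sub hcM oD Di _ (smooth_into_inv i.2 hM)). Qed.

End bundle_charts.
Arguments bundle_img i _ : clear implicits.
Arguments bundle_inv i _ : clear implicits.

Section bundle_manifold.
Hypothesis hcov : forall x, exists (U : set M) (psi : bundle_total E -> M * F), U x /\ is_local_triv h mM r mE U psi.

Lemma inv_ext_coordinate (i : triv_index * mfd_index mM) (U' : set M) psi' (D : set (chart_model (mfd_chart mM i.2))) :
  is_local_triv h mM r mE U' psi' -> open D ->
  (forall y, D y -> [/\ chart_img (mfd_chart mM i.2) y, (sval i.1).1 (chart_inv (mfd_chart mM i.2) y) &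
    U' (chart_inv (mfd_chart mM i.2) y)]) ->
  Cr r (D `*` [set: restr h Ft]) (fun p => part_ext psi' (tagged (bundle_inv i p)) : restr h Ft).
Proof.
move=> hpsi' oD DP; have si := smooth_chart_inv oD (fun y Dy => let: And3 iy _ _ := DP y Dy in iy).
have hc : hausdorff_space (chart_model (mfd_chart mM i.2)) by have [] := hcM.2 i.2.
have DU y : D y -> (sval i.1).1 (chart_inv (mfd_chart mM i.2) y) by case/DP.
apply: (ext_coordinate (b := fun _ => id) (bt := fun _ => id) (svalP i.1) hpsi' oD DU) => //.
- by move=> y /DP[].
- by move=> y _; split=> //; exact: cont_id.
- exact: (smooth_triv_inv hF hcM hcE (svalP i.1) hc DU si).
Qed.

Lemma bundle_transition i j : Cr r [set y | bundle_img i y /\ bundle_dom j (bundle_inv i y)]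
  (bundle_fun j \o bundle_inv i).
Proof.
have hc : hausdorff_space (chart_model (mfd_chart mM i.2)) by have [] := hcM.2 i.2.
have [hc' [od' _] _ _ _] := hcM.2 j.2.
pose W : set (mspace mM) := [set x | (sval i.1).1 x /\ [set x | (sval j.1).1 x /\ chart_dom (mfd_chart mM j.2) x] x].
have oW : open W.
  by apply: open_inter; [case: (svalP i.1)|apply: open_inter => //; case: (svalP j.1)].
have oD := open_bundle_base i oW; set D := (X in open X) in oD.
have -> : [set y | bundle_img i y /\ bundle_dom j (bundle_inv i y)] = D `*` setT.
  by apply/seteqP; split=> -[y v] /= => [[[iy Uy] [Uy' dy]]|[[iy [Uy [Uy' dy]]] _]].
have oDT : open (D `*` [set: restr h Ft]) by apply: open_prod => //; exact: openT.
apply: Cr_pair => //.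
- have [_ _ _ /(_ i.2 j.2) tr] := hM.
  apply: (@Cr_comp _ _ _ _ _ _ _ _ fst _ hc hc' _ _ tr); first by move=> [y v] [[iy [Uy [Uy' dy]]] _].
  by apply: Cr_lin => //; exact: cont_fst.
- apply: inv_ext_coordinate (svalP j.1) oD _.
  by move=> y [iy [Uy [Uy' _]]].
Qed.

Definition bundle_manifold : manifold R K (bundle_total Et) :=
  glued_manifold bundle_dom bundle_img bundle_fun bundle_inv.

Lemma bundle_cover e : exists i, bundle_dom i e.
Proof.
have [U [psi [Ux hpsi]]] := hcov (tag e); have [c dc] := hcM.1 (tag e).
by exists (exist _ (U, psi) hpsi, c).
Qed.

Lemma bundle_has_charts : has_charts bundle_manifold.
Proof.
exact: (glued_has_charts bundle_model_hausdorff open_bundle_img bundle_funK bundle_invK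
  bundle_cover bundle_transition).
Qed.

Lemma bundle_Cr_manifold : is_Cr_manifold r bundle_manifold.
Proof.
apply: (glued_Cr_manifold bundle_model_hausdorff open_bundle_img bundle_funK bundle_invK
  bundle_cover bundle_transition).
have hHM : hausdorff_space (mspace mM) by case: hM.
apply: (glued_hausdorff bundle_model_hausdorff open_bundle_img bundle_funK bundle_invK
  bundle_cover bundle_transition (B := mspace mM)
  (p := fun e : bundle_total Et => tag e : mspace mM) hHM).
- move=> i [y v] [/= iy Uy]; have [_ [_ oi] [_ ci] _ _] := hcM.2 i.2.
  apply: (@continuous_comp _ _ (mspace mM) fst (chart_inv (mfd_chart mM i.2))); first exact: cvg_fst.
  exact: (within_contP _ oi).1.
- by move=> x y e; have [i di] := bundle_cover x; exists i; split=> //; rewrite /bundle_dom /= -e.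
Qed.

Lemma bundle_base i : smooth_into r mM (bundle_img i) (fun y => tag (bundle_inv i y)).
Proof.
have hc : hausdorff_space (chart_model (mfd_chart mM i.2)) by have [] := hcM.2 i.2.
apply: (smooth_into_pre hcM (l := fst) hc _ _ (smooth_into_inv i.2 hM)); first by move=> y [].
by apply: Cr_lin => //; [exact: open_bundle_img|exact: cont_fst].
Qed.

Lemma bundle_tag : Cr_map r bundle_manifold mM setT (fun e => tag e).
Proof.
apply: Cr_map_of_charts => //; [exact: bundle_has_charts|exact: openT|].
move=> i; apply: (smooth_into_sub hcM _ _ _ (bundle_base i)) => //; last by move=> y [].
exact: is_chart_inv_open (bundle_has_charts.2 i) openT.
Qed.

Lemma open_bundle_tag (U : set M) : open (U : set (mspace mM)) ->
  open ([set e | U (tag e)] : set (mspace bundle_manifold)).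
Proof.
move=> oU; have [_ ct _] := bundle_tag.
rewrite [X in open X](_ : _ = [set e | setT e /\ U (tag e)]); last by apply/seteqP; split=> e // [].
apply: (@open_preim (mspace bundle_manifold) (mspace mM)) => //; first exact: openT.
exact: (within_contP _ openT).1.
Qed.

Lemma bundle_triv U psi : is_local_triv h mM r mE U psi ->
  is_local_triv h mM r bundle_manifold U (ext_triv jF jE psi).
Proof.
move=> hpsi; have [oU _ _ _ _] := hpsi.
have hFt' : hausdorff_space (restr h Ft) := hFt.
have hP := prod_has_charts hcM (tvs_has_charts hFt').
have oEU := open_bundle_tag oU.
split=> //.
- apply: Cr_map_of_charts => //; first exact: bundle_has_charts.
  move=> i; have oS := is_chart_inv_open (bundle_has_charts.2 i) oEU.
  apply: (smooth_into_pair hcM (tvs_has_charts hFt') (f := fun y => tag (bundle_inv i y))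
    (g := fun y => part_ext psi (tagged (bundle_inv i y)))).
  + by apply: (smooth_into_sub hcM oS _ _ (bundle_base i)) => // y [].
  + apply: smooth_into_tvs => //.
    pose W : set (mspace mM) := [set x | (sval i.1).1 x /\ U x].
    have oW : open W by apply: open_inter => //; case: (svalP i.1).
    have oD := open_bundle_base i oW.
    apply: (Cr_sub hFt' oS _ _ (inv_ext_coordinate hpsi oD _)) => //.
    * by move=> [y v] [[/= iy Uy] Uy'].
    * by move=> y [iy []].
- exists (fun p => existT _ p.1 (inv_ext psi p.1 p.2)); split.
  + apply: Cr_map_of_charts => //; first exact: bundle_has_charts.
      by apply: (@open_prod (mspace mM) (restr h Ft)) => //; exact: openT.
    (* Read in the chart c of the base, the inverse of the extended trivialization is the inverse of
       the bundle chart given by psi and c. *)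
    move=> [c []]; pose i : triv_index * mfd_index mM := (exist _ (U, psi) hpsi, c).
    have oUT : open (U `*` setT : set (mspace mM * restr h Ft)).
      by apply: (@open_prod (mspace mM) (restr h Ft)) => //; exact: openT.
    have oS := is_chart_inv_open (hP.2 (c, tt)) oUT.
    have si : smooth_into r bundle_manifold (bundle_img i) (bundle_inv i).
      exact: (@smooth_into_inv R K r _ bundle_manifold i bundle_Cr_manifold).
    apply: (@smooth_into_sub R K r (bundle_model i) _ _ bundle_has_charts _ _ _ _ oS _ _ si) => //.
    by move=> [y v] [[iy _] [Uy _]].
  + move=> [x w] /= Ux; split=> //; rewrite /ext_triv /=.
    by congr existT; exact: (part_extK hpsi w Ux).
  + move=> [x v] /= Ux; split=> //; rewrite /ext_triv /=.
    by congr (_, _); exact: (inv_extK hpsi v Ux).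
- move=> x Ux; apply/seteqP; split=> [_ [e /= ex <-]//|[x' v] [/= -> _]].
  exists (existT _ x (inv_ext psi x v)) => //; rewrite /ext_triv /=.
  by congr (_, _); exact: (inv_extK hpsi v Ux).
- by move=> x Ux; have [] := part_extP hpsi Ux.
Qed.

(** * The extended action *)

Section action.
Context (G : groupType) (mG : manifold R K G) (alpha : G -> M -> M).
Context (beta : forall g x, E x -> E (alpha g x)).
Arguments beta : clear implicits.
Arguments ext_action {R L G M alpha E} beta {Et} jE g x _.
Hypotheses (hG : has_charts mG) (halpha : is_Cr_action r mG mM alpha).
Hypotheses (hbeta : is_Cr_action r mG mE (total_action beta)).
Hypothesis lbeta : forall g x, linear (beta g x).

Lemma fibre_action_open g x (N : set (E (alpha g x))) :
  fibre_open mE N -> fibre_open mE (beta g x @^-1` N).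
Proof.
move=> [N' oN' ->]; have [_ _ [_ cb _]] := hbeta.
exists ([set e | setT e /\ N' (total_action beta g e)] : set (mspace mE)).
  apply: (@open_preim (mspace mE) (mspace mE) setT (total_action beta g)) => //; first exact: openT.
  move=> e _; apply: (@continuous_comp (mspace mE) (mspace mG * mspace mE)%type (mspace mE)
    (fun e => (g, e)) (fun p => total_action beta p.1 p.2)).
    by apply: (@cont_pair_at (mspace mE) (mspace mG) (mspace mE) (fun=> g) id); [exact: cvg_cst|exact: cvg_id].
  exact: (within_contP _ openT).1.
by apply/seteqP; split=> w //= [].
Qed.

Lemma ext_actionP g x : [/\ linear (ext_action beta jE g x), continuous (ext_action beta jE g x) &
  forall w, ext_action beta jE g x (jE x w) = jE (alpha g x) (beta g x w)].
Proof.
by apply: (cont_extP (hjE x) (hjE (alpha g x)) (@lbeta g x)) => N; exact: fibre_action_open.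
Qed.

(** The laws of alpha equate base points only propositionally, so the fibres over y1 and y2 are
    different types. The maps are compared in the total space, and by density once y1 = y2 is
    eliminated. *)
Lemma total_ext_eq x y1 y2 (b1 : E x -> E y1) (b2 : E x -> E y2)
    (g1 : Et x -> Et y1) (g2 : Et x -> Et y2) :
  continuous g1 -> continuous g2 ->
  (forall v, g1 (jE x v) = jE y1 (b1 v)) -> (forall v, g2 (jE x v) = jE y2 (b2 v)) ->
  y1 = y2 -> (forall v, existT E y1 (b1 v) = existT E y2 (b2 v)) ->
  forall w, existT Et y1 (g1 w) = existT Et y2 (g2 w).
Proof.
move=> c1 c2 e1 e2 e12; case: y2 / e12 b2 g2 c2 e2 => b2 g2 c2 e2 e w; congr existT.
have [_ _ _ _ dj] := hjE x.
have := @dense_eq R L (E x) (Et x) (Et y1) (jE x) g1 g2 dj (@hEt y1) c1 c2.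
move=> /(_ _)/(congr1 (@^~ w)); apply => v.
by rewrite e1 e2 (existT_inj (e v)).
Qed.

Lemma total_ext_action1 e : total_action (ext_action beta jE) 1%g e = e.
Proof.
case: e => x w; rewrite /total_action /=; have [_ c e] := ext_actionP 1%g x.
have [a1 _ _] := halpha; have [b1 _ _] := hbeta.
apply: (total_ext_eq (b1 := beta 1%g x) (b2 := id) (g2 := id) c (@cont_id _) e) => // v.
exact: b1 (existT _ x v).
Qed.

Lemma total_ext_actionM g k e : total_action (ext_action beta jE) (g * k)%g e =
  total_action (ext_action beta jE) g (total_action (ext_action beta jE) k e).
Proof.
case: e => x w; rewrite /total_action /=; have [_ c e] := ext_actionP (g * k)%g x.
have [_ c1 e1] := ext_actionP k x; have [_ c2 e2] := ext_actionP g (alpha k x).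
have [_ aM _] := halpha; have [_ bM _] := hbeta.
apply: (total_ext_eq (b1 := beta (g * k)%g x) (b2 := beta g (alpha k x) \o beta k x)
  (g2 := ext_action beta jE g (alpha k x) \o ext_action beta jE k x) c (cont_comp c1 c2) e) => //.
- by move=> v; rewrite /= e1 e2.
- by move=> v; exact: bM g k (existT _ x v).
Qed.

Lemma ext_action_Cr_map : Cr_map r (prod_manifold mG bundle_manifold) bundle_manifold setT
  (fun p => total_action (ext_action beta jE) p.1 p.2).
Proof.
have hGB := prod_has_charts hG bundle_has_charts.
apply: (Cr_map_of_charts hGB bundle_has_charts openT) => -[kG i].
have oS := is_chart_inv_open (hGB.2 (kG, i)) openT; split=> // j.
have [_ _ sa] := halpha; have [_ _ sb] := hbeta.
have [hg [_ ogi] _ _ _] := hG.2 kG; have [hc [_ oci] _ _ _] := hcM.2 i.2.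
have [hc' [ocd' _] _ _ _] := hcM.2 j.2.
pose cG := mfd_chart mG kG; pose c := mfd_chart mM i.2; pose c' := mfd_chart mM j.2.
pose X : tvsType (fld R K) := (chart_model cG * chart_model c)%type.
have hX : hausdorff_space X := hausdorff_prod hg hc.
pose S0 : set X := chart_img cG `*` [set y | chart_img c y /\ (sval i.1).1 (chart_inv c y)].
have oS0 : open S0.
  by apply: open_prod => //; apply: open_bundle_base; case: (svalP i.1).
pose a (q : X) := chart_inv c q.2.
pose a' (q : X) := alpha (chart_inv cG q.1) (a q).
(* [hG] gives no transition maps of class C^r on G, so this map is tested in the chart [kG]
   alone. *)
have sG (D : set X) : open D -> D `<=` S0 -> chartwise r mG D (chart_inv cG \o fst).
  move=> oD DS; apply: (chartwise_inv hG (i := kG) (l := fst)); first by move=> q /DS[].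
  by apply: Cr_lin => //; exact: cont_fst.
have sM (D : set X) : open D -> D `<=` S0 -> smooth_into r mM D a.
  move=> oD DS; apply: (smooth_into_pre hcM (l := snd) hc _ _ (smooth_into_inv i.2 hM)).
    by move=> q /DS[_ []].
  by apply: Cr_lin => //; exact: cont_snd.
have sa' : smooth_into r mM S0 a'.
  have sp := chartwise_pair hG hcM (sG S0 oS0 (fun _ h => h)) (smooth_into_chartwise hcM (sM S0 oS0 (fun _ h => h))).
  exact: (smooth_into_comp (prod_has_charts hG hcM) hcM.2 _ sp sa).
pose W : set (mspace mM) := [set x | (sval j.1).1 x /\ chart_dom c' x].
have oW : open W by apply: open_inter => //; case: (svalP j.1).
pose D := [set q | S0 q /\ W (a' q)].
have oD : open D.
  apply: (@open_preim X (mspace mM) S0 a') => //.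
  exact: (chartwise_cont hcM (smooth_into_chartwise hcM sa')).
have DS : D `<=` S0 by move=> q [].
pose f (z : X * restr h Ft) : bundle_model j := (chart_fun c' (a' z.1),
  part_ext (sval j.1).2 (ext_action beta jE (chart_inv cG z.1.1) (a z.1)
    (inv_ext (sval i.1).2 (a z.1) z.2))).
have oDT : open (D `*` [set: restr h Ft]) by apply: open_prod => //; exact: openT.
have hf : Cr r (D `*` [set: restr h Ft]) f.
  apply: Cr_pair => //.
    have [_ /(_ j.2) hj] := sa'.
    apply: (@Cr_comp _ _ _ _ _ _ _ _ fst _ hX hc' _ _ hj); first by move=> [q v] [[? []]].
    by apply: Cr_lin => //; exact: cont_fst.
  apply: (ext_coordinate (b := fun q => beta (chart_inv cG q.1) (a q))
    (bt := fun q => ext_action beta jE (chart_inv cG q.1) (a q)) (svalP i.1) (svalP j.1) oD).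
  - by move=> q [[_ []]].
  - by move=> q [_ []].
  - by move=> q _; exact: lbeta.
  - by move=> q _; exact: ext_actionP.
  - have DU q : D q -> (sval i.1).1 (a q) by move=> [[_ []]].
    have st := smooth_triv_inv hF hcM hcE (svalP i.1) hX DU (sM D oD DS).
    have oDF : open (D `*` [set: restr h F]) by apply: open_prod => //; exact: openT.
    have sg : chartwise r mG (D `*` [set: restr h F]) (chart_inv cG \o (fst \o fst)).
      apply: (chartwise_inv hG (i := kG) (l := fst \o fst)); first by move=> [q v] [/DS[]].
      apply: Cr_lin => //; apply: cont_comp; exact: cont_fst.
    have sp := chartwise_pair hG hcE sg (smooth_into_chartwise hcE st).
    exact: (smooth_into_comp (prod_has_charts hG hcE) hcE.2 _ sp sb).
(* Groups the coordinates of G and M into one base, as the fibrewise extension requires the fibre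
   variable to stand alone. *)
pose sigma (p : chart_model cG * bundle_model i) : X * restr h Ft := ((p.1, p.2.1), p.2.2).
have hBj := @bundle_model_hausdorff j.
have lsigma : linear sigma by [].
have csigma : continuous sigma.
  have c1 : continuous (fun p : chart_model cG * bundle_model i => p.2) by exact: cont_snd.
  apply: cont_pair; first (apply: cont_pair; first exact: cont_fst).
    exact: cont_comp c1 (@cont_fst _ _ _ _).
  exact: cont_comp c1 (@cont_snd _ _ _ _).
have -> : [set x | [set y | chart_img (mfd_chart (prod_manifold mG bundle_manifold) (kG, i)) y /\
     [set: G * bundle_total Et] (chart_inv (mfd_chart (prod_manifold mG bundle_manifold) (kG, i)) y)] x /\
   chart_dom (mfd_chart bundle_manifold j) (((fun p => total_action (ext_action beta jE) p.1 p.2) \o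
     chart_inv (mfd_chart (prod_manifold mG bundle_manifold) (kG, i))) x)] =
   [set p | setT p /\ (D `*` [set: restr h Ft]) (sigma p)].
  apply/seteqP; split=> -[g [y v]].
    by move=> [[[/= ig [iy Uy]] _] [Uy' dy]].
  by move=> [_ [[[/= ig [iy Uy]] [Uy' dy]] _]].
apply: (@Cr_comp R K r _ _ _ _ (D `*` [set: restr h Ft]) sigma f _ hBj) => //.
- exact: hausdorff_prod hX hFt.
- by move=> p [].
- apply: Cr_lin => //; first exact: hausdorff_prod hX hFt.
  by apply: open_preim => //; [exact: openT|move=> p _; exact: csigma].
Qed.

Lemma ext_action_Cr : is_Cr_action r mG bundle_manifold (total_action (ext_action beta jE)).
Proof. split; [exact: total_ext_action1|exact: total_ext_actionM|exact: ext_action_Cr_map]. Qed.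

End action.
End bundle_manifold.
End extended_trivializations.

(** * From class C^r to class C^(r-1) *)

Section weakening.
Context {R : realType} {K : scalars} (r : smoothness).

Lemma Cr_manifold_pred (T : Type) (m : manifold R K T) :
  is_Cr_manifold r m -> is_Cr_manifold (pred_smooth r) m.
Proof. by move=> [hT cov ch tr]; split=> // i j; exact: Cr_pred (tr i j). Qed.

Lemma Cr_map_pred (T T' : Type) (m : manifold R K T) (m' : manifold R K T') W f :
  Cr_map r m m' W f -> Cr_map (pred_smooth r) m m' W f.
Proof. by move=> [oW cf hf]; split=> // i j; exact: Cr_pred (hf i j). Qed.

Lemma Cr_action_pred (G : groupType) (mG : manifold R K G) (T : Type) (m : manifold R K T) a :
  is_Cr_action r mG m a -> is_Cr_action (pred_smooth r) mG m a.
Proof. by move=> [a1 aM ca]; split=> //; exact: Cr_map_pred. Qed.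

Lemma local_triv_pred (L : scalars) (h : K = RealScalars \/ K = L) (M : Type) (mM : manifold R K M)
    (F : tvsType (fld R L)) (E : M -> lmodType (fld R L)) (mE : manifold R K (bundle_total E)) U
    (psi : bundle_total E -> M * F) :
  is_local_triv h mM r mE U psi -> is_local_triv h mM (pred_smooth r) mE U psi.
Proof.
move=> [oU cpsi [phi [cphi phiK psiK]] im lin]; split=> //; first exact: Cr_map_pred.
by exists phi; split=> //; exact: Cr_map_pred.
Qed.

End weakening.

Theorem proposition6p2
  (R : realType) (K L : scalars) (hKL : K = RealScalars \/ K = L)
  (s r : smoothness) (hs : s = Infty \/ s = Omega)
  (hr : r <> Fin 0) (hrs : le_smooth r s)
  (G : groupType) (mG : manifold R K G) (hG : is_Lie_group s mG)
  (M : Type) (mM : manifold R K M) (hM : is_Cr_manifold r mM)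
  (alpha : G -> M -> M) (halpha : is_Cr_action r mG mM alpha)
  (F : tvsType (fld R L)) (hF : hausdorff_space F)
  (E : M -> lmodType (fld R L)) (mE : manifold R K (bundle_total E))
  (beta : forall g x, E x -> E (alpha g x))
  (hE : is_equivariant_bundle hKL mM r mG F mE beta)
  (Ft : tvsType (fld R L)) (jF : F -> Ft)
  (hjF : is_completion (fun O : set F => open O) jF)
  (Et : M -> tvsType (fld R L)) (jE : forall x, E x -> Et x)
  (hjE : forall x, is_completion (@fibre_open R K L M E mE x) (jE x)) :
  exists mEt : manifold R K (bundle_total Et),
    is_equivariant_bundle hKL mM (pred_smooth r) mG Ft mEt
      (ext_action beta jE) /\
    forall (U : set M) (psi : bundle_total E -> M * F),
      is_local_triv hKL mM r mE U psi ->
      is_local_triv hKL mM (pred_smooth r) mEt U (ext_triv jF jE psi).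
Proof.
have [hvb hbeta lbeta] := hE; have [hmE _ _ hcov] := hvb.
exists (bundle_manifold hKL mM r mE jF jE); split; last first.
  by move=> U psi hpsi; apply/local_triv_pred/bundle_triv.
split; last by move=> g x; have [] := ext_actionP hjE hbeta lbeta g x.
- split.
  + exact/Cr_manifold_pred/bundle_Cr_manifold.
  + exact/Cr_map_pred/bundle_tag.
  + by move=> x; exists (existT _ x (0 : Et x)).
  + move=> x; have [U [psi [Ux hpsi]]] := hcov x; exists U, (ext_triv jF jE psi); split=> //.
    by apply/local_triv_pred/bundle_triv.
- exact/Cr_action_pred/(ext_action_Cr hF hM hmE hjF hjE hcov (Lie_group_charts hG) halpha hbeta lbeta).
Qed.
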